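(* Let $X$ be a smooth projective toric variety, and let $P$ be a lattice polytope representing an ample toric line bundle on $X$. (1) The Białynicki-Birula decomposition of $X$ is a stratification for some admissible cocharacter if and only if $P$ has the combinatorial type of a product of simplices. (2) The Białynicki-Birula decomposition of $X$ is a stratification for all admissible cocharacters if and only if $P$ is a product of simplices, up to a unimodular transformation.
   Context: Work over an algebraically closed field $\mathbb{K}$. Let $T\cong\mathbb{G}_m^n$ be the dense torus of $X$, $M=\mathrm{Hom}(T,\mathbb{G}_m)$ its character lattice and $N=\mathrm{Hom}(\mathbb{G}_m,T)$ its cocharacter lattice. The polytope $P\subset M_{\mathbb{R}}=M\otimes\mathbb{R}$ is a full-dimensional lattice polytope whose outer normal fan in $N_{\mathbb{R}}$ is the fan of $X$; faces $F$ of $P$ correspond (inclusion- and dimension-preservingly) to $T$-orbit closures in $X$. Smoothness of $X$ means that at every vertex of $P$ the primitive edge directions form a $\mathbb{Z}$-basis of $M$. A cocharacter $v\in N$ is admissible if the induced $\mathbb{G}_m$-action on $X$ has finite fixed locus, equivalently $X^{\mathbb{G}_m}=X^T$ (equivalently, $v$ is not perpendicular to any edge of $P$). An admissible $v$ makes $X$ a $\mathbb{G}_m$-variety with (positive) Białynicki-Birula decomposition $X=\bigsqcup_{p\in X^{\mathbb{G}_m}}X_p^+$, $X_p^+=\{x\in X:\lim_{t\to0}v(t)\cdot x=p\}$. It is a stratification if the closure of each cell is a union of cells. Two polytopes have the same combinatorial type if their face lattices are isomorphic. A unimodular transformation is a lattice-preserving (bijective) affine-linear map; two lattice polytopes are unimodularly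 equivalent if each can be mapped bijectively onto the other by a lattice-preserving affine-linear map. *)

(* Defs.v *)
From HB Require Import structures.
From mathcomp Require Import all_boot all_order all_algebra.
From mathcomp Require Import boolp classical_sets functions cardinality reals.

Set Implicit Arguments.
Unset Strict Implicit.
Unset Printing Implicit Defensive.
Import Order.TTheory GRing.Theory Num.Theory.
Local Open Scope classical_set_scope.
Local Open Scope ring_scope.

(* A basis of the torus T = G_m^n is fixed, so that both the character lattice
   M and the cocharacter lattice N are 'rV[int]_n, in duality through [pairing],
   and M_R, N_R are 'rV[R]_n. *)

Definition pairing (A : pzRingType) (n : nat) (m u : 'rV[A]_n) : A :=
  \sum_(i < n) m 0 i * u 0 i.

Definition real_mx (R : realType) (k n : nat) (A : 'M[int]_(k, n)) :
  'M[R]_(k, n) := map_mx intr A.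
Arguments real_mx R {k n} A.

Section Polytopes.
Variable R : realType.

Definition conv_rows (k n : nat) (A : 'M[R]_(k, n)) : set 'rV[R]_n :=
  [set x | exists w : 'rV[R]_k,
     [/\ forall i, 0 <= w 0 i, \sum_i w 0 i = 1 & x = w *m A]].

(* The rows of A are affinely independent. *)
Definition affinely_independent (k n : nat) (A : 'M[R]_(k, n)) : Prop :=
  row_free (row_mx (const_mx 1 : 'cV[R]_k) A).

Definition lattice_polytope (n : nat) (P : set 'rV[R]_n) : Prop :=
  exists (k : nat) (A : 'M[int]_(k, n)), P = conv_rows (real_mx R A).

Definition full_dimensional (n : nat) (P : set 'rV[R]_n) : Prop :=
  exists A : 'M[R]_(n.+1, n),
    affinely_independent A /\ forall i, P (row i A).

Definition is_face (n : nat) (P F : set 'rV[R]_n) : Prop :=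
  F = set0 \/
  exists u : 'rV[R]_n,
    F = [set x | P x /\ forall y, P y -> pairing y u <= pairing x u].

Definition is_vertex (n : nat) (P : set 'rV[R]_n) (p : 'rV[R]_n) : Prop :=
  is_face P [set p].

Definition is_edge (n : nat) (P : set 'rV[R]_n) (p q : 'rV[R]_n) : Prop :=
  p <> q /\ is_face P (conv_rows (col_mx p q)).

Definition same_combinatorial_type (n m : nat)
    (P : set 'rV[R]_n) (Q : set 'rV[R]_m) : Prop :=
  exists f : set 'rV[R]_n -> set 'rV[R]_m,
    [/\ forall F, is_face P F -> is_face Q (f F),
        forall F G, is_face P F -> is_face P G -> (F `<=` G <-> f F `<=` f G)
      & forall G, is_face Q G -> exists2 F, is_face P F & f F = G].

(* A matrix with a two-sided inverse over the integers forces n = m. *)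
Definition unimodularly_equivalent (n m : nat)
    (P : set 'rV[R]_n) (Q : set 'rV[R]_m) : Prop :=
  exists (A : 'M[int]_(n, m)) (B : 'M[int]_(m, n)) (b : 'rV[int]_m),
    [/\ A *m B = 1%:M, B *m A = 1%:M
      & Q = [set x *m real_mx R A + real_mx R b | x in P]].

Definition is_simplex (n : nat) (S : set 'rV[R]_n) : Prop :=
  exists (k : nat) (A : 'M[R]_(k.+1, n)),
    affinely_independent A /\ S = conv_rows A.

(* Simplices with arbitrary real vertices are allowed: if the product is
   unimodularly equivalent to a lattice polytope, then every factor is a
   full-dimensional lattice simplex. *)
Definition is_product_of_simplices (r : nat) (d : 'I_r -> nat)
    (Q : set 'rV[R]_(\sum_(i < r) d i)) : Prop :=
  exists S : forall i, set 'rV[R]_(d i),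
    (forall i, is_simplex (S i)) /\ Q = [set x | forall i, S i (submxrow x i)].

Definition combinatorial_product_of_simplices (n : nat) (P : set 'rV[R]_n) :
    Prop :=
  exists (r : nat) (d : 'I_r -> nat) (Q : set 'rV[R]_(\sum_(i < r) d i)),
    is_product_of_simplices Q /\ same_combinatorial_type P Q.

Definition unimodular_product_of_simplices (n : nat) (P : set 'rV[R]_n) :
    Prop :=
  exists (r : nat) (d : 'I_r -> nat) (Q : set 'rV[R]_(\sum_(i < r) d i)),
    is_product_of_simplices Q /\ unimodularly_equivalent P Q.

Definition primitive (n : nat) (w : 'rV[int]_n) : Prop :=
  w <> 0 /\ forall (k : int) (w' : 'rV[int]_n), w = k *: w' -> `|k| = 1.

Definition primitive_edge_direction (n : nat) (P : set 'rV[R]_n)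
    (p : 'rV[R]_n) (w : 'rV[int]_n) : Prop :=
  primitive w /\
  exists (q : 'rV[R]_n) (c : R),
    [/\ is_edge P p q, 0 < c & q = p + c *: real_mx R w].

Definition smooth_polytope (n : nat) (P : set 'rV[R]_n) : Prop :=
  forall p, is_vertex P p ->
    exists B : 'M[int]_n, B \in unitmx /\
      forall w, primitive_edge_direction P p w <-> exists i, w = row i B.

Definition outer_normal_cone (n : nat) (P F : set 'rV[R]_n) : set 'rV[R]_n :=
  [set u | forall x y, F x -> P y -> pairing y u <= pairing x u].

Definition outer_normal_fan (n : nat) (P : set 'rV[R]_n) :
    set (set 'rV[R]_n) :=
  [set s | exists F, [/\ is_face P F, F !=set0 & s = outer_normal_cone P F]].

End Polytopes.

(* The toric variety X_Sigma of a fan Sigma over an algebraically closed field K,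
   as the set of its K-points with the Zariski topology and the torus action.
   It is glued from the affine charts U_s = Spec K[S_s], s in Sigma, where S_s
   is the monoid of lattice points of the dual cone of s; K-points of U_s are
   the homomorphisms from S_s to the multiplicative monoid of K. *)
Section ToricVariety.
Variables (R : realType) (K : fieldType) (n : nat).

Definition dual_monoid (s : set 'rV[R]_n) : set 'rV[int]_n :=
  [set m | forall u, s u -> 0 <= pairing (real_mx R m) u].

(* A homomorphism on S is represented by a function on all of M that vanishes
   outside S, so that distinct functions are distinct homomorphisms. *)
Definition monoid_hom (S : set 'rV[int]_n) (g : 'rV[int]_n -> K) : Prop :=
  [/\ g 0 = 1,
      forall m m', S m -> S m' -> g (m + m') = g m * g m'
    & forall m, ~ S m -> g m = 0].

Definition chart_point : Type := (set 'rV[R]_n * ('rV[int]_n -> K))%type.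

Definition is_chart_point (Sigma : set (set 'rV[R]_n)) (c : chart_point) :
    Prop :=
  Sigma c.1 /\ monoid_hom (dual_monoid c.1) c.2.

(* Two chart points are identified when they are the images of one point of
   U_(s `&` t) under the open embeddings into U_s and U_t. *)
Definition glued (c d : chart_point) : Prop :=
  exists g, [/\ monoid_hom (dual_monoid (c.1 `&` d.1)) g,
                forall m, dual_monoid c.1 m -> g m = c.2 m
              & forall m, dual_monoid d.1 m -> g m = d.2 m].

(* A point of X_Sigma is a gluing class of chart points. *)
Definition toric_point : Type := set chart_point.

Definition class_of (Sigma : set (set 'rV[R]_n)) (c : chart_point) :
    toric_point :=
  [set d | is_chart_point Sigma d /\ glued c d].

Definition toric_variety (Sigma : set (set 'rV[R]_n)) : set toric_point :=
  [set x | exists2 c, is_chart_point Sigma c & x = class_of Sigma c].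

(* The list of the (a, m) stands for the Laurent polynomial sum of a * chi^m. *)
Definition laurent : Type := seq (K * 'rV[int]_n).

Definition regular_on (s : set 'rV[R]_n) (f : laurent) : Prop :=
  forall a, a \in f -> dual_monoid s a.2.

Definition laurent_eval (f : laurent) (g : 'rV[int]_n -> K) : K :=
  \sum_(a <- f) a.1 * g a.2.

Definition zariski_closed (Sigma : set (set 'rV[R]_n)) (Z : set toric_point) :
    Prop :=
  Z `<=` toric_variety Sigma /\
  forall s, Sigma s ->
    exists I : set laurent,
      (forall f, I f -> regular_on s f) /\
      forall g, monoid_hom (dual_monoid s) g ->
        (Z (class_of Sigma (s, g)) <-> forall f, I f -> laurent_eval f g = 0).

Definition zariski_closure (Sigma : set (set 'rV[R]_n)) (A : set toric_point) :
    set toric_point :=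
  [set x | toric_variety Sigma x /\
           forall Z, zariski_closed Sigma Z -> A `<=` Z -> Z x].

(* The point v(t) of T acts on the coordinate chi^m through t ^ <m, v>. *)
Definition cochar_act (v : 'rV[int]_n) (t : K) (x : toric_point) :
    toric_point :=
  [set (c.1, fun m => t ^ pairing m v * c.2 m) | c in x].

Definition fixed_locus (Sigma : set (set 'rV[R]_n)) (v : 'rV[int]_n) :
    set toric_point :=
  [set x | toric_variety Sigma x /\ forall t : K, t != 0 -> cochar_act v t x = x].

Definition admissible (Sigma : set (set 'rV[R]_n)) (v : 'rV[int]_n) : Prop :=
  finite_set (fixed_locus Sigma v).

(* The morphism t |-> v(t) x from G_m to X extends to A^1 with value p at 0.
   As each chart is stable under the action, an extension maps A^1 into any
   chart that contains p, that is, every regular function chi^m of the chart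
   pulls back to a polynomial in t. *)
Definition limit_at0 (v : 'rV[int]_n) (x p : toric_point) : Prop :=
  exists (s : set 'rV[R]_n) (g h : 'rV[int]_n -> K),
    [/\ x (s, g), p (s, h)
      & forall m, dual_monoid s m ->
          exists f : {poly K},
            (forall t, t != 0 -> f.[t] = t ^ pairing m v * g m) /\
            f.[0] = h m].

Definition bb_cell (Sigma : set (set 'rV[R]_n)) (v : 'rV[int]_n)
    (p : toric_point) : set toric_point :=
  [set x | toric_variety Sigma x /\ limit_at0 v x p].

Definition bb_stratification (Sigma : set (set 'rV[R]_n)) (v : 'rV[int]_n) :
    Prop :=
  forall p, fixed_locus Sigma v p ->
    exists I : set toric_point,
      I `<=` fixed_locus Sigma v /\
      zariski_closure Sigma (bb_cell Sigma v p) =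
        \bigcup_(q in I) bb_cell Sigma v q.

End ToricVariety.

Arguments admissible {R} K {n} Sigma v.
Arguments bb_stratification {R} K {n} Sigma v.

(* Main.v *)
(* The closure of the cell of a vertex p is the orbit closure of the face F_p
   spanned at p by the edges along which v decreases, so the decomposition is a
   stratification if and only if q in F_p implies F_q included in F_p.  On a
   2-face this condition allows no polygon with more than four sides.  Crossing
   an edge therefore exchanges two facets without disturbing the others, which
   divides the facets into classes such that every vertex misses exactly one
   facet of each class and any choice of the missed facets occurs: P is
   combinatorially a product of simplices.  Conversely, for such a P, Batyrev's
   argument on a relation of minimal degree finds a class whose normals sum to
   zero modulo the span of the normals of the classes already chosen; giving
   rapidly decreasing weights to the classes in this order yields a v for which
   F_p is described by comparing labels of facets, so that the condition holds.
   If the condition holds for every v, then transporting an edge along an edge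
   of another class cannot tilt it, hence the normals of each class sum to zero
   and P is a product of simplices up to a unimodular transformation. *)

Require Import Defs.
From mathcomp Require Import all_boot all_order all_algebra.
From mathcomp Require Import boolp classical_sets functions cardinality reals.
From mathcomp Require Import ring lra zify.

Set Implicit Arguments.
Unset Strict Implicit.
Unset Printing Implicit Defensive.
Import Order.TTheory GRing.Theory Num.Theory.
Local Open Scope ring_scope.

(** Two finite descriptions carry the geometry. The polytope becomes integral data at its vertices,
    where lying on a facet is the vanishing of one coordinate. A point of the variety is seen
    through its support, the set of vertices whose charts contain it; cells and their closures are
    determined by supports, and of the Zariski topology only the density of a cell along
    one-parameter curves is used.

    A 2-face has at most four sides because each of its vertices other than the v-highest and the
    v-lowest must be adjacent to both of these, while each of these has only two neighbours.

    Batyrev's argument needs a degree on relations. The polytope supplies one: a facet counts with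
    the sum of its distances from the vertices of a fibre. Replacing a full class in a relation by
    an equivalent nonnegative combination of normals at one vertex lowers the degree, because that
    vertex misses a facet of the class.

    A product of simplices may contain points as factors. So a class may consist of one label that
    every vertex misses; it is not a facet, and its normal is 0. *)

Lemma fin_argmax (d : Order.disp_t) (U : orderType d) (T : finType) (P : pred T)
  (f : T -> U) (t0 : T) : P t0 -> exists2 t, P t & forall s, P s -> (f s <= f t)%O.
Proof.
by move=> P0; exists [arg max_(t > t0 | P t) f t]%O; case: arg_maxP.
Qed.

(** * Bilinearity of the pairing and passage from integral to real vectors *)

Section Pairing.
Variables (A : comPzRingType) (n : nat).
Implicit Types x y u : 'rV[A]_n.

Lemma pairingE x u : pairing x u = (x *m u^T) 0 0.
Proof. by rewrite mxE; apply: eq_bigr => i _; rewrite mxE. Qed.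

Lemma pairingC x u : pairing x u = pairing u x.
Proof. by apply: eq_bigr => i _; rewrite mulrC. Qed.

Lemma pairingDl x y u : pairing (x + y) u = pairing x u + pairing y u.
Proof. by rewrite !pairingE mulmxDl mxE. Qed.

Lemma pairingNl x u : pairing (- x) u = - pairing x u.
Proof. by rewrite !pairingE mulNmx mxE. Qed.

Lemma pairingBl x y u : pairing (x - y) u = pairing x u - pairing y u.
Proof. by rewrite pairingDl pairingNl. Qed.

Lemma pairingZl a x u : pairing (a *: x) u = a * pairing x u.
Proof. by rewrite !pairingE -scalemxAl mxE. Qed.

Lemma pairing0l u : pairing 0 u = 0.
Proof. by rewrite pairingE mul0mx mxE. Qed.

Lemma pairing_suml (I : Type) (r : seq I) (P : pred I) (F : I -> 'rV[A]_n) u :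
  pairing (\sum_(i <- r | P i) F i) u = \sum_(i <- r | P i) pairing (F i) u.
Proof. by rewrite pairingE mulmx_suml summxE; apply: eq_bigr => i _; rewrite pairingE. Qed.

Lemma pairingDr u x y : pairing u (x + y) = pairing u x + pairing u y.
Proof. by rewrite pairingC pairingDl !(pairingC u). Qed.

Lemma pairingNr u x : pairing u (- x) = - pairing u x.
Proof. by rewrite pairingC pairingNl (pairingC u). Qed.

Lemma pairingBr u x y : pairing u (x - y) = pairing u x - pairing u y.
Proof. by rewrite pairingDr pairingNr. Qed.

Lemma pairingZr u a x : pairing u (a *: x) = a * pairing u x.
Proof. by rewrite pairingC pairingZl pairingC. Qed.

Lemma pairing0r u : pairing u 0 = 0.
Proof. by rewrite pairingC pairing0l. Qed.

Lemma pairing_sumr (I : Type) (r : seq I) (P : pred I) (F : I -> 'rV[A]_n) u :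
  pairing u (\sum_(i <- r | P i) F i) = \sum_(i <- r | P i) pairing u (F i).
Proof. by rewrite pairingC pairing_suml; apply: eq_bigr => i _; rewrite pairingC. Qed.

Lemma pairing_mulmx (k : nat) x (M : 'M[A]_(n, k)) (u : 'rV[A]_k) :
  pairing (x *m M) u = pairing x (u *m M^T).
Proof. by rewrite (pairingE x) trmx_mul trmxK mulmxA [RHS]mxE; apply: eq_bigr => i _; rewrite [u^T _ _]mxE. Qed.

End Pairing.

Section RealVectors.
Variables (R : realType) (n : nat).
Implicit Types x y u : 'rV[int]_n.

Lemma real_mxD x y : real_mx R (x + y) = real_mx R x + real_mx R y.
Proof. exact: map_mxD. Qed.

Lemma real_mxB x y : real_mx R (x - y) = real_mx R x - real_mx R y.
Proof. exact: map_mxB. Qed.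

Lemma real_mxZ a x : real_mx R (a *: x) = a%:~R *: real_mx R x.
Proof. exact: map_mxZ. Qed.

Lemma real_mx0 : real_mx R (0 : 'rV[int]_n) = 0.
Proof. exact: map_mx0. Qed.

Lemma real_mx_sum (I : Type) (r : seq I) (P : pred I) (F : I -> 'rV[int]_n) :
  real_mx R (\sum_(i <- r | P i) F i) = \sum_(i <- r | P i) real_mx R (F i).
Proof. exact: (big_morph _ real_mxD real_mx0). Qed.

Lemma real_mx_inj : injective (@real_mx R 1 n).
Proof.
move=> x y /matrixP h; apply/matrixP => i j; have := h i j.
by rewrite !mxE => /eqP; rewrite eqr_int => /eqP.
Qed.

Lemma real_mxM (k m l : nat) (A : 'M[int]_(k, m)) (B : 'M[int]_(m, l)) :
  real_mx R (A *m B) = real_mx R A *m real_mx R B.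
Proof. exact: map_mxM. Qed.

Lemma pairing_real x u :
  pairing (real_mx R x) (real_mx R u) = (pairing x u)%:~R.
Proof. by rewrite /pairing rmorph_sum /=; apply: eq_bigr => i _; rewrite !mxE rmorphM. Qed.

End RealVectors.

(** * Smooth polytopes as integral vertex-edge data *)

(* Row i of [ebas p] is the primitive vector of the i-th edge at p, which leads
   to the vertex [nb p i]; [cone_ge0] says that the polytope lies in the cone
   spanned at p by its edges. *)
Record smooth_model (n : nat) (V : finType) := SmoothModel {
  pt : V -> 'rV[int]_n;
  ebas : V -> 'M[int]_n;
  nb : V -> 'I_n -> V;
  len : V -> 'I_n -> int;
  pt_inj : injective pt;
  ebas_unit : forall p, ebas p \in unitmx;
  len_gt0 : forall p i, 0 < len p i;
  pt_nb : forall p i, pt (nb p i) = pt p + len p i *: row i (ebas p);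
  cone_ge0 : forall p q i, 0 <= ((pt q - pt p) *m invmx (ebas p)) 0 i
}.

Section Model.
Variables (n : nat) (V : finType) (X : smooth_model n V).
Implicit Types (p q r : V) (i j k : 'I_n) (x u v : 'rV[int]_n).
Local Notation pt := (pt X).
Local Notation nb := (nb X).
Local Notation len := (len X).

Definition edge p i : 'rV[int]_n := row i (ebas X p).
Definition co p x i : int := (x *m invmx (ebas X p)) 0 i.
(** Up to sign the dual basis of the edges at p: [nrm p i] is the outer normal of the facet spanned
    at p by all edges but the i-th. *)
Definition nrm p i : 'rV[int]_n := - (col i (invmx (ebas X p)))^T.

Lemma edgeE p i a : edge p i 0 a = ebas X p i a.
Proof. by rewrite mxE. Qed.

Lemma nrmE p i a : nrm p i 0 a = - invmx (ebas X p) a i.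
Proof. by rewrite !mxE. Qed.

Lemma coD p x y i : co p (x + y) i = co p x i + co p y i.
Proof. by rewrite /co mulmxDl mxE. Qed.
Lemma coN p x i : co p (- x) i = - co p x i.
Proof. by rewrite /co mulNmx mxE. Qed.
Lemma coB p x y i : co p (x - y) i = co p x i - co p y i.
Proof. by rewrite coD coN. Qed.
Lemma coZ p a x i : co p (a *: x) i = a * co p x i.
Proof. by rewrite /co -scalemxAl mxE. Qed.
Lemma co0 p i : co p 0 i = 0.
Proof. by rewrite /co mul0mx mxE. Qed.

Lemma co_sum (I : Type) (r : seq I) (P : pred I) (F : I -> 'rV[int]_n) p k :
  co p (\sum_(i <- r | P i) F i) k = \sum_(i <- r | P i) co p (F i) k.
Proof.
exact: (big_morph (fun x => co p x k) (fun x y => coD p x y k) (co0 p k)).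
Qed.

Lemma co_edge p j i : co p (edge p j) i = (i == j)%:R.
Proof.
rewrite /co /edge -row_mul mulmxV ?ebas_unit // !mxE.
by rewrite eq_sym.
Qed.

Lemma pairing_nrm x p i : pairing x (nrm p i) = - co p x i.
Proof.
rewrite /nrm pairingNr pairingE trmxK /co; congr (- _).
by rewrite !mxE; apply: eq_bigr => k _; rewrite !mxE.
Qed.

Lemma pairing_edge_nrm p j i : pairing (edge p j) (nrm p i) = - (i == j)%:R.
Proof. by rewrite pairing_nrm co_edge. Qed.

Lemma coE p x : x = \sum_i co p x i *: edge p i.
Proof.
rewrite -{1}[x](mulmxKV (ebas_unit X p)) mulmx_sum_row.
by apply: eq_bigr.
Qed.

Lemma pairing_coE p x u : pairing x u = \sum_i co p x i * pairing (edge p i) u.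
Proof.
rewrite {1}(coE p x) pairing_suml.
by apply: eq_bigr => i _; rewrite pairingZl.
Qed.

Lemma co_eq0 p x : (forall i, co p x i = 0) -> x = 0.
Proof.
by move=> h; rewrite (coE p x) big1 // => i _; rewrite h scale0r.
Qed.

Lemma nrm_expand p u : u = \sum_i (- pairing (edge p i) u) *: nrm p i.
Proof.
apply/rowP => j; have := pairing_coE p (delta_mx 0 j) u.
rewrite {1}/pairing (bigD1 j) //= mxE !eqxx mul1r big1 ?addr0 => [->|k kj]; last first.
  by rewrite mxE eqxx (negPf kj) mul0r.
rewrite summxE; apply: eq_bigr => i _.
by rewrite !mxE /co -rowE mxE mulrN mulNr opprK mulrC.
Qed.

Lemma nrm_inj p : injective (nrm p).
Proof.
move=> i j eij; have := pairing_edge_nrm p i j.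
by rewrite -eij pairing_edge_nrm eqxx; case: eqP.
Qed.

Lemma cone_co p q i : 0 <= co p (pt q - pt p) i.
Proof. exact: cone_ge0. Qed.

Lemma nb_sub p i : pt (nb p i) - pt p = len p i *: edge p i.
Proof. by rewrite pt_nb addrC addKr. Qed.

Lemma co_nb p i k : co p (pt (nb p i) - pt p) k = len p i * (k == i)%:R.
Proof. by rewrite nb_sub coZ co_edge. Qed.

Lemma nb_neq p i : nb p i != p.
Proof.
apply/eqP => h; have := co_nb p i i; rewrite h subrr co0 eqxx mulr1 => /eqP.
by rewrite eq_sym gt_eqF ?len_gt0.
Qed.

Lemma nb_le p i u :
  (pairing (pt (nb p i)) u <= pairing (pt p) u) = (pairing (edge p i) u <= 0).
Proof. by rewrite -subr_le0 -pairingBl nb_sub pairingZl pmulr_rle0 ?len_gt0. Qed.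

Lemma nb_lt p i u :
  (pairing (pt (nb p i)) u < pairing (pt p) u) = (pairing (edge p i) u < 0).
Proof. by rewrite -subr_lt0 -pairingBl nb_sub pairingZl pmulr_rlt0 ?len_gt0. Qed.

Lemma co_pt_eq p q : (forall i, co p (pt q - pt p) i = 0) -> q = p.
Proof.
by move=> /co_eq0/eqP; rewrite subr_eq0 => /eqP/(@pt_inj _ _ X).
Qed.

Lemma nb_inj p : injective (nb p).
Proof.
move=> i j e; have := co_nb p i i; rewrite e co_nb eqxx mulr1.
case: eqP => [//|_] /eqP; rewrite mulr0 eq_sym gt_eqF ?len_gt0 //.
Qed.

(* In the two edge bases a facet normal [nrm q i] supported at p has
   coordinates a column c of a unimodular matrix; the column of the inverse
   matrix at a nonzero entry of c is a multiple of a basis vector, so the same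
   holds for c. *)
Lemma facet_at p q i : pairing (pt p) (nrm q i) = pairing (pt q) (nrm q i) ->
  exists j, nrm q i = nrm p j.
Proof.
move=> hpq; set u := nrm q i.
pose c j := - pairing (edge p j) u.
have max_u r : pairing (pt r) u <= pairing (pt p) u.
  by rewrite hpq -subr_ge0 -opprB oppr_ge0 -pairingBl pairing_nrm oppr_le0 cone_co.
have c_ge0 j : 0 <= c j.
  by have := max_u (nb p j); rewrite nb_le /c oppr_ge0.
have : exists j, c j != 0.
  case: (pickP (fun j => c j != 0)) => [j|h0]; first by exists j.
  have := pairing_edge_nrm q i i; rewrite -/u (nrm_expand p u) big1 ?pairing0r.
    by rewrite eqxx => /eqP; rewrite eq_sym oppr_eq0 oner_eq0.
  by move=> j _; move/negbFE: (h0 j); rewrite /c => /eqP->; rewrite scale0r.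
case=> j cj; exists j.
have inside r : pairing (pt r) u = pairing (pt p) u -> co p (pt r - pt p) j = 0.
  move=> hr; have : pairing (pt r - pt p) u = 0 by rewrite pairingBl hr subrr.
  rewrite (pairing_coE p) => /eqP; rewrite -oppr_eq0 -sumrN.
  rewrite psumr_eq0 => [/allP/(_ j)|k _]; last first.
    by rewrite -mulrN mulr_ge0 ?cone_co // c_ge0.
  by rewrite mem_index_enum -mulrN mulf_eq0 (negPf cj) orbF => /(_ isT)/eqP.
have zk k : k != i -> co p (edge q k) j = 0.
  move=> ki; have hq : co p (pt q - pt p) j = 0 by apply: inside.
  have hn : co p (pt (nb q k) - pt p) j = 0.
    apply: inside; rewrite pt_nb pairingDl pairingZl -/(edge q k) pairing_edge_nrm.
    by rewrite eq_sym (negPf ki) oppr0 mulr0 addr0 hpq.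
  move/eqP: hn; rewrite pt_nb -/(edge q k) addrAC coD hq add0r coZ.
  by rewrite mulf_eq0 gt_eqF ?len_gt0 //= => /eqP.
have expd : nrm p j = co p (edge q i) j *: u.
  rewrite (nrm_expand q (nrm p j)) (bigD1 i) //= pairing_nrm opprK big1 ?addr0 // => k ki.
  by rewrite pairing_nrm zk // opprK scale0r.
have /eqP := pairing_edge_nrm p j j.
rewrite eqxx expd pairingZr -[pairing _ _]opprK -/(c j) mulrN eqr_opp => /eqP h1.
suff -> : co p (edge q i) j = 1 by rewrite scale1r.
have cj0 : 0 < c j by rewrite lt_neqAle eq_sym cj c_ge0.
by move: h1 cj0; set a := co _ _ _; set b := c j; nia.
Qed.

Lemma opposite_rays p x : (forall i, 0 <= co p x i) -> (forall i, 0 <= co p (- x) i) -> x = 0.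
Proof.
move=> h1 h2; apply: (@co_eq0 p) => i; apply/eqP; rewrite eq_le h1 andbT.
by rewrite -oppr_ge0 -coN.
Qed.

Lemma edge_neq0 p i : edge p i != 0.
Proof.
apply/eqP => h; have := co_edge p i i; rewrite h co0 eqxx => /eqP.
by rewrite eq_sym oner_eq0.
Qed.

(** The cone at p is pointed, so that no vertex lies strictly between two others. *)
Lemma between_false (a b : int) p q r (d : 'rV[int]_n) : d != 0 -> 0 < a -> 0 < b ->
  pt q - pt p = a *: d -> pt r - pt p = - (b *: d) -> False.
Proof.
move=> /eqP d0 a0 b0 hq hr; apply: d0; apply: (@opposite_rays p) => i.
  by have := cone_co p q i; rewrite hq coZ pmulr_rge0.
by have := cone_co p r i; rewrite hr !coN coZ -mulrN pmulr_rge0.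
Qed.

(** Three distinct vertices on one line would put one of them strictly between the others; so the
    line of an edge carries only its two ends. *)
Lemma on_edge p i q : (forall k, k != i -> co p (pt q - pt p) k = 0) ->
  q = p \/ q = nb p i.
Proof.
move=> h; pose c := co p (pt q - pt p) i.
have hq : pt q = pt p + c *: edge p i.
  apply: (addrI (- pt p)); rewrite addKr addrC {1}(coE p (_ - _)) (bigD1 i) //= big1 ?addr0 //.
  by move=> k ki; rewrite h ?scale0r.
have c0 : 0 <= c.
  by have := cone_co p q i; rewrite hq addrC addKr coZ co_edge eqxx mulr1.
move: c0; rewrite le_eqVlt => /orP[/eqP c0|c0].
  by left; apply: (@pt_inj _ _ X); rewrite hq -c0 scale0r addr0.
right; apply: (@pt_inj _ _ X); rewrite hq pt_nb; congr (_ + _ *: _).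
case: (ltgtP c (len p i)) => // hc; exfalso.
- apply: (@between_false (len p i - c) c q (nb p i) p (edge p i)) => //.
  + exact: edge_neq0.
  + by rewrite subr_gt0.
  + by rewrite pt_nb hq opprD addrACA subrr add0r scalerBl.
  + by rewrite hq opprD addrA subrr add0r.
- apply: (@between_false (c - len p i) (len p i) (nb p i) q p (edge p i)) => //.
  + exact: edge_neq0.
  + by rewrite subr_gt0.
  + exact: len_gt0.
  + by rewrite pt_nb hq opprD addrACA subrr add0r scalerBl.
  + by rewrite pt_nb opprD addrA subrr add0r.
Qed.

End Model.

Section ModelFaces.
Variables (n : nat) (V : finType) (X : smooth_model n V).
Implicit Types (p q r : V) (i j k : 'I_n) (x u v : 'rV[int]_n).
Local Notation pt := (pt X).
Local Notation nb := (nb X).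
Local Notation len := (len X).
Local Notation edge := (edge X).
Local Notation co := (co X).
Local Notation nrm := (nrm X).

Lemma cone_sum_le0 (F : numDomainType) p q (f : 'I_n -> F) :
  (forall i, f i <= 0) -> \sum_i (co p (pt q - pt p) i)%:~R * f i <= 0.
Proof.
by move=> f0; apply: sumr_le0 => i _; rewrite mulr_ge0_le0 // ler0z cone_co.
Qed.

Lemma cone_sum_eq0 (F : numDomainType) p q (f : 'I_n -> F) :
  (forall i, f i <= 0) ->
  \sum_i (co p (pt q - pt p) i)%:~R * f i = 0 <->
  (forall i, f i != 0 -> co p (pt q - pt p) i = 0).
Proof.
move=> f0; split=> [/eqP|h]; last first.
  rewrite big1 // => i _; have [->|fi] := eqVneq (f i) 0; first by rewrite mulr0.
  by rewrite h // mul0r.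
rewrite -oppr_eq0 -sumrN psumr_eq0 => [/allP h i fi|i _]; last first.
  by rewrite -mulrN mulr_ge0 ?ler0z ?cone_co // oppr_ge0.
have := h i; rewrite mem_index_enum oppr_eq0 mulf_eq0 (negPf fi) orbF intr_eq0.
by move=> /(_ isT) /eqP.
Qed.

Lemma edge_pairing_le0 p u i : (forall r, pairing (pt r) u <= pairing (pt p) u) ->
  pairing (edge p i) u <= 0.
Proof.
by move=> /(_ (nb p i)); rewrite nb_le.
Qed.

Lemma pairing_max_eq p q u : (forall i, pairing (edge p i) u <= 0) ->
  pairing (pt q) u = pairing (pt p) u <->
  (forall i, pairing (edge p i) u != 0 -> co p (pt q - pt p) i = 0).
Proof.
move=> h; rewrite -(cone_sum_eq0 p q h).
have -> : \sum_i (co p (pt q - pt p) i)%:~R * pairing (edge p i) u =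
  pairing (pt q - pt p) u.
  by rewrite [RHS](pairing_coE X p); apply: eq_bigr => i _; rewrite intz.
by rewrite pairingBl; split=> [->|/eqP]; rewrite ?subrr // subr_eq0 => /eqP.
Qed.

Lemma pairing_max_le p q u : (forall i, pairing (edge p i) u <= 0) ->
  pairing (pt q) u <= pairing (pt p) u.
Proof.
move=> h; rewrite -subr_le0 -pairingBl (pairing_coE X p).
have := cone_sum_le0 p q h; congr (_ <= _).
by apply: eq_bigr => i _; rewrite intz.
Qed.

(** It vanishes on the edges at p with index in I and equals -1 on the others, hence exposes the
    face spanned at p by the edges in I. *)
Definition face_normal p (I : pred 'I_n) : 'rV[int]_n := \sum_(k | ~~ I k) nrm p k.

Lemma edge_face_normal p (I : pred 'I_n) i :
  pairing (edge p i) (face_normal p I) = - (~~ I i)%:R.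
Proof.
rewrite pairing_sumr; have [Ii|nIi] := boolP (I i).
  rewrite big1 ?oppr0 // => k nIk; rewrite pairing_edge_nrm.
  by case: eqP nIk => [->|]; rewrite ?Ii ?oppr0.
rewrite (bigD1 i) //= pairing_edge_nrm eqxx big1 ?addr0 // => k /andP[_ ki].
by rewrite pairing_edge_nrm (negPf ki) oppr0.
Qed.

Lemma edge_face_normal_le0 p (I : pred 'I_n) i :
  pairing (edge p i) (face_normal p I) <= 0.
Proof. by rewrite edge_face_normal oppr_le0. Qed.

Lemma face_normal_eq p q (I : pred 'I_n) :
  pairing (pt q) (face_normal p I) = pairing (pt p) (face_normal p I) <->
  (forall i, ~~ I i -> co p (pt q - pt p) i = 0).
Proof.
rewrite pairing_max_eq; last exact: edge_face_normal_le0.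
by split=> h i hi; apply: h; move: hi; rewrite edge_face_normal; case: (I i).
Qed.

Lemma reverse_edge p i : exists j,
  [/\ nb (nb p i) j = p, edge (nb p i) j = - edge p i & len (nb p i) j = len p i].
Proof.
set q := nb p i; pose u := face_normal p (pred1 i).
have eqpq : pairing (pt q) u = pairing (pt p) u.
  by apply/face_normal_eq => k /negPf/= ki; rewrite co_nb ki mulr0.
have umax r : pairing (pt r) u <= pairing (pt q) u.
  by rewrite eqpq; apply: pairing_max_le => k; apply: edge_face_normal_le0.
have edge_q := fun k => edge_pairing_le0 k umax.
have/existsP[j cj] : [exists j, co q (pt p - pt q) j != 0].
  rewrite -[X in is_true X]negbK; apply/existsPn => h; have := nb_neq X p i.
  suff <- : p = nb p i by rewrite eqxx.
  by apply: (@co_pt_eq _ _ X) => k; have := h k; rewrite negbK => /eqP.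
have enb : pairing (pt (nb q j)) u = pairing (pt p) u.
  rewrite -eqpq pt_nb pairingDl pairingZl -/(edge q j).
  have /(_ j) h := (pairing_max_eq p edge_q).1 (esym eqpq).
  have [->|/h c0] := eqVneq (pairing (edge q j) u) 0; first by rewrite mulr0 addr0.
  by rewrite c0 eqxx in cj.
exists j.
have nbqj : nb q j = p.
  have /face_normal_eq/on_edge [//|e] := enb.
  by have := nb_neq X q j; rewrite e eqxx.
have e1 : len q j *: edge q j = - (len p i *: edge p i).
  by rewrite -!nb_sub nbqj -/q opprB.
have e2 := congr1 (fun z => co q z j) e1; have e3 := congr1 (fun z => co p z i) e1.
rewrite coZ co_edge eqxx mulr1 coN coZ in e2.
rewrite coZ coN coZ co_edge eqxx mulr1 in e3.
have l0 := len_gt0 X q j; have l1 := len_gt0 X p i.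
(* Primitivity of the two edge vectors enters here: the coordinate of each along the other is a
   negative integer and their product is 1, so both are -1. *)
have elen : len q j = len p i.
  move: e2 e3 l0 l1; set a := len q j; set b := len p i.
  set c := co q _ _; set d := co p _ _ => *.
  have h1 : b * (c * d - 1) = 0 by nia.
  have h2 : c * d = 1 by move/eqP: h1; rewrite mulf_eq0; lia.
  have h3 : c < 0 by nia.
  have h4 : d < 0 by nia.
  have h5 : c = -1 by nia.
  lia.
split=> //; move/eqP: e1; rewrite elen -scalerN -subr_eq0 -scalerBr scalemx_eq0.
by rewrite gt_eqF //= subr_eq0 => /eqP.
Qed.

(** * The orientation of a generic cocharacter *)

Section Orientation.
Variable v : 'rV[int]_n.

Definition down p i := pairing (edge p i) v < 0.
Definition generic := forall p i, pairing (edge p i) v != 0.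

(* The vertices of the face spanned at p by the v-decreasing edges; the closure
   of the cell of p is the orbit closure of this face, which makes
   [closed_lower] the frontier condition. *)
Definition lower p q := [forall i, ~~ down p i ==> (co p (pt q - pt p) i == 0)].

Definition closed_lower := forall p q r, lower p q -> lower q r -> lower p r.

Lemma lowerP p q : reflect (forall i, ~~ down p i -> co p (pt q - pt p) i = 0) (lower p q).
Proof.
apply: (iffP forallP) => h i; first by move=> di; apply/eqP; move: (h i); rewrite di.
by apply/implyP => di; apply/eqP/h.
Qed.

Lemma lower_refl p : lower p p.
Proof. by apply/lowerP => i _; rewrite subrr co0. Qed.

Lemma lower_nb p i : lower p (nb p i) = down p i.
Proof.
apply/lowerP/idP => [h|di k dk]; last first.
  by rewrite co_nb; case: eqP dk => [->|]; rewrite ?di ?mulr0.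
apply: contraT => /h; rewrite co_nb eqxx mulr1 => /eqP.
by rewrite gt_eqF ?len_gt0.
Qed.

(** In the edge basis at p all terms of [pairing (pt q - pt p) v] are nonpositive, and they vanish
    together only for q = p. The set I stands for the decreasing edges, for the edges of a 2-face or
    for all edges. *)
Lemma cone_down_lt p q (I : pred 'I_n) :
  (forall i, I i -> down p i) -> (forall i, ~~ I i -> co p (pt q - pt p) i = 0) ->
  q != p -> pairing (pt q) v < pairing (pt p) v.
Proof.
move=> Id h qp; rewrite -subr_lt0 -pairingBl (pairing_coE X p) lt_neqAle.
have le0 k : co p (pt q - pt p) k * pairing (edge p k) v <= 0.
  have [Ik|/h->] := boolP (I k); last by rewrite mul0r.
  by rewrite mulr_ge0_le0 ?cone_co // ltW //; apply: Id.
rewrite sumr_le0 // andbT; apply: contra qp.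
rewrite -oppr_eq0 -sumrN psumr_eq0 => [/allP h0|k _]; last by rewrite oppr_ge0.
apply/eqP/(@co_pt_eq _ _ X) => k.
have [Ik|/h//] := boolP (I k); have := h0 k; rewrite mem_index_enum oppr_eq0 mulf_eq0.
by rewrite (lt_eqF (Id _ Ik)) orbF => /(_ isT)/eqP.
Qed.

Lemma lower_lt p q : lower p q -> q != p -> pairing (pt q) v < pairing (pt p) v.
Proof. by move=> /lowerP h; apply: (@cone_down_lt _ _ (down p)). Qed.

Lemma lower_face_normal p q : lower p q <->
  pairing (pt q) (face_normal p (down p)) = pairing (pt p) (face_normal p (down p)).
Proof. by rewrite face_normal_eq; split=> /lowerP. Qed.

End Orientation.
End ModelFaces.

(** * Facet labellings *)

(* A polytope with a labelling is combinatorially a product of simplices, with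
   one factor for each element of C: FF is the set of facets, [cl] sends a facet
   to its factor, and p is the vertex that lies, for each c, on all the facets
   of class c but [miss p c]. *)
Record labelling (n : nat) (V : finType) (X : smooth_model n V)
    (C FF : finType) := Labelling {
  cl : FF -> C;
  miss : V -> {ffun C -> FF};
  fac : V -> 'I_n -> FF;
  normal : FF -> 'rV[int]_n;
  cl_miss : forall p c, cl (miss p c) = c;
  miss_onto : forall t : {ffun C -> FF}, (forall c, cl (t c) = c) ->
    exists p, miss p = t;
  miss_inj : injective miss;
  fac_in : forall p i, miss p (cl (fac p i)) != fac p i;
  fac_onto : forall p G, miss p (cl G) != G -> exists i, fac p i = G;
  normal_fac : forall p i, normal (fac p i) = nrm X p i;
  miss_nb : forall p i c, miss (nb X p i) c =
    if c == cl (fac p i) then fac p i else miss p c;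
  normal_lt : forall p q G, miss p (cl G) != G -> miss q (cl G) = G ->
    pairing (pt X q) (normal G) < pairing (pt X p) (normal G);
  normal_eq0 : forall G, (forall p, miss p (cl G) = G) -> normal G = 0
}.

(** * Polygons with two poles *)

Section Polygon.
Variables (V : finType) (F : pred V) (N : V -> {set V}).
Hypothesis N_sub : forall x y, F x -> y \in N x -> F y.
Hypothesis N_sym : forall x y, F x -> y \in N x -> x \in N y.
Hypothesis N_irr : forall x y, F x -> y \in N x -> y != x.
Hypothesis N_two : forall x, F x -> #|N x| = 2.

Let pigeon x y1 y2 y3 : F x -> y1 \in N x -> y2 \in N x -> y3 \in N x ->
  y1 != y2 -> y1 != y3 -> y2 = y3.
Proof.
move=> Fx h1 h2 h3 n12 n13; apply/eqP; apply: contraT => n23.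
suff : (2 < #|N x|)%N by rewrite N_two.
apply: (@leq_trans #|[set y1; y2; y3]|%SET).
  by rewrite -finset.setUA cardsU1 cards2 n23 in_set2 negb_or n12 n13.
by apply/subset_leq_card/fintype.subsetP => y; rewrite !inE => /orP[/orP[]|] /eqP->.
Qed.

Let polygon_le4_pole s t p a b a' b' : F s -> F t ->
  (forall q, F q -> q != s -> q != t -> N q = [set s; t]) ->
  p = s -> a \in N p -> b \in N p -> a != b -> a' \in N a -> a' != p ->
  b' \in N b -> b' != p -> a' = b \/ a' = b'.
Proof.
move=> Fs Ft hN ep; rewrite {p}ep => ha hb ab ha' a's hb' b's.
have Fa := N_sub Fs ha; have Fb := N_sub Fs hb.
have as_ := N_irr Fs ha; have bs := N_irr Fs hb.
have [at_|at_] := eqVneq a t.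
  left; have hNb : N b = [set s; t] by apply: hN => //; rewrite -at_ eq_sym.
  apply: (@pigeon a s) => //.
  - exact: N_sym.
  - by rewrite at_; apply: N_sym => //; rewrite hNb !inE eqxx orbT.
  - by rewrite eq_sym.
  - by rewrite eq_sym.
have := ha'; rewrite hN // !inE (negPf a's) /= => /eqP a't.
have [bt|bt] := eqVneq b t; [left|right]; first by rewrite a't bt.
have := hb'; rewrite hN // !inE (negPf b's) /= => /eqP ->.
exact: a't.
Qed.

Let polygon_le4_side s t p a b a' b' : F s -> F t ->
  (forall q, F q -> q != s -> q != t -> N q = [set s; t]) ->
  F p -> p != s -> p != t -> a = s -> b = t -> a' \in N a -> a' != p ->
  b' \in N b -> b' != p -> a' = b \/ a' = b'.
Proof.
move=> Fs Ft hN Fp ps pt_ -> -> ha' a'p hb' b'p.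
have [a't|a't] := eqVneq a' t; [by left|right].
have a's := N_irr Fs ha'; have Fa' := N_sub Fs ha'.
apply: (@pigeon t p) => //; rewrite 1?eq_sym //.
- by apply: N_sym => //; rewrite hN // !inE eqxx orbT.
- by apply: N_sym => //; rewrite hN // !inE eqxx orbT.
Qed.

(** Every vertex other than s and t is a neighbour of both, and s has only two neighbours, so that
    there are at most four vertices. The conclusion separates the triangle, [a' = b], from the
    quadrilateral, [a' = b']. *)
Lemma polygon_le4 s t p a b a' b' : F s -> F t ->
  (forall q, F q -> q != s -> q != t -> N q = [set s; t]) ->
  F p -> a \in N p -> b \in N p -> a != b -> a' \in N a -> a' != p ->
  b' \in N b -> b' != p -> a' = b \/ a' = b'.
Proof.
move=> Fs Ft hN Fp ha hb ab ha' a'p hb' b'p.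
have hN' q : F q -> q != t -> q != s -> N q = [set t; s].
  by move=> Fq qt qs; rewrite hN // finset.setUC.
have [ps|ps] := eqVneq p s; first exact: (polygon_le4_pole Fs Ft hN ps ha hb).
have [pt_|pt_] := eqVneq p t; first exact: (polygon_le4_pole Ft Fs hN' pt_ ha hb).
have := ha; have := hb; rewrite hN // !inE.
move=> /orP[]/eqP eb /orP[]/eqP ea; last 1 first.
- by rewrite ea eb eqxx in ab.
- by rewrite ea eb eqxx in ab.
- exact: (polygon_le4_side Ft Fs hN' Fp pt_ ps ea eb).
- exact: (polygon_le4_side Fs Ft hN Fp ps pt_ ea eb).
Qed.

End Polygon.

(** * From the frontier condition to a labelling *)

Section ClosedLowerLabelling.
Variables (n : nat) (V : finType) (X : smooth_model n V).
Implicit Types (p q r : V) (i j k : 'I_n).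
Local Notation pt := (pt X).
Local Notation nb := (nb X).
Local Notation edge := (edge X).
Local Notation co := (co X).
Local Notation nrm := (nrm X).

(** A facet is encoded by its outer normal, which identifies the same facet seen from different
    vertices. *)
Definition facet := seq_sub [seq nrm x.1 x.2 | x : V * 'I_n].

Implicit Types G H : facet.

Definition facet_of p i : facet := SeqSub (codom_f (fun x => nrm x.1 x.2) (p, i)).
Local Notation fac := facet_of.

Lemma facet_of_eq p i q j : fac p i = fac q j <-> nrm p i = nrm q j.
Proof. by split=> [/(congr1 val)|h] //; apply: val_inj. Qed.

Lemma facet_of_inj p : injective (fac p).
Proof. by move=> i j /facet_of_eq /nrm_inj. Qed.

Definition inc p G := [exists i, fac p i == G].

Lemma inc_fac p i : inc p (fac p i).
Proof. by apply/existsP; exists i. Qed.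

Lemma inc_pairing p q i : inc p (fac q i) <-> pairing (pt p) (nrm q i) = pairing (pt q) (nrm q i).
Proof.
split=> [/existsP[j /eqP/facet_of_eq e]|/facet_at[j /esym/facet_of_eq e]]; last first.
  by apply/existsP; exists j; rewrite e.
apply/eqP; rewrite -subr_eq0 -pairingBl eq_le; apply/andP; split.
  by rewrite pairing_nrm oppr_le0 cone_co.
by rewrite -e -opprB pairingNl pairing_nrm opprK cone_co.
Qed.

Lemma inc_co p q i : inc p (fac q i) <-> co q (pt p - pt q) i = 0.
Proof.
rewrite inc_pairing; split=> [h|/eqP].
  by apply/eqP; rewrite -oppr_eq0 -pairing_nrm pairingBl h subrr.
by rewrite -oppr_eq0 -pairing_nrm pairingBl subr_eq0 => /eqP.
Qed.

(** The index of the same edge at its other end; the default i is never taken, by [reverse_edge]. *)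
Definition back p i := odflt i [pick j | nb (nb p i) j == p].
(** The facet entered on crossing the i-th edge from p; the facet that is left is [fac p i]. *)
Definition new_fac p i := fac (nb p i) (back p i).

Lemma nb_back p i : nb (nb p i) (back p i) = p.
Proof.
rewrite /back; case: pickP => [j /eqP //|h].
by have [j [e _ _]] := reverse_edge X p i; have := h j; rewrite e eqxx.
Qed.

Lemma back_back p i : back (nb p i) (back p i) = i.
Proof.
by have := nb_back (nb p i) (back p i); rewrite [X in nb X _]nb_back => /nb_inj.
Qed.

Lemma edge_back p i : edge (nb p i) (back p i) = - edge p i.
Proof.
have [j [e e1 _]] := reverse_edge X p i.
by have /nb_inj -> : nb (nb p i) (back p i) = nb (nb p i) j by rewrite nb_back.
Qed.

Lemma new_fac_back p i : new_fac (nb p i) (back p i) = fac p i.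
Proof. by rewrite /new_fac back_back nb_back. Qed.

Lemma inc_new_fac p i : ~~ inc p (new_fac p i).
Proof.
apply/negP => /inc_co/eqP; have := co_nb X (nb p i) (back p i) (back p i).
by rewrite nb_back eqxx mulr1 => ->; rewrite gt_eqF ?len_gt0.
Qed.

Lemma inc_nb_old p i k : k != i -> inc (nb p i) (fac p k).
Proof. by move=> ki; apply/inc_co; rewrite co_nb (negPf ki) mulr0. Qed.

Lemma inc_nb p i G : inc (nb p i) G = (inc p G && (G != fac p i)) || (G == new_fac p i).
Proof.
apply/idP/idP => [/existsP[k /eqP <-]|/orP[/andP[/existsP[k /eqP <-]]|/eqP->]].
- have [->|kb] := eqVneq k (back p i); first by rewrite eqxx orbT.
  apply/orP; left; apply/andP; split.
    by have := inc_nb_old (nb p i) kb; rewrite nb_back.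
  apply: contra (inc_new_fac (nb p i) (back p i)) => /eqP h.
  by rewrite new_fac_back -h inc_fac.
- by move=> h; apply: inc_nb_old; apply: contra h => /eqP->.
- exact: inc_fac.
Qed.

Lemma inc_nb_drop p i : ~~ inc (nb p i) (fac p i).
Proof. by rewrite -(new_fac_back p i) inc_new_fac. Qed.

Lemma inc_inj p q : (forall G, inc p G -> inc q G) -> p = q.
Proof.
by move=> h; apply/esym/(@co_pt_eq _ _ X) => i; apply/inc_co/h/inc_fac.
Qed.

Variable v : 'rV[int]_n.
Hypothesis v_gen : generic X v.
Hypothesis v_closed : closed_lower X v.

Section TwoFace.
Variables (p0 : V) (i0 j0 : 'I_n).
Hypothesis ij0 : i0 != j0.

(** [Psi] selects the facets that contain the 2-face spanned at [p0] by the edges [i0] and [j0]; [F]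
    is its vertex set, [E q] the set of its edges at q and [N q] the set of neighbours along
    them. *)
Let Psi G := [&& inc p0 G, G != fac p0 i0 & G != fac p0 j0].
Let F q := [forall G, Psi G ==> inc q G].
Let E q := [set k | ~~ Psi (fac q k)]%SET.
Let N q := [set nb q k | k in E q]%SET.

Let F_inc q G : F q -> Psi G -> inc q G.
Proof. by move=> /forallP/(_ G)/implyP. Qed.

Let F_p0 : F p0.
Proof. by apply/forallP => G; apply/implyP => /and3P[]. Qed.

Let E_p0 : E p0 = [set i0; j0]%SET.
Proof.
apply/setP => k; rewrite !inE /Psi inc_fac /= negb_and !negbK.
by rewrite !(inj_eq (@facet_of_inj p0)).
Qed.

Let card_E q : F q -> #|E q| = #|E p0|.
Proof.
have key r : F r -> #|~: E r| = #|[set G | Psi G]%SET|.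
  move=> Fr; rewrite -(card_imset _ (@facet_of_inj r)); apply: eq_card => G.
  rewrite inE; apply/imsetP/idP => [[k]|]; first by rewrite !inE negbK => ? ->.
  by move=> PG; have /existsP[k /eqP e] := F_inc Fr PG; exists k; rewrite // !inE e negbK.
move=> Fq; have := cardsC (E q); have := cardsC (E p0).
by rewrite (key _ Fq) (key _ F_p0) => <- /addIn.
Qed.

Let two_E q : F q -> #|E q| = 2.
Proof. by move=> /card_E ->; rewrite E_p0 cards2 ij0. Qed.

Let F_nb q k : F q -> k \in E q -> F (nb q k).
Proof.
rewrite inE => Fq kE; apply/forallP => G; apply/implyP => PG.
rewrite inc_nb F_inc //=; apply/orP; left.
by apply: contra kE => /eqP <-.
Qed.

Let back_E q k : F q -> k \in E q -> back q k \in E (nb q k).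
Proof. by rewrite !inE => Fq kE; apply: contra (inc_new_fac q k); apply: F_inc. Qed.

Let N_sub x y : F x -> y \in N x -> F y.
Proof. by move=> Fx /imsetP[k kE ->]; apply: F_nb. Qed.

Let N_sym x y : F x -> y \in N x -> x \in N y.
Proof.
move=> Fx /imsetP[k kE ->]; apply/imsetP; exists (back x k); first exact: back_E.
by rewrite nb_back.
Qed.

Let N_irr x y : F x -> y \in N x -> y != x.
Proof. by move=> _ /imsetP[k _ ->]; apply: nb_neq. Qed.

Let N_two x : F x -> #|N x| = 2.
Proof. by move=> Fx; rewrite card_imset ?two_E //; apply: nb_inj. Qed.

Let F_co q r k : F r -> k \notin E q -> co q (pt r - pt q) k = 0.
Proof. by rewrite inE negbK => Fr PG; apply/inc_co/F_inc. Qed.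

Let extreme (w : 'rV[int]_n) : (forall p i, pairing (edge p i) w != 0) ->
  exists2 s, F s & forall r, F r -> r != s -> pairing (pt r) w < pairing (pt s) w.
Proof.
move=> w_gen; have [//|s Fs smax] := @fin_argmax _ _ _ F (fun s => pairing (pt s) w) p0.
exists s => // r Fr; apply: (@cone_down_lt _ _ X _ _ _ (mem (E s))).
  by move=> k kE; rewrite /down lt_neqAle w_gen -nb_le smax ?F_nb.
by move=> k; apply: F_co.
Qed.

(** Take s highest and t lowest on the 2-face. A vertex q between them has one edge up and one edge
    down. If the lower neighbour were not t, it would have a lower neighbour r in turn; [v_closed]
    puts r on the line of the first edge, whose only vertices are both higher than r. If the upper
    neighbour were not s, then q would be its lower neighbour, hence t. *)
Let poles : exists s t, [/\ F s, F t &
  forall q, F q -> q != s -> q != t -> N q = [set s; t]%SET].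
Proof.
have [s Fs smax] := extreme v_gen.
have [|t Ft tmin] := @extreme (- v).
  by move=> p i; rewrite pairingNr oppr_eq0.
have {}tmin r : F r -> r != t -> pairing (pt t) v < pairing (pt r) v.
  by move=> Fr rt; rewrite -ltrN2 -!pairingNr tmin.
have has_up q : F q -> q != s -> exists2 k, k \in E q & ~~ down X v q k.
  move=> Fq qs; apply/exists_inP; rewrite -[X in is_true X]negbK negb_exists_in.
  apply/negP => /forall_inP h; have : pairing (pt s) v < pairing (pt q) v.
    apply: (@cone_down_lt _ _ X v q s (mem (E q))); last by rewrite eq_sym.
      by move=> k /h; rewrite negbK.
    by move=> k; apply: F_co.
  by move=> /lt_trans/(_ (smax _ Fq qs)); rewrite ltxx.
have has_down q : F q -> q != t -> exists2 k, k \in E q & down X v q k.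
  move=> Fq qs; apply/exists_inP; rewrite -[X in is_true X]negbK negb_exists_in.
  apply/negP => /forall_inP h; have : pairing (pt t) (- v) < pairing (pt q) (- v).
    apply: (@cone_down_lt _ _ X (- v) q t (mem (E q))); last by rewrite eq_sym.
      move=> k /h; rewrite /down pairingNr oppr_lt0 -leNgt le_eqVlt eq_sym.
      by rewrite (negPf (v_gen _ _)).
    by move=> k; apply: F_co.
  by rewrite !pairingNr ltrN2 => /lt_trans/(_ (tmin _ Fq qs)); rewrite ltxx.
have down_lt q k : down X v q k -> pairing (pt (nb q k)) v < pairing (pt q) v.
  by rewrite nb_lt.
have up_gt q k : ~~ down X v q k -> pairing (pt q) v < pairing (pt (nb q k)) v.
  move=> uk; rewrite ltNge nb_le le_eqVlt negb_or uk andbT; exact: v_gen.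
have E_cases q k1 k2 k : F q -> k1 \in E q -> k2 \in E q -> down X v q k1 ->
    ~~ down X v q k2 -> k \in E q -> k = k1 \/ k = k2.
  move=> Fq h1 h2 d1 d2 h; have n12 : k1 != k2 by apply: contraNneq d2 => <-.
  have : E q = [set k1; k2]%SET.
    apply/esym/eqP; rewrite eqEcard two_E // cards2 n12 andbT.
    by apply/fintype.subsetP => x; rewrite in_set2 => /orP[]/eqP->.
  by move: h => + e; rewrite e in_set2 => /orP[]/eqP; [left|right].
have down_t q k : F q -> q != s -> k \in E q -> down X v q k -> nb q k = t.
  move=> Fq qs kE dk; apply/eqP; apply: contraT => dt.
  have [k2 k2E uk2] := has_up q Fq qs.
  have Fd := F_nb Fq kE; have [k' k'E dk'] := has_down _ Fd dt.
  set r := nb (nb q k) k'; have Fr : F r by apply: F_nb.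
  have : lower X v q r by apply: (v_closed (q := nb q k)); rewrite lower_nb.
  move=> /lowerP low.
  have /on_edge : forall l, l != k -> co q (pt r - pt q) l = 0.
    move=> l lk; have [lE|lE] := boolP (l \in E q); last by rewrite F_co.
    have [e|->] := E_cases _ _ _ _ Fq kE k2E dk uk2 lE; first by rewrite e eqxx in lk.
    exact: low.
  have := lt_trans (down_lt _ _ dk') (down_lt _ _ dk).
  have := down_lt _ _ dk'; rewrite -/r.
  by move=> h1 h2 [] e; rewrite e ltxx in h1 h2.
exists s, t; split=> // q Fq qs qt.
have [k1 k1E dk1] := has_down q Fq qt; have [k2 k2E uk2] := has_up q Fq qs.
have e1 := down_t _ _ Fq qs k1E dk1.
have e2 : nb q k2 = s.
  apply/eqP; apply: contraT => us; have Fu := F_nb Fq k2E.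
  suff e : q = t by rewrite e eqxx in qt.
  rewrite -(nb_back q k2); apply: down_t => //; first exact: back_E.
  by rewrite /down edge_back pairingNl oppr_lt0 lt_neqAle eq_sym v_gen leNgt.
apply/setP => x; rewrite !inE; apply/imsetP/orP => [[k kE ->]|[]/eqP->].
- by have [->|->] := E_cases _ _ _ _ Fq k1E k2E dk1 uk2 kE; rewrite ?e1 ?e2 eqxx; [right|left].
- by exists k2.
- by exists k1.
Qed.

(** In a triangle both edges at [p0] enter the same facet, the third side, and going on from
    [nb p0 i0] regains [fac p0 i0]. In a quadrilateral opposite edges enter the same facet. *)
Lemma two_face_exchange k : fac (nb p0 i0) k = fac p0 j0 ->
  new_fac (nb p0 i0) k =
  if new_fac p0 j0 == new_fac p0 i0 then fac p0 i0 else new_fac p0 j0.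
Proof.
set a := nb p0 i0; set b := nb p0 j0; move=> ek.
have /existsP[l /eqP el] : inc b (fac p0 i0) by apply: inc_nb_old.
have [s [t [Fs Ft hN]]] := poles.
have iE : i0 \in E p0 by rewrite E_p0 !inE eqxx.
have jE : j0 \in E p0 by rewrite E_p0 !inE eqxx orbT.
have ha : a \in N p0 by apply: imset_f.
have hb : b \in N p0 by apply: imset_f.
have hk : k \in E a by rewrite inE ek /Psi eqxx !andbF.
have hl : l \in E b by rewrite inE el /Psi eqxx !andbF.
have ab : a != b by apply: contra ij0 => /eqP/nb_inj->.
have a'p : nb a k != p0.
  by apply: contraNneq (inc_nb_drop a k) => ->; rewrite ek inc_fac.
have b'p : nb b l != p0.
  by apply: contraNneq (inc_nb_drop b l) => ->; rewrite el inc_fac.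
have ij : fac p0 i0 != fac p0 j0 by rewrite (inj_eq (@facet_of_inj p0)).
have ni := inc_new_fac p0 i0; have nj := inc_new_fac p0 j0.
have incp_n G i : inc p0 G -> G != new_fac p0 i.
  by apply: contraTneq => ->; apply: inc_new_fac.
have incX := inc_nb a k; rewrite ek in incX.
have incY := inc_nb b l; rewrite el in incY.
have [eab|eab] := polygon_le4 N_sub N_sym N_irr N_two Fs Ft hN F_p0 ha hb ab
   (imset_f _ hk) a'p (imset_f _ hl) b'p.
- have h1 : fac p0 i0 = new_fac a k.
    have := incX (fac p0 i0); rewrite eab inc_nb_old // /a !inc_nb eqxx andbF /=.
    by rewrite (negPf (incp_n _ _ (inc_fac _ _))) /= => /esym/eqP.
  have := incX (new_fac p0 j0); rewrite eab inc_fac -h1 /a inc_nb (negPf nj) /=.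
  rewrite [_ == fac p0 i0](contraNF _ nj) => [|/eqP->]; last exact: inc_fac.
  by rewrite orbF => /esym/andP[-> _].
have [eH|neH] := eqVneq (new_fac p0 j0) (new_fac p0 i0); last first.
  have := incX (new_fac p0 j0).
  rewrite eab incY /b inc_fac /= [_ == fac p0 i0](contraNF _ nj) => [|/eqP->]; last exact: inc_fac.
  rewrite /= /a inc_nb (negPf nj) (negPf neH) /= => /esym/eqP //.
(* A quadrilateral whose edges at [p0] enter the same facet: from the fourth vertex the edges back
   to a and to b would leave the same facet, hence coincide. *)
exfalso; have aX := inc_new_fac a k; have bY := inc_new_fac b l.
have : inc (nb b l) (new_fac a k) by rewrite -eab inc_fac.
rewrite incY => /orP[/andP[]|/eqP XY].
  rewrite inc_nb => /orP[/andP[h1 h2] h3|/eqP h].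
    by move: aX; rewrite inc_nb h1 h3.
  by move: aX; rewrite h eH inc_fac.
move/negP: ab; apply; rewrite -(nb_back a k) -(nb_back b l) -eab.
apply/eqP; congr (nb _ _); apply: (@facet_of_inj (nb a k)).
by rewrite -/(new_fac a k) XY /new_fac eab.
Qed.

End TwoFace.
(** A highest vertex of a set closed under adjacency has only decreasing edges, hence is strictly
    the highest of all vertices; a set and its complement cannot both contain it. *)
Lemma vertex_connected (Q : pred V) p q :
  (forall r i, Q r = Q (nb r i)) -> Q p -> Q q.
Proof.
have peak (P : pred V) r : (forall r i, P r = P (nb r i)) -> P r ->
    exists2 s, P s & forall r, r != s -> pairing (pt r) v < pairing (pt s) v.
  move=> Pnb Pr; have [s Ps smax] := fin_argmax (fun s => pairing (pt s) v) Pr.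
  exists s => // x; apply: (@cone_down_lt _ _ X _ _ _ predT) => // k _.
  by rewrite /down lt_neqAle v_gen -nb_le smax -?Pnb.
move=> Qnb Qp; apply: contraT => nQq.
have [s Qs smax] := peak _ _ Qnb Qp.
have [|s' nQs' smax'] := peak (predC Q) q _ nQq; first by move=> r i /=; rewrite -Qnb.
have [e|ss'] := eqVneq s s'; first by rewrite /= -e Qs in nQs'.
have := smax' _ ss'; have := smax s'; rewrite eq_sym => /(_ ss') h /(lt_trans h).
by rewrite ltxx.
Qed.

(* The facet of the class of G that misses p: the classes are the fibres of
   [rep p], which do not depend on p. *)
Definition rep p G := if [pick i | fac p i == G] is Some i then new_fac p i else G.

Lemma rep_fac p i : rep p (fac p i) = new_fac p i.
Proof.
rewrite /rep; case: pickP => [j /eqP/facet_of_inj -> //|/(_ i)].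
by rewrite eqxx.
Qed.

Lemma rep_out p G : ~~ inc p G -> rep p G = G.
Proof.
rewrite /rep; case: pickP => // i /eqP <-.
by rewrite inc_fac.
Qed.

Lemma inc_rep p G : ~~ inc p (rep p G).
Proof.
have [/existsP[i /eqP <-]|h] := boolP (inc p G); last by rewrite rep_out.
by rewrite rep_fac inc_new_fac.
Qed.

Lemma rep_nb p i G : rep (nb p i) G =
  if rep p G == new_fac p i then fac p i else rep p G.
Proof.
have [/existsP[j /eqP <-]|nG] := boolP (inc p G).
  rewrite rep_fac; have [->|ji] := eqVneq j i.
    by rewrite eqxx rep_out // inc_nb_drop.
  have /existsP[k /eqP ek] : inc (nb p i) (fac p j) by apply: inc_nb_old.
  rewrite -ek rep_fac; apply: two_face_exchange => //.
  by rewrite eq_sym.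
rewrite (rep_out nG); case: eqP => [->|/eqP GN].
  by rewrite -[RHS]new_fac_back -(rep_fac (nb p i)).
by rewrite rep_out // inc_nb (negPf nG) (negPf GN).
Qed.

(** Crossing an edge renames one value of [rep], [new_fac r i], to [fac r i], which was not a value
    before since it contains r. So the fibres persist along edges, and the vertices are
    connected. *)
Lemma rep_fibre p q G H : (rep p G == rep p H) = (rep q G == rep q H).
Proof.
suff h b x y : (rep x G == rep x H) == b -> (rep y G == rep y H) == b.
  exact: (esym (eqP (h (rep p G == rep p H) p q (eqxx _)))).
apply: (@vertex_connected (fun x => (rep x G == rep x H) == b)) => r i; congr (_ == _).
rewrite !rep_nb.
have ne K : (rep r K == fac r i) = false.
  by apply: contraNF (inc_rep r K) => /eqP->; rewrite inc_fac.
have [eG|] := eqVneq (rep r G) (new_fac r i); have [eH|] := eqVneq (rep r H) (new_fac r i).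
- by rewrite eqxx eG eH eqxx.
- by move=> /negPf h; rewrite eG eq_sym h [RHS]eq_sym ne.
- by move=> /negPf h; rewrite eH h ne.
- by [].
Qed.

Variable p0 : V.

(** Each class is represented by its unique member that misses the base vertex. *)
Definition facet_class := {G : facet | ~~ inc p0 G}.
Definition class_of_facet G : facet_class := Sub (rep p0 G) (inc_rep p0 G).
Definition missing p : {ffun facet_class -> facet} := [ffun c => rep p (val c)].

Lemma rep_rep p q G : rep p (rep q G) = rep p G.
Proof. by apply/eqP; rewrite (rep_fibre p q) (rep_out (inc_rep q G)). Qed.

Lemma missing_class p G : missing p (class_of_facet G) = rep p G.
Proof. by rewrite ffunE rep_rep. Qed.

Lemma class_missing p c : class_of_facet (missing p c) = c.
Proof.
by apply: val_inj; rewrite /= ffunE rep_rep rep_out //; apply: (valP c).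
Qed.

Lemma missing_neq p G : (missing p (class_of_facet G) != G) = inc p G.
Proof.
rewrite missing_class; have [h|h] := boolP (inc p G).
  by apply: contraTneq h => <-; apply: inc_rep.
by rewrite rep_out // eqxx.
Qed.

Lemma missing_nb p i c : missing (nb p i) c =
  if c == class_of_facet (fac p i) then fac p i else missing p c.
Proof.
rewrite !ffunE rep_nb; congr (if _ then _ else _).
rewrite -rep_fac (rep_fibre p p0) (rep_out (valP c)).
by rewrite -val_eqE.
Qed.

(** Induction on the number of classes in which p disagrees with t: crossing the edge at p that
    leaves the facet [t c] corrects the class c and changes no other. *)
Lemma missing_onto (t : {ffun facet_class -> facet}) :
  (forall c, class_of_facet (t c) = c) -> exists p, missing p = t.
Proof.
move=> ht; suff h m p : (#|[set c | missing p c != t c]%SET| < m)%N ->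
    exists p, missing p = t by exact: (h _ p0 (ltnSn _)).
elim: m p => // m IH p; rewrite ltnS => hm.
have [/existsP[c hc]|] := boolP [exists c, missing p c != t c]; last first.
  by move=> /existsPn h; exists p; apply/ffunP => c; apply/eqP; rewrite -[_ == _]negbK.
have /existsP[i /eqP ei] : inc p (t c) by rewrite -missing_neq ht.
apply: (IH (nb p i)); apply: leq_trans hm; apply: proper_card.
apply/properP; split.
  apply/fintype.subsetP => d; rewrite !inE missing_nb ei ht.
  by have [->|//] := eqVneq d c; rewrite eqxx.
by exists c; rewrite !inE // missing_nb ei ht !eqxx.
Qed.

Lemma missing_inj : injective missing.
Proof. by move=> p q e; apply: inc_inj => G; rewrite -!missing_neq e. Qed.

Lemma closed_lower_labelling : exists C FF, inhabited (labelling X C FF).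
Proof.
exists facet_class, facet; constructor.
apply: (@Labelling _ _ _ _ _ class_of_facet missing fac val).
- exact: class_missing.
- exact: missing_onto.
- exact: missing_inj.
- by move=> p i; rewrite missing_neq inc_fac.
- by move=> p G; rewrite missing_neq => /existsP[i /eqP]; exists i.
- by [].
- exact: missing_nb.
- move=> p q G; rewrite missing_neq => /existsP[i /eqP <-] hq.
  have : ~~ inc q (fac p i) by rewrite -missing_neq hq eqxx.
  move=> /negP h; rewrite lt_neqAle; apply/andP; split.
    by apply/eqP => e; apply: h; apply/inc_pairing.
  by rewrite -subr_le0 -pairingBl pairing_nrm oppr_le0 cone_co.
(* No class is a point factor here, because every facet contains the vertex from which its normal is
   taken. *)
move=> G hG; exfalso; have /codomP[[p i] e] := valP G.
have {e} e : G = fac p i by apply: val_inj.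
by have := missing_neq p G; rewrite hG eqxx e inc_fac.
Qed.

End ClosedLowerLabelling.

(** * Generic cocharacters *)

Lemma dominate (T : finType) (x y : T -> int) : exists2 N : int, 0 < N &
  forall t, x t != 0 -> sgz (N * x t + y t) = sgz (x t).
Proof.
(* N exceeds every [|y t|], while a nonzero integer [x t] has absolute value at least 1. *)
exists (1 + \sum_t `|y t|) => [|t xt]; first by rewrite ltr_pwDl // sumr_ge0.
have : `|y t| <= \sum_t `|y t| by rewrite (bigD1 t) //= lerDl sumr_ge0.
move: (\sum_t _) xt => N x0 hN.
case: (ltgtP (x t) 0) x0 => // hx _.
- rewrite (ltr0_sgz hx) ltr0_sgz //; nia.
- rewrite (gtr0_sgz hx) gtr0_sgz //; nia.
Qed.

(** If the vector found so far is orthogonal to e, a large multiple of it plus e is not, since e has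
    positive square; the other pairings keep their signs. *)
Lemma exists_generic_vector (n : nat) (s : seq 'rV[int]_n) :
  (forall e, e \in s -> e != 0) ->
  exists v, forall e, e \in s -> pairing e v != 0.
Proof.
elim: s => [|e s IH] h; first by exists 0.
case: IH => [e' e's|v hv]; first by apply: h; rewrite in_cons e's orbT.
have ee : 0 < pairing e e.
  have /rV0Pn[i ei] : e != 0 by apply: h; rewrite mem_head.
  rewrite /pairing (bigD1 i) //= ltr_wpDr ?sumr_ge0 // => [j _|].
    by rewrite -expr2 sqr_ge0.
  by rewrite -expr2 lt_neqAle sqr_ge0 eq_sym sqrf_eq0 ei.
have [N N0 hN] := dominate (fun t : seq_sub s => pairing (val t) v) (fun t => pairing (val t) e).
have [ev|ev] := eqVneq (pairing e v) 0.
  exists (N *: v + e) => e'; rewrite in_cons => /orP[/eqP->|e's].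
    by rewrite pairingDr pairingZr ev mulr0 add0r gt_eqF.
  have := hN (SeqSub e's) (hv _ e's); rewrite /= pairingDr pairingZr => h1.
  by rewrite -sgz_eq0 h1 sgz_eq0 hv.
by exists v => e'; rewrite in_cons => /orP[/eqP->|/hv].
Qed.

Section GenericExists.
Variables (n : nat) (V : finType) (X : smooth_model n V).

Lemma exists_generic : exists v, generic X v.
Proof.
have [|v hv] := @exists_generic_vector n [seq edge X x.1 x.2 | x : V * 'I_n].
  by move=> e /codomP[[p i] ->]; apply: edge_neq0.
by exists v => p i; apply: hv; exact: (codom_f (fun x => edge X x.1 x.2) (p, i)).
Qed.

(** It allows a sign pattern on chosen edges to be prescribed by a special vector [v0]. *)
Lemma perturb_generic v0 : exists2 v, generic X v &
  forall p i, pairing (edge X p i) v0 != 0 ->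
    sgz (pairing (edge X p i) v) = sgz (pairing (edge X p i) v0).
Proof.
have [v1 gv1] := exists_generic.
have [N N0 hN] := dominate (fun t : V * 'I_n => pairing (edge X t.1 t.2) v0)
   (fun t => pairing (edge X t.1 t.2) v1).
exists (N *: v0 + v1) => [p i|p i h]; rewrite pairingDr pairingZr; last exact: (hN (p, i)).
have [->|h] := eqVneq (pairing (edge X p i) v0) 0; first by rewrite mulr0 add0r gv1.
by rewrite -sgz_eq0 (hN (p, i)) //= sgz_eq0.
Qed.

End GenericExists.

(** * Cocharacters and normal relations of a labelled polytope *)

Section Labelled.
Variables (n : nat) (V C FF : finType) (X : smooth_model n V).
Variable L : labelling X C FF.
Implicit Types (p q r : V) (i j k : 'I_n) (G H : FF) (c : C) (w z : 'rV[int]_n).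
Local Notation pt := (pt X).
Local Notation nb := (nb X).
Local Notation len := (len X).
Local Notation edge := (edge X).
Local Notation co := (co X).
Local Notation nrm := (nrm X).
Local Notation cl := (cl L).
Local Notation miss := (miss L).
Local Notation fac := (fac L).
Local Notation normal := (normal L).

Lemma fac_inj p : injective (fac p).
Proof. by move=> i j e; apply: (@nrm_inj _ _ X p); rewrite -!(normal_fac L) e. Qed.

(** Both sides say that q lies on the facet [fac p i]. If it does, the normal of this facet is also
    one at q, and the two vertices bound each other's value. *)
Lemma co_label p q i :
  (co p (pt q - pt p) i == 0) = (miss q (cl (fac p i)) != fac p i).
Proof.
apply/idP/idP => [/eqP h|].
  apply: contraT; rewrite negbK => /eqP hq.
  have := normal_lt (fac_in L p i) hq; rewrite normal_fac.
  by rewrite -subr_lt0 -pairingBl pairing_nrm h oppr0 ltxx.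
move=> /fac_onto[j ej]; rewrite eq_le cone_co andbT -oppr_ge0.
have := cone_co X q p j.
by rewrite -opprB coN -pairing_nrm -(normal_fac L) ej (normal_fac L) pairing_nrm.
Qed.

(** When edges are directed by comparing labels, [lower p q] says that in each class q misses the
    same facet as p or one with smaller [mu]. This is a product of partial orders, hence
    transitive. *)
Lemma order_closed_lower (F : numDomainType) (mu : FF -> F) v :
  (forall p i, down X v p i = (mu (fac p i) < mu (miss p (cl (fac p i))))) ->
  closed_lower X v.
Proof.
move=> hmu; suff lowerE p q : lower X v p q <->
    forall c, miss q c = miss p c \/ mu (miss q c) < mu (miss p c).
  move=> p q r /lowerE hpq /lowerE hqr; apply/lowerE => c.
  case: (hpq c) (hqr c) => [->|h1] [->|h2]; [by left|by right|by right|right].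
  exact: lt_trans h1.
split=> [/lowerP h c|h]; last first.
  apply/lowerP => i; rewrite hmu => hd; apply/eqP; rewrite co_label.
  apply: contraNneq hd => e; case: (h (cl (fac p i))); rewrite e //.
  by move=> e'; have := fac_in L p i; rewrite -e' eqxx.
have [e|ne] := eqVneq (miss q c) (miss p c); [by left|right].
have [i ei] : exists i, fac p i = miss q c.
  by apply: fac_onto; rewrite cl_miss eq_sym.
have ec : c = cl (fac p i) by rewrite ei cl_miss.
rewrite -ei ec -hmu; apply: contraT => /h/eqP.
by rewrite co_label ei cl_miss eqxx.
Qed.

Lemma facet_cases p G : miss p (cl G) = G \/ exists i, fac p i = G.
Proof.
by have [e|/fac_onto h] := eqVneq (miss p (cl G)) G; [left|right].
Qed.

Lemma edge_normal_fac p i k : pairing (edge p i) (normal (fac p k)) = - (k == i)%:R.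
Proof. by rewrite normal_fac pairing_edge_nrm. Qed.

Lemma edge_normal_out p i G : G != miss p (cl G) ->
  pairing (edge p i) (normal G) = - (G == fac p i)%:R.
Proof.
case: (facet_cases p G) => [->|[j <- _]]; first by rewrite eqxx.
by rewrite edge_normal_fac (inj_eq (@fac_inj p)).
Qed.

Definition class_sum c : 'rV[int]_n := \sum_(G | cl G == c) normal G.

(** The support value of a facet, read at any vertex on it. The default 0 is correct as well: a
    label that every vertex misses has normal 0. *)
Definition height G : int :=
  if [pick p | miss p (cl G) != G] is Some p then pairing (pt p) (normal G) else 0.

Lemma pairing_height p G : miss p (cl G) != G -> pairing (pt p) (normal G) = height G.
Proof.
rewrite /height; case: pickP => [q hq|/(_ p) ->] // hp.
have half x y : miss x (cl G) != G -> miss y (cl G) != G ->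
    pairing (pt x) (normal G) <= pairing (pt y) (normal G).
  move=> _ /fac_onto[i <-]; rewrite normal_fac -subr_le0 -pairingBl pairing_nrm.
  by rewrite oppr_le0 cone_co.
by apply/eqP; rewrite eq_le !half.
Qed.

Lemma pairing_le_height p G : pairing (pt p) (normal G) <= height G.
Proof.
have [/eqP h|/pairing_height-> //] := boolP (miss p (cl G) == G).
have [/existsP[q hq]|/existsPn h0] := boolP [exists q, miss q (cl G) != G].
  by rewrite -(pairing_height hq) ltW // normal_lt.
have e : normal G = 0 by apply: normal_eq0 => q; apply/eqP/negPn/h0.
by rewrite e /height; case: pickP => [q|_]; rewrite ?e ?pairing0r.
Qed.

Lemma pairing_lt_height p q G : miss p (cl G) = G -> miss q (cl G) != G ->
  pairing (pt p) (normal G) < height G.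
Proof. by move=> hp hq; rewrite -(pairing_height hq) normal_lt. Qed.

Section Step.
Variable J : {set C}.
Definition annihilates w := forall G, cl G \in J -> pairing w (normal G) = 0.
Hypothesis edge_ann : forall p i, cl (fac p i) \notin J -> annihilates (edge p i).
Variable p0 : V.
(** The vertices of the fibre through [p0] over the factors in J. Batyrev's argument runs inside
    this face, modulo the normals of the classes in J. *)
Let Gf p := [forall c in J, miss p c == miss p0 c].

Let GfP p : reflect (forall c, c \in J -> miss p c = miss p0 c) (Gf p).
Proof.
apply: (iffP forall_inP) => h c cJ; first exact/eqP/h.
by rewrite h.
Qed.

Let Gf_nb p i : Gf p -> cl (fac p i) \notin J -> Gf (nb p i).
Proof.
move=> /GfP h hi; apply/GfP => c cJ; rewrite miss_nb.
by case: eqP => [e|_]; [rewrite -e cJ in hi|rewrite h].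
Qed.

Lemma annihilates_co p i w : annihilates w -> cl (fac p i) \in J -> co p w i = 0.
Proof.
move=> hw /hw; rewrite normal_fac pairing_nrm => /eqP.
by rewrite oppr_eq0 => /eqP.
Qed.

Lemma pairing_annihilates p w z : annihilates w ->
  pairing w z = \sum_(i | cl (fac p i) \notin J) co p w i * pairing (edge p i) z.
Proof.
move=> hw; rewrite (pairing_coE X p) [RHS]big_mkcond; apply: eq_bigr => i _.
by case: ifPn => // /negPn hi; rewrite (annihilates_co hw hi) mul0r.
Qed.

Let Gf_co p q i : Gf p -> Gf q -> cl (fac p i) \in J -> co p (pt q - pt p) i = 0.
Proof.
move=> /GfP hp /GfP hq hi; apply/eqP; rewrite co_label hq // -hp //.
exact: fac_in.
Qed.

(** The degree of a label: its total distance from the vertices of the fibre. *)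
Let gap G : int := \sum_(q | Gf q) (height G - pairing (pt q) (normal G)).

Let gap_ge0 G : 0 <= gap G.
Proof. by apply: sumr_ge0 => q _; rewrite subr_ge0 pairing_le_height. Qed.

(* z is congruent, modulo the span of the normals with class in J, to the
   combination of normals with coefficients c. *)
Let reduction z : exists p (c : FF -> nat),
  [/\ Gf p, forall G, cl G \in J -> c G = 0%N,
      forall w, annihilates w ->
        \sum_G (c G)%:Z * pairing w (normal G) = pairing w z &
      \sum_G (c G)%:Z * gap G = \sum_(q | Gf q) (pairing (pt p) z - pairing (pt q) z)].
Proof.
have Gf0 : Gf p0 by apply/GfP.
(* At a vertex where z is maximal on the fibre, the edges of the fibre pair nonpositively with z,
   which makes the coefficients of the normals there nonnegative. *)
have [p Gp pmax] := fin_argmax (fun p => pairing (pt p) z) Gf0.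
have le0 i : cl (fac p i) \notin J -> pairing (edge p i) z <= 0.
  by move=> /(Gf_nb Gp) /pmax; rewrite nb_le.
pose c G := (\sum_(i | (cl (fac p i) \notin J) && (fac p i == G)) `|pairing (edge p i) z|)%N.
have cE (f : FF -> int) : \sum_G (c G)%:Z * f G =
    \sum_(i | cl (fac p i) \notin J) - pairing (edge p i) z * f (fac p i).
  under eq_bigr => G _ do rewrite /c (big_morph Posz PoszD (erefl 0%:Z)) mulr_suml.
  rewrite (exchange_big_dep (fun i => cl (fac p i) \notin J)) /=; last by move=> ? ? _ /andP[].
  apply: eq_bigr => i hi; rewrite hi (big_pred1 (fac p i)) => [|G]; last first.
    by rewrite /= eq_sym.
  by rewrite abszE ler0_norm ?le0.
exists p, c; split=> //.
- move=> G hG; rewrite /c big1 // => i /andP[hi /eqP e].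
  by rewrite e hG in hi.
- move=> w hw; rewrite cE (pairing_annihilates p z hw); apply: eq_bigr => i _.
  by rewrite normal_fac pairing_nrm mulrNN mulrC.
(* All facets that occur contain p, so their heights are attained there and the degree can be
   computed from z alone. *)
rewrite cE; under eq_bigr => i _ do rewrite mulr_sumr.
rewrite exchange_big; apply: eq_bigr => q Gq /=.
rewrite -pairingBl -[pt p - _]opprB pairingNl (pairing_coE X p) -sumrN.
rewrite [LHS]big_mkcond; apply: eq_bigr => i _; case: ifPn => [hi|/negPn hi].
  rewrite -(pairing_height (fac_in L p i)) -pairingBl normal_fac pairing_nrm.
  by rewrite -[pt p - pt q]opprB coN opprK mulNr mulrC.
by rewrite Gf_co // mul0r oppr0.
Qed.

Let relation (a : FF -> nat) := (forall G, cl G \in J -> a G = 0%N) /\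
  forall w, annihilates w -> \sum_G (a G)%:Z * pairing w (normal G) = 0.

Let deg (a : FF -> nat) : int := \sum_G (a G)%:Z * gap G.

(** If each class outside J had a label with coefficient zero, one vertex would miss all these
    labels. The relation would then involve only facets at that vertex, whose edges in the fibre
    read off each coefficient, so that all would vanish. *)
Let full_class a : relation a -> (exists G, a G != 0%N) ->
  exists2 c, c \notin J & forall G, cl G = c -> (0 < a G)%N.
Proof.
move=> [a0 ha] [G0 hG0].
have [/existsP[c /andP[cJ /forallP h]]|] :=
    boolP [exists c, (c \notin J) && [forall G, (cl G == c) ==> (0 < a G)%N]].
  by exists c => // G /eqP e; have := h G; rewrite e.
move=> /existsPn h; exfalso.
have zero c : c \notin J -> exists G, cl G = c /\ a G = 0%N.
  move=> cJ; have := h c; rewrite cJ /= => /forallPn[G].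
  by rewrite negb_imply -eqn0Ngt => /andP[/eqP e /eqP e']; exists G.
have [t ht] : exists t : {ffun C -> FF}, forall c,
    cl (t c) = c /\ a (t c) = 0%N.
  have {}zero c : exists G, (cl G == c) && (a G == 0%N).
    have [cJ|/zero[G [e e']]] := boolP (c \in J); last by exists G; rewrite e e' !eqxx.
    by exists (miss p0 c); rewrite cl_miss eqxx a0 // cl_miss.
  exists [ffun c => xchoose (zero c)] => c; rewrite ffunE.
  by have /andP[/eqP ? /eqP ?] := xchooseP (zero c).
have [p hp] := miss_onto (fun c => (ht c).1).
have aim c : a (miss p c) = 0%N by rewrite hp (ht c).2.
case: (facet_cases p G0) => [e|[i e]]; first by rewrite -e aim in hG0.
have [hi|hi] := boolP (cl G0 \in J); first by rewrite a0 in hG0.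
have := ha _ (edge_ann (p := p) (i := i) _); rewrite e => /(_ hi)/eqP.
rewrite (bigD1 G0) //= -{2}e edge_normal_fac eqxx mulrN1 big1 ?addr0.
  by rewrite oppr_eq0 => /eqP[] /eqP; rewrite (negPf hG0).
move=> G GG0; case: (facet_cases p G) => [<-|[k ek]]; first by rewrite aim mul0r.
rewrite -ek edge_normal_fac; case: eqP => [ki|_]; last by rewrite oppr0 mulr0.
by rewrite -ek ki e eqxx in GG0.
Qed.

(* Batyrev: a relation of minimal degree is the sum of all the normals of one
   class. *)
Lemma class_sum_annihilated : (exists c, c \notin J) ->
  exists2 c, c \notin J & forall w, annihilates w -> pairing w (class_sum c) = 0.
Proof.
(* A point factor: a label that every vertex misses is alone in its class, and its normal is 0. *)
have [/existsP[G /andP[GJ /forallP hG]]|nondeg] :=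
    boolP [exists G, (cl G \notin J) && [forall p, miss p (cl G) == G]].
  exists (cl G) => // w _; suff -> : class_sum (cl G) = normal G.
    by rewrite normal_eq0 ?pairing0r // => p; apply/eqP.
  apply: big_pred1 => K; rewrite /= .
  apply/eqP/eqP => [e|-> //]; case: (facet_cases p0 K) => [<-|[i ei]].
    by rewrite e; apply/eqP.
  by have := hG (nb p0 i); rewrite miss_nb ei e eqxx => /eqP.
move=> [c0 c0J].
have {}nondeg G : cl G \notin J -> exists p, miss p (cl G) != G.
  move=> GJ; move/existsPn: nondeg => /(_ G); rewrite GJ /= => /forallPn[p hp].
  by exists p.
(* Subtract the sum of a full class and add back its reduction b. Either b is zero, and the class
   sum is annihilated, or the result is a nontrivial relation of smaller degree. *)
have descent N a : relation a -> (exists G, a G != 0%N) -> deg a < N%:Z ->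
    exists2 c, c \notin J & forall w, annihilates w -> pairing w (class_sum c) = 0.
  elim: N a => [|N IH] a ra na degN.
    by move: degN; rewrite ltNge sumr_ge0 // => G _; rewrite mulr_ge0 // gap_ge0.
  have [c cJ hc] := full_class ra na.
  have [p [b [Gp b0 hb degb]]] := reduction (class_sum c).
  have [/existsP[G1 bG]|/existsPn bz] := boolP [exists G, b G != 0%N]; last first.
    exists c => // w hw; rewrite -hb // big1 // => G _.
    by have := bz G; rewrite negbK => /eqP ->; rewrite mul0r.
  pose a' G := (a G - (cl G == c) + b G)%N.
  have a'E (f : FF -> int) : \sum_G (a' G)%:Z * f G =
      \sum_G (a G)%:Z * f G - \sum_(G | cl G == c) f G + \sum_G (b G)%:Z * f G.
    rewrite [X in _ - X]big_mkcond -sumrB -big_split; apply: eq_bigr => G _ /=.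
    rewrite /a' PoszD mulrDl; congr (_ + _).
    case: eqP => [/hc aG|_]; last by rewrite subn0 subr0.
    by rewrite -subzn // mulrBl mul1r.
  apply: (IH a').
  - split=> [G GJ|w hw].
      by rewrite /a' ra.1 // b0.
    by rewrite a'E ra.2 // hb // /class_sum pairing_sumr sub0r addNr.
  - by exists G1; rewrite /a' addn_eq0 negb_and bG orbT.
  (* The vertex p lies on every facet of the class except [miss p c], where its value is strictly
     below the height. *)
  have lt : \sum_(q | Gf q) (pairing (pt p) (class_sum c) - pairing (pt q) (class_sum c)) <
      \sum_(G | cl G == c) gap G.
    rewrite /gap exchange_big /=; apply: ltr_sum => [|q Gq].
      by apply/hasP; exists p; rewrite ?mem_index_enum.
    rewrite sumrB -pairing_sumr ltrD2r pairing_sumr; have mc := cl_miss L p c.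
    rewrite (bigD1 (miss p c)) ?mc //= [ltRHS](bigD1 (miss p c)) ?mc //=.
    rewrite ltr_leD //; last by apply: ler_sum => *; apply: pairing_le_height.
    have [q' hq'] := nondeg (miss p c) (eq_ind_r (fun c => c \notin J) cJ mc).
    by apply: (pairing_lt_height _ hq'); rewrite mc.
  move: degN lt; rewrite -[deg a']/(\sum_G (a' G)%:Z * gap G) a'E degb -/(deg a).
  move: (deg a) (\sum_(G | _) _) (\sum_(q | _) _) => A B D; lia.
(* A relation to start from: a normal outside J together with a reduction of its opposite. *)
have [p [b [Gp b0 hb _]]] := reduction (- normal (miss p0 c0)).
pose a G := ((G == miss p0 c0) + b G)%N.
have aE (f : FF -> int) : \sum_G (a G)%:Z * f G = f (miss p0 c0) + \sum_G (b G)%:Z * f G.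
  transitivity (\sum_G ((G == miss p0 c0)%:Z * f G + (b G)%:Z * f G)).
    by apply: eq_bigr => G _; rewrite /a PoszD mulrDl.
  rewrite big_split /= (bigD1 (miss p0 c0)) //= eqxx mul1r big1 ?addr0 // => G /negPf->.
  by rewrite mul0r.
apply: (@descent `|(deg a + 1)%R|%N a).
- split=> [G GJ|w hw]; last by rewrite aE hb // pairingNr subrr.
  rewrite /a b0 // addn0; apply/eqP; rewrite eqb0; apply: contra c0J => /eqP eG.
  by rewrite -(cl_miss L p0 c0) -eG.
- by exists (miss p0 c0); rewrite /a eqxx.
have : 0 <= deg a by apply: sumr_ge0 => G _; rewrite mulr_ge0 // gap_ge0.
by move: (deg a) => A; lia.
Qed.

End Step.

(* Later factors get smaller weights, so that their contribution to the earlier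
   coordinates cannot change a sign. *)
Lemma tower (p0 : V) (mu : FF -> int) (m : nat) : (m <= #|C|)%N ->
  exists J : {set C}, [/\ #|J| = m,
    forall p i, cl (fac p i) \notin J -> annihilates J (edge p i) &
    exists v, (forall p i, cl (fac p i) \notin J -> pairing (edge p i) v = 0) /\
      (forall p i, cl (fac p i) \in J -> mu (fac p i) != mu (miss p (cl (fac p i))) ->
         sgz (pairing (edge p i) v) = sgz (mu (fac p i) - mu (miss p (cl (fac p i)))))].
Proof.
elim: m => [_|m IH mC].
  exists finset.set0; rewrite cards0; split=> // [p i _ G|]; first by rewrite inE.
  by exists 0; split=> p i; rewrite ?pairing0r // inE.
have [J [cardJ annJ [v [v0 vJ]]]] := IH (ltnW mC).
have [|c cJ hc] := class_sum_annihilated annJ p0.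
  have /card_gt0P[c] : (0 < #|~: J|)%N by rewrite -(ltn_add2l #|J|) cardsC addn0 cardJ.
  by rewrite inE => hc; exists c.
(* Since the class sum vanishes on the edges outside J, an edge of class c pairs to -1 with the
   facet it leaves and to 1 with the facet it enters; edges of other classes pair to 0. *)
have out p i G : cl (fac p i) \notin J -> cl G = c ->
    pairing (edge p i) (normal G) =
    if cl (fac p i) == c then (G == miss p c)%:R - (G == fac p i)%:R else 0.
  move=> hi hG; have := hc _ (annJ _ _ hi).
  rewrite /class_sum pairing_sumr (bigD1 (miss p c)) ?cl_miss //=.
  rewrite (eq_bigr (fun H => - (H == fac p i)%:R)); last first.
    by move=> H /andP[/eqP <-]; apply: edge_normal_out.
  rewrite sumrN => /eqP; rewrite subr_eq0 => /eqP e.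
  have [eG|nG] := eqVneq G (miss p c).
    rewrite eG e; have [ei|ni] := eqVneq (cl (fac p i)) c.
      have ne : fac p i != miss p c by rewrite -ei eq_sym fac_in.
      rewrite (bigD1 (fac p i)) ?ei ?eqxx //= big1 ?addr0 ?eqxx => [|H /andP[_ /negPf-> //]].
      by rewrite eq_sym (negPf ne) subr0.
    by apply: big1 => H /andP[/eqP eH _]; case: eqP => // e'; rewrite -eH e' eqxx in ni.
  rewrite edge_normal_out ?hG // sub0r; have [//|ni] := eqVneq (cl (fac p i)) c.
  have [e'|_] := eqVneq G (fac p i); last by rewrite oppr0.
  by rewrite -e' hG eqxx in ni.
(* With these coefficients, crossing an edge of class c outside J changes the value by the
   difference of [mu] between the missed facets after and before. *)
pose t := \sum_(G | cl G == c) - mu G *: normal G.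
have tE p i : cl (fac p i) \notin J -> pairing (edge p i) t =
    if cl (fac p i) == c then mu (fac p i) - mu (miss p c) else 0.
  move=> hi; rewrite /t pairing_sumr.
  under eq_bigr => G /eqP hG do rewrite pairingZr (out _ _ _ hi hG).
  have [ei|ni] := eqVneq (cl (fac p i)) c; last by rewrite big1 // => G _; rewrite mulr0.
  have ne : fac p i != miss p c by rewrite -ei eq_sym fac_in.
  rewrite (bigD1 (miss p c)) ?cl_miss //= (bigD1 (fac p i)) ?ei ?eqxx //=.
  rewrite [miss p c == _]eq_sym (negPf ne) subr0 sub0r mulr1 mulrNN mulr1.
  rewrite big1 ?addr0; first by rewrite addrC.
  by move=> G /andP[/andP[_ /negPf->] /negPf->]; rewrite subrr mulr0.
have [N N0 hN] := dominate (fun x : V * 'I_n => pairing (edge x.1 x.2) v)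
    (fun x => pairing (edge x.1 x.2) t).
exists (c |: J)%SET; split; first by rewrite cardsU1 cJ cardJ.
  move=> p i; rewrite !inE negb_or => /andP[ic iJ] G; rewrite !inE => /orP[/eqP hG|].
    by rewrite out // (negPf ic).
  by apply: annJ.
exists (N *: v + t); split=> p i; rewrite !inE pairingDr pairingZr.
  by rewrite negb_or => /andP[ic iJ]; rewrite v0 // tE // (negPf ic) mulr0 addr0.
have [iJ _ hmu|iJ] := boolP (cl (fac p i) \in J).
  rewrite (hN (p, i)) /= ?vJ // -sgz_eq0 vJ // sgz_eq0 subr_eq0.
  exact: hmu.
by rewrite orbF => /eqP ic hmu; rewrite v0 // tE // ic eqxx mulr0 add0r.
Qed.

(** Any injective [mu] serves: the missed label changes along every edge, which makes v generic. *)
Lemma labelling_closed_lower : exists2 v, generic X v & closed_lower X v.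
Proof.
have [/existsP[p0 _]|/existsPn noV] := boolP [exists p : V, true]; last first.
  by exists 0 => p; have := noV p.
pose mu G : int := (enum_rank G : nat)%:Z.
have mu_inj : injective mu by move=> G H [] /val_inj/enum_rank_inj.
have [J [cardJ _ [v [_ hv]]]] := tower p0 mu (leqnn #|C|).
have {}hv p i : sgz (pairing (edge p i) v) = sgz (mu (fac p i) - mu (miss p (cl (fac p i)))).
  apply: hv; last by rewrite (inj_eq mu_inj) eq_sym fac_in.
  suff -> : J = [set: C]%SET by rewrite inE.
  by apply/eqP; rewrite eqEcard finset.subsetT cardsT cardJ leqnn.
exists v => [p i|].
  by rewrite -sgz_eq0 hv sgz_eq0 subr_eq0 (inj_eq mu_inj) eq_sym fac_in.
apply: (@order_closed_lower _ mu) => p i.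
by rewrite /down -sgz_lt0 hv sgz_lt0 subr_lt0.
Qed.

Lemma labelled_reverse p i : exists j, [/\ nb (nb p i) j = p,
  edge (nb p i) j = - edge p i & fac (nb p i) j = miss p (cl (fac p i))].
Proof.
have [j [e1 e2 _]] := reverse_edge X p i; exists j; split=> //.
set q := nb p i in e1 e2 *; set c := cl (fac q j).
have mp : miss p c = fac q j by rewrite -e1 miss_nb eqxx.
suff -> : cl (fac p i) = c by [].
have := fac_in L q j; rewrite -/c -mp /q miss_nb.
by have [<- //|_] := eqVneq c (cl (fac p i)); rewrite eqxx.
Qed.

Lemma edge_normal_miss p i : pairing (edge p i) (normal (miss p (cl (fac p i)))) = 1.
Proof.
have [j [_ e <-]] := labelled_reverse p i.
by rewrite -[edge p i]opprK -e pairingNl edge_normal_fac eqxx opprK.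
Qed.

(** Both edges lie in the same 2-face, so they agree modulo [edge p i]. The coefficient is forced
    because the transported edge lies in the facet m just entered, while [edge p i] pairs to 1 with
    the normal of m. *)
Lemma transported_edge p i k : k != i -> exists2 j,
  fac (nb p i) j = fac p k &
  edge (nb p i) j =
    edge p k - pairing (edge p k) (normal (miss p (cl (fac p i)))) *: edge p i.
Proof.
move=> ki; set q := nb p i; set m := miss p _.
have qfac l : l != i -> exists j, fac q j = fac p l.
  move=> li; apply: fac_onto; rewrite miss_nb.
  have [_|_] := eqVneq (cl (fac p l)) (cl (fac p i)); last exact: fac_in.
  by rewrite (inj_eq (@fac_inj p)) eq_sym.
have [j ej] := qfac k ki; exists j => //.
set a := pairing _ (normal m).
have e : edge q j = edge p k + co p (edge q j) i *: edge p i.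
  apply/eqP; rewrite -subr_eq0; apply/eqP/(@co_eq0 _ _ X p) => l.
  rewrite coB coD coZ !co_edge; have [->|li] := eqVneq l i.
    by rewrite eq_sym (negPf ki) mulr1 add0r subrr.
  have [l' el'] := qfac l li.
  rewrite mulr0 addr0 -[co p _ l]opprK -pairing_nrm -(normal_fac L) -el' edge_normal_fac opprK.
  rewrite -(inj_eq (@fac_inj q)) el' ej (inj_eq (@fac_inj p)).
  by rewrite subrr.
have [j0 [_ _ ej0]] := labelled_reverse p i.
have : pairing (edge q j) (normal m) = 0.
  rewrite -/q -/m in ej0; rewrite -ej0 edge_normal_fac; case: eqP => [e0|_]; last by rewrite oppr0.
  have := fac_in L p k; rewrite -ej -e0 ej0 /m.
  by rewrite cl_miss eqxx.
rewrite e pairingDl pairingZl edge_normal_miss mulr1 -/a => /eqP.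
by rewrite addrC addr_eq0 => /eqP ->; rewrite scaleNr.
Qed.

Hypothesis all_closed : forall v, generic X v -> closed_lower X v.

(** Otherwise some v increases along edge k at p but decreases along edge i and along the
    transported edge after it. Two lower steps then reach a vertex with a positive coordinate along
    k, which is not lower than p. *)
Let nonneg p i k : cl (fac p i) != cl (fac p k) ->
  0 <= pairing (edge p k) (normal (miss p (cl (fac p i)))).
Proof.
move=> cik; have ki : k != i by apply: contraNneq cik => ->.
have [j _ ej] := transported_edge p ki; move: ej.
set q := nb p i; set a := pairing _ _ => ej; rewrite leNgt; apply/negP => a0.
(* The value on the transported edge is 1 + 2a; the factor 2 makes it negative for every negative
   integer a. *)
have [v gv hv] := perturb_generic X (2 *: nrm p i - nrm p k).
have ei : pairing (edge p i) (2 *: nrm p i - nrm p k) = - 2.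
  by rewrite pairingBr pairingZr !pairing_edge_nrm eqxx (negPf ki) oppr0 subr0 mulrN1.
have ek : pairing (edge p k) (2 *: nrm p i - nrm p k) = 1.
  by rewrite pairingBr pairingZr !pairing_edge_nrm eqxx eq_sym (negPf ki) oppr0 mulr0 sub0r opprK.
have eq_ : pairing (edge q j) (2 *: nrm p i - nrm p k) < 0.
  rewrite ej pairingBl pairingZl ei ek; move: (a) a0 => b; lia.
have di : down X v p i by rewrite /down -sgz_lt0 hv ei.
have dk : ~~ down X v p k by rewrite /down -sgz_lt0 hv ek.
have dj : down X v q j by rewrite /down -sgz_lt0 hv ?sgz_lt0 // lt_eqF.
have : lower X v p (nb q j) by apply: (all_closed gv (q := q)); rewrite lower_nb.
move=> /lowerP/(_ _ dk)/eqP; have -> : pt (nb q j) - pt p = len q j *: edge q j + len p i *: edge p i.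
  by rewrite -!nb_sub -/q addrA subrK.
rewrite coD !coZ ej coB coZ !co_edge eqxx (negPf ki) !mulr0 subr0 addr0 mulr1.
by rewrite gt_eqF // len_gt0.
Qed.

(** [nonneg] applied to edge k and to its reverse at the other end gives both inequalities, because
    the missed facet of class c is the same at both ends. *)
Lemma edge_normal_eq0 p k c : c != cl (fac p k) ->
  pairing (edge p k) (normal (miss p c)) = 0.
Proof.
move=> ck; have [/existsP[G /andP[/eqP clG Gm]]|] := boolP [exists G, (cl G == c) && (G != miss p c)].
  have [i ei] : exists i, fac p i = G by apply: fac_onto; rewrite clG eq_sym.
  have cik : cl (fac p i) != cl (fac p k) by rewrite ei clG.
  apply/eqP; rewrite eq_le; apply/andP; split; last first.
    by have := nonneg cik; rewrite ei clG.
  set q := nb p k; have [k' [eq eqk' ek']] := labelled_reverse p k.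
  have ki : i != k by apply: contraNneq cik => ->.
  have [i' ei' _] := transported_edge p ki.
  have := @nonneg q i' k'; rewrite ei' ek' cl_miss => /(_ cik).
  rewrite eqk' pairingNl oppr_ge0 ei clG /q miss_nb (negPf ck).
  by [].
move=> /existsPn h; rewrite normal_eq0 ?pairing0r // => q; rewrite cl_miss.
by apply/eqP; have := h (miss q c); rewrite cl_miss eqxx /= negbK.
Qed.

Lemma class_sum_eq0 (p0 : V) c : class_sum c = 0.
Proof.
rewrite (nrm_expand X p0 (class_sum c)) big1 // => k _.
suff -> : pairing (edge p0 k) (class_sum c) = 0 by rewrite oppr0 scale0r.
rewrite /class_sum pairing_sumr (bigD1 (miss p0 c)) ?cl_miss //=.
rewrite (eq_bigr (fun H => - (H == fac p0 k)%:R)); last first.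
  by move=> G /andP[/eqP <-]; apply: edge_normal_out.
rewrite sumrN; have [->|ck] := eqVneq c (cl (fac p0 k)).
  rewrite edge_normal_miss (bigD1 (fac p0 k)) /= ?eqxx ?(eq_sym (fac p0 k)) ?fac_in //.
  by rewrite big1 ?addr0 ?subrr // => G /andP[_ /negPf->].
rewrite edge_normal_eq0 // big1 ?subr0 // => G /andP[/eqP e _].
by case: eqP => // e'; rewrite -e e' eqxx in ck.
Qed.

End Labelled.

(** * Convex hulls of finite families *)

Section Convexity.
Variables (R : realType) (n : nat).

Lemma pairing_self_gt0 (b : 'rV[R]_n) : b != 0 -> 0 < pairing b b.
Proof.
move=> /rV0Pn[i bi]; rewrite /pairing (bigD1 i) //= ltr_wpDr ?sumr_ge0 // => [j _|].
  by rewrite -expr2 sqr_ge0.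
by rewrite -expr2 lt_neqAle sqr_ge0 eq_sym sqrf_eq0 bi.
Qed.

Lemma small_perturbation (T : finType) (a b : T -> R) (A : {set T}) :
  (forall t, t \in A -> a t < 0) ->
  exists2 e : R, 0 < e & forall t, t \in A -> a t + e * b t < 0.
Proof.
move=> ha; pose B := 1 + \sum_(t in A) `|b t| / - a t.
have B0 : 0 < B.
  by rewrite /B ltr_pwDl // sumr_ge0 // => t tA; rewrite divr_ge0 // oppr_ge0 ltW // ha.
exists B^-1 => [|t tA]; first by rewrite invr_gt0.
have at0 := ha t tA; have h : `|b t| / - a t < B.
  rewrite /B (bigD1 t) //= addrCA ltrDl addrC ltr_wpDl // sumr_ge0 // => s /andP[sA _].
  by rewrite divr_ge0 // oppr_ge0 ltW // ha.
rewrite ltr_pdivrMr ?oppr_gt0 // in h.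
rewrite -(pmulr_rlt0 _ B0) mulrDr mulVKf ?gt_eqF //.
have := ler_norm (b t); move: h; rewrite mulrN; lra.
Qed.

Section Family.
Variables (T : finType).
Implicit Types (x : T -> 'rV[R]_n) (A : {set T}) (u : 'rV[R]_n) (w : T -> R).

(** Induction on A. If the functional u for the family without [t0] is not negative on b = [x t0],
    project the others orthogonally to b. A functional for the projections, made orthogonal to b and
    tilted slightly against b, works for all. A relation among the projections lifts to a
    combination equal to c *: b, and pairing with u shows c <= 0, so that b completes it to a
    relation. *)
Lemma gordan x A : (exists u, forall t, t \in A -> pairing (x t) u < 0) \/
  exists w, [/\ forall t, 0 <= w t, forall t, t \notin A -> w t = 0,
    exists t, 0 < w t & \sum_t w t *: x t = 0].
Proof.
have [m] := ubnP #|A|; elim: m A x => // m IH A x; rewrite ltnS => cardA.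
have [->|/set0Pn[t0 t0A]] := eqVneq A finset.set0.
  by left; exists 0 => t; rewrite inE.
have cardA' : (#|A :\ t0| < m)%N by move: cardA; rewrite (cardsD1 t0) t0A.
have outA t : t \notin A -> t \notin (A :\ t0)%SET by apply: contra; rewrite inE => /andP[].
set b := x t0; case: (IH _ x cardA') => [[u hu]|[w [w0 wA wpos ws]]]; last first.
  by right; exists w; split=> // t /outA/wA.
have [bu|bu] := ltP (pairing b u) 0.
  left; exists u => t tA; have [->//|tt0] := eqVneq t t0.
  by apply: hu; rewrite !inE tt0.
have [b0|b0] := eqVneq b 0.
  right; exists (fun t => (t == t0)%:R); split=> //.
  - by move=> t; case: eqP => // ->; rewrite t0A.
  - by exists t0; rewrite eqxx ltr01.
  - by rewrite (bigD1 t0) //= -/b b0 scaler0 add0r big1 // => t /negPf->; rewrite scale0r.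
have bb := pairing_self_gt0 b0.
pose x' t := x t - (pairing (x t) b / pairing b b) *: b.
case: (IH _ x' cardA') => [[u' hu']|[w [w0 wA wpos ws]]].
  left; pose u'' := u' - (pairing u' b / pairing b b) *: b.
  have bu'' : pairing b u'' = 0.
    by rewrite pairingBr pairingZr divfK ?gt_eqF // pairingC subrr.
  have xu'' t : pairing (x t) u'' = pairing (x' t) u'.
    rewrite pairingBr pairingBl !pairingZr !pairingZl (pairingC u').
    by rewrite mulrAC (mulrC (pairing b u')) mulrAC.
  have [|e e0 he] := @small_perturbation T (fun t => pairing (x t) u'')
      (fun t => - pairing (x t) b) (A :\ t0).
    by move=> t /hu'; rewrite xu''.
  exists (u'' - e *: b) => t tA; rewrite pairingBr pairingZr.
  have [->|tt0] := eqVneq t t0; first by rewrite -/b bu'' sub0r oppr_lt0 mulr_gt0.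
  by have := he t; rewrite !inE tt0 tA mulrN => /(_ isT).
have {}ws : \sum_t w t *: x t = (\sum_t w t * (pairing (x t) b / pairing b b)) *: b.
  apply/eqP; rewrite -subr_eq0 scaler_suml -sumrB -[X in _ == X]ws; apply/eqP.
  by apply: eq_bigr => t _; rewrite scalerBr scalerA.
set c := (X in _ = X *: b) in ws.
have w_t0 : w t0 = 0 by apply: wA; rewrite !inE eqxx.
have [c0|c0] := leP c 0; last first.
  have := congr1 (fun y => pairing y u) ws; rewrite pairing_suml pairingZl => e.
  have [t1 wt1] := wpos; suff : \sum_t pairing (w t *: x t) u < 0.
    by rewrite e ltNge mulr_ge0 // ltW.
  have t1A : t1 \in (A :\ t0)%SET by apply: contraT => /wA e1; rewrite e1 ltxx in wt1.
  rewrite (bigD1 t1) //= pairingZl ltr_wnDr ?pmulr_rlt0 ?hu // sumr_le0 // => t _.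
  rewrite pairingZl; have [/hu/ltW h|/wA->] := boolP (t \in (A :\ t0)%SET).
    by rewrite mulr_ge0_le0.
  by rewrite mul0r.
right; exists (fun t => if t == t0 then - c else w t); split.
- by move=> t; case: eqP => // _; rewrite oppr_ge0.
- by move=> t tA; case: eqP tA => [->|_ /outA/wA //]; rewrite t0A.
- have [t1 wt1] := wpos; exists t1; case: eqP => // e.
  by rewrite e w_t0 ltxx in wt1.
rewrite (bigD1 t0) //= eqxx scaleNr -ws (bigD1 t0) //= w_t0 scale0r add0r addrC.
by apply/eqP; rewrite subr_eq0; apply/eqP/eq_bigr => t /negPf->.
Qed.

Definition hull_on x A : set 'rV[R]_n := [set y : 'rV[R]_n | exists w : T -> R,
  [/\ forall t, 0 <= w t, forall t, t \notin A -> w t = 0,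
      \sum_t w t = 1 & y = \sum_t w t *: x t]]%classic.

Definition hull x := hull_on x [set: T].

Lemma hull_on_pt x A t : t \in A -> hull_on x A (x t).
Proof.
move=> tA; exists (fun s => (s == t)%:R); split=> //.
- by move=> s; case: eqP => // ->; rewrite tA.
- by rewrite (bigD1 t) //= eqxx big1 ?addr0 // => s /negPf->.
- by rewrite (bigD1 t) //= eqxx scale1r big1 ?addr0 // => s /negPf->; rewrite scale0r.
Qed.

Lemma hull_pt x t : hull x (x t).
Proof. by apply: hull_on_pt; rewrite inE. Qed.

Lemma hullP x y : hull x y <-> exists w : T -> R,
  [/\ forall t, 0 <= w t, \sum_t w t = 1 & y = \sum_t w t *: x t].
Proof.
split=> [[w [w0 _ w1 e]]|[w [w0 w1 e]]]; exists w; split=> //.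
by move=> t; rewrite inE.
Qed.

Lemma weight_pos w : (forall t, 0 <= w t) -> \sum_t w t = 1 -> exists t, 0 < w t.
Proof.
move=> w0 w1; have /existsP[t ht] : [exists t, 0 < w t]; last by exists t.
apply: contraT => /existsPn h; have : \sum_t w t <= 0.
  by apply: sumr_le0 => t _; rewrite leNgt h.
by rewrite w1 ler10.
Qed.

Lemma hull_max x y u a : (forall t, pairing (x t) u <= a) -> hull x y -> pairing y u <= a.
Proof.
move=> h /hullP[w [w0 w1 ->]]; rewrite pairing_suml -[a]mul1r -w1 mulr_suml.
by apply: ler_sum => t _; rewrite pairingZl ler_wpM2l.
Qed.

Lemma hull_max_eq x w u a : (forall t, pairing (x t) u <= a) ->
  (forall t, 0 <= w t) -> \sum_t w t = 1 -> pairing (\sum_t w t *: x t) u = a ->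
  forall t, 0 < w t -> pairing (x t) u = a.
Proof.
move=> h w0 w1 hy t wt; apply/eqP; rewrite eq_le h //= leNgt; apply/negP => lt.
move: hy; rewrite pairing_suml => /eqP; apply/negP; rewrite lt_eqF //.
rewrite -[ltRHS]mul1r -w1 mulr_suml (bigD1 t) //= [ltRHS](bigD1 t) //=.
rewrite ltr_leD //; first by rewrite pairingZl ltr_pM2l.
by apply: ler_sum => s _; rewrite pairingZl ler_wpM2l.
Qed.

Definition max_face (P : set 'rV[R]_n) u : set 'rV[R]_n :=
  [set y | P y /\ forall z, P z -> pairing z u <= pairing y u]%classic.

Lemma face_combination x u y : max_face (hull x) u y -> exists w, [/\ forall t, 0 <= w t,
  \sum_t w t = 1, y = \sum_t w t *: x t & forall t, 0 < w t -> max_face (hull x) u (x t)].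
Proof.
move=> [/hullP[w [w0 w1 ey]] ymax]; exists w; split=> // t wt.
split=> [|z /ymax]; first exact: hull_pt.
rewrite (hull_max_eq _ w0 w1 _ wt (a := pairing y u)) ?ey // => s; rewrite -ey.
by apply: ymax; apply: hull_pt.
Qed.

Definition argmax_at x u t := forall s, pairing (x s) u <= pairing (x t) u.

Lemma argmaxE x u t : argmax_at x u t <-> max_face (hull x) u (x t).
Proof.
split=> [h|[_ h] s]; last by apply: h; apply: hull_pt.
by split=> [|z]; [apply: hull_pt|apply: hull_max].
Qed.

Lemma argmax_face x u t0 A : (forall t, argmax_at x u t <-> t \in A) -> t0 \in A ->
  max_face (hull x) u = hull_on x A.
Proof.
move=> hA t0A; have leh y : hull x y -> pairing y u <= pairing (x t0) u.
  by apply: hull_max; apply/hA.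
apply/seteqP; split=> y => [/face_combination[w [w0 w1 ey hw]]|].
  exists w; split=> // t tA; apply/eqP; rewrite eq_le w0 andbT leNgt.
  by apply: contra tA => /hw/argmaxE/hA.
move=> [w [w0 wA w1 ey]]; split; first by apply/hullP; exists w.
move=> z /leh; suff -> : pairing y u = pairing (x t0) u by [].
rewrite ey pairing_suml -[RHS]mul1r -w1 mulr_suml; apply: eq_bigr => t _; rewrite pairingZl.
have [tA|/wA->] := boolP (t \in A); last by rewrite !mul0r.
by congr (_ * _); apply/eqP; rewrite eq_le leh ?((hA t).2) //; apply: hull_pt.
Qed.

Lemma hull_on1 x t : hull_on x [set t] = [set x t]%classic.
Proof.
apply/seteqP; split=> [y [w [w0 wA w1 ->]]|y ->]; last by apply: hull_on_pt; rewrite inE.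
have ws s : s != t -> w s = 0 by move=> st; apply: wA; rewrite inE.
have wt : w t = 1 by move: w1; rewrite (bigD1 t) //= big1 ?addr0.
by rewrite (bigD1 t) //= wt scale1r big1 ?addr0 // => s /ws->; rewrite scale0r.
Qed.

End Family.
End Convexity.

Section Hulls.
Variables (R : realType) (n : nat).

Lemma hull_conv (T : finType) (x : T -> 'rV[R]_n) p q (l : R) :
  0 <= l <= 1 -> hull x p -> hull x q -> hull x (p + l *: (q - p)).
Proof.
move=> /andP[l0 l1] /hullP[w [w0 w1 ->]] /hullP[w' [w'0 w'1 ->]]; apply/hullP.
exists (fun t => (1 - l) * w t + l * w' t); split.
- by move=> t; rewrite addr_ge0 // mulr_ge0 // subr_ge0.
- by rewrite big_split /= -!mulr_sumr w1 w'1 !mulr1 subrK.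
rewrite (eq_bigr _ (fun t _ => scalerDl _ _ _)) big_split /=.
under [in RHS]eq_bigr => t _ do rewrite -scalerA.
under [X in _ = _ + X]eq_bigr => t _ do rewrite -scalerA.
by rewrite -!scaler_sumr scalerBr scalerBl scale1r addrA addrAC.
Qed.

Lemma conv_rows2 (p q z : 'rV[R]_n) : conv_rows (col_mx p q) z <->
  exists2 l : R, 0 <= l <= 1 & z = p + l *: (q - p).
Proof.
split=> [[w [w0 w1 ->]]|[l /andP[l0 l1] ->]].
  have -> : w *m col_mx p q = w 0 (lshift 1 0) *: p + w 0 (rshift 1 0) *: q.
    by rewrite mulmx_sum_row big_split_ord !big_ord1 rowKu rowKd !row_id.
  have := w0 (rshift 1 0); have := w0 (lshift 1 0); move: w1.
  rewrite big_split_ord !big_ord1 /=.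
  move: (w _ _) (w _ _) => b a ab a0 b0; exists b; first by lra.
  have -> : a = 1 - b by lra.
  by rewrite scalerBr scalerBl scale1r addrA addrAC.
exists (row_mx (1 - l)%:M l%:M); split.
- move=> i; rewrite mxE; case: splitP => j _; rewrite (ord1 j) mxE eqxx mulr1n //.
  by rewrite subr_ge0.
- by rewrite big_split_ord !big_ord1 /= row_mxEl row_mxEr !mxE !eqxx !mulr1n subrK.
by rewrite mul_row_col !mul_scalar_mx scalerBr scalerBl scale1r addrA addrAC.
Qed.

Lemma hull_restrict (T : finType) (x : T -> 'rV[R]_n) (A : {set T}) :
  hull_on x A = hull (fun t : {t | t \in A} => x (val t)).
Proof.
have sub (U : nmodType) (F : T -> U) : (forall t, t \notin A -> F t = 0) ->
    \sum_t F t = \sum_(t : {t | t \in A}) F (val t).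
  move=> F0; rewrite -[RHS](big_sub A F) [RHS]big_mkcond.
  by apply: eq_bigr => t _; case: ifPn => // /F0.
apply/predeqP => y; split=> [[w [w0 wA w1 ->]]|/hullP[w [w0 w1 ->]]].
  apply/hullP; exists (fun t => w (val t)); split=> //; first by rewrite -w1 sub.
  by rewrite sub // => t /wA->; rewrite scale0r.
pose w' t := if insub t is Some s then w s else 0.
have w'A t : t \notin A -> w' t = 0 by move=> tA; rewrite /w' insubN.
have w'E (t : {t | t \in A}) : w' (val t) = w t by rewrite /w' valK.
exists w'; split=> //.
- by move=> t; rewrite /w'; case: insub.
- by rewrite sub // -w1; apply: eq_bigr.
rewrite sub => [|t /w'A->]; last by rewrite scale0r.
by apply: eq_bigr => t _; rewrite w'E.
Qed.

Lemma hull_drop (T : finType) (x : T -> 'rV[R]_n) (A : {set T}) t : t \in A ->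
  hull_on x (A :\ t) (x t) -> (hull_on x A `<=` hull_on x (A :\ t))%classic.
Proof.
move=> tA [w [w0 wA w1 e]] y [w' [w'0 w'A w'1 ->]].
have wt : w t = 0 by apply: wA; rewrite !inE eqxx.
exists (fun s => (if s == t then 0 else w' s) + w' t * w s); split.
- by move=> s; rewrite addr_ge0 ?mulr_ge0 //; case: eqP.
- move=> s sA; rewrite wA // mulr0 addr0; case: eqP => // /eqP st.
  by apply: w'A; move: sA; rewrite !inE st.
- rewrite big_split /= -mulr_sumr w1 mulr1 -w'1 [in RHS](bigD1 t) //= addrC.
  congr (_ + _); rewrite (bigD1 t) //= eqxx add0r.
  by apply: eq_bigr => s /negPf->.
under [RHS]eq_bigr => s _ do rewrite scalerDl -scalerA.
rewrite big_split /= -scaler_sumr -e (bigD1 t) //= addrC; congr (_ + _).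
rewrite [RHS](bigD1 t) //= eqxx scale0r add0r.
by apply: eq_bigr => s /negPf->.
Qed.

(* A minimal generating set consists of exposed points. *)
Lemma hull_exposed (T : finType) (x : T -> 'rV[R]_n) : exists A : {set T},
  hull x = hull_on x A /\ forall t, t \in A -> exists u, forall s, s \in A ->
    s != t -> pairing (x s) u < pairing (x t) u.
Proof.
have [|A /minsetP[/asboolP hA Amin]] :=
    @ex_minset T (fun A => `[< hull x = hull_on x A >]).
  by exists finset.setT; apply/asboolP.
exists A; split=> // t tA.
have irr : ~ hull_on x (A :\ t) (x t).
  move=> h; have : (A :\ t)%SET = A.
    apply: Amin; last exact: subD1set.
    apply/asboolP; rewrite hA; apply/seteqP; split; first exact: hull_drop.
    move=> y [w [w0 wA w1 ->]]; exists w; split=> // s sA; apply: wA.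
    by apply: contra sA; rewrite inE => /andP[].
  by move=> e; move: tA; rewrite -e !inE eqxx.
case: (gordan (fun s => x s - x t) (A :\ t)) => [[u hu]|[w [w0 wA [t1 wt1] ws]]].
  exists u => s sA st; rewrite -subr_lt0 -pairingBl.
  by apply: hu; rewrite !inE st.
exfalso; apply: irr; set W := \sum_s w s.
have W0 : 0 < W by rewrite /W (bigD1 t1) //= ltr_wpDr // sumr_ge0.
exists (fun s => w s / W); split.
- by move=> s; rewrite divr_ge0 // ltW.
- by move=> s /wA->; rewrite mul0r.
- by rewrite -mulr_suml mulfV ?gt_eqF.
apply: (scalerI (lt0r_neq0 W0)); rewrite scaler_sumr.
under [RHS]eq_bigr => s _ do rewrite scalerA mulrCA mulfV ?gt_eqF // mulr1.
apply/esym/eqP; rewrite -subr_eq0 /W scaler_suml -sumrB -[X in _ == X]ws.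
by apply/eqP/eq_bigr => s _; rewrite scalerBr.
Qed.

End Hulls.

(** Descent on the sum of absolute values of the entries; passing to [sgz k *: w] keeps the
    extracted factor positive. *)
Lemma primitive_part (n : nat) (x : 'rV[int]_n) : x != 0 ->
  exists (d : int) (w : 'rV[int]_n), [/\ 0 < d, primitive w & x = d *: w].
Proof.
pose N (x : 'rV[int]_n) := (\sum_i `|x 0%R i|)%N.
have [m] := ubnP (N x); elim: m x => // m IH x; rewrite ltnS => hN x0.
have [hx|hx] := pselect (primitive x); first by exists 1, x; rewrite scale1r.
have [k [w [e k1]]] : exists k w, x = k *: w /\ `|k| <> 1.
  apply: contrapT => h; apply: hx; split; first exact/eqP.
  by move=> k w e; apply: contrapT => k1; apply: h; exists k, w.
have k0 : k != 0 by apply: contra x0 => /eqP k0; rewrite e k0 scale0r.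
have w0 : w != 0 by apply: contra x0 => /eqP w0; rewrite e w0 scaler0.
have [||d [w' [d0 pw' e']]] := IH (sgz k *: w).
- apply: leq_trans hN.
  have /rV0Pn[i wi] := w0; rewrite /N (bigD1 i) //= [X in (_ < X)%N](bigD1 i) //= -addSn.
  have k2 : (1 < `|k|)%N by move: k0 k1; lia.
  have sg1 : `|sgz k|%N = 1%N by case: sgzP k0.
  rewrite e leq_add //; first by rewrite !mxE !abszM sg1 mul1n ltn_Pmull // absz_gt0.
  by apply: leq_sum => j _; rewrite !mxE !abszM sg1 mul1n leq_pmull // ltnW.
- by rewrite scalemx_eq0 sgz_eq0 negb_or k0.
exists (`|k| * d), w'; split=> //; first by rewrite mulr_gt0 // normr_gt0.
by rewrite -scalerA -e' scalerA e; congr (_ *: _); case: sgzP => hk; lia.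
Qed.

(** * Edges of a polytope at a vertex *)

Section ExposedPoints.
Variables (R : realType) (n : nat) (V : finType) (x : V -> 'rV[R]_n).
Hypothesis exposed : forall p, exists u, forall q, q != p -> pairing (x q) u < pairing (x p) u.

Lemma exposed_vertex p : is_vertex (hull x) (x p).
Proof.
right; have [u hu] := exposed p; exists u; symmetry; rewrite -(hull_on1 x p).
apply: (@argmax_face _ _ _ _ _ p); last by rewrite inE.
move=> t; rewrite inE; split=> [h|/eqP-> s]; last first.
  by have [->//|/hu/ltW] := eqVneq s p.
by apply: contraT => /hu; rewrite ltNge h.
Qed.

Section EdgesAt.
Variable p : V.
Let g q := x q - x p.

Definition cone_on (A : {set V}) : set 'rV[R]_n := [set y : 'rV[R]_n | exists w : V -> R,
  [/\ forall t, 0 <= w t, forall t, t \notin A -> w t = 0 & y = \sum_t w t *: g t]]%classic.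

(* A minimal generating set of the cone at p consists of edges: Gordan's lemma
   modulo a generator gives a functional that exposes its ray. *)
Lemma edge_generators : exists A : {set V},
  (forall q, cone_on A (g q)) /\
  forall e, e \in A -> exists q (t : R), [/\ 0 < t, x q - x p = t *: g e & is_edge (hull x) (x p) (x q)].
Proof.
have [u0 hu0] := exposed p.
have g0 q : q != p -> pairing (g q) u0 < 0 by move=> /hu0; rewrite /g pairingBl subr_lt0.
have gp : g p = 0 by rewrite /g subrr.
have [|A /minsetP[/andP[pA /asboolP hA] Amin]] :=
    @ex_minset V (fun A => (p \notin A) && `[< forall q, cone_on A (g q) >]).
  exists (~: [set p])%SET; apply/andP; split; first by rewrite !inE eqxx.
  apply/asboolP => q.
  exists (fun t => ((t == q) && (q != p))%:R); split=> //.
  - move=> t; rewrite !inE negbK => /eqP->.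
    by rewrite eq_sym; case: eqP.
  - rewrite (bigD1 q) //= eqxx big1 ?addr0 => [|t /negPf->]; last by rewrite scale0r.
    by case: eqP => [->|_]; rewrite ?scale1r // gp scaler0.
exists A; split=> // e eA.
have ep : e != p by apply: contraNneq pA => <-.
have ge := g0 e ep.
have irr : ~ cone_on (A :\ e) (g e).
  move=> [w [w0 wA we]]; have : (A :\ e)%SET = A.
    apply: Amin; last exact: subD1set.
    rewrite !inE (negPf pA) andbF /=; apply/asboolP => q.
    have [w' [w'0 w'A ->]] := hA q.
    have wee : w e = 0 by apply: wA; rewrite !inE eqxx.
    exists (fun s => (if s == e then 0 else w' s) + w' e * w s); split.
    - by move=> s; rewrite addr_ge0 ?mulr_ge0 //; case: eqP.
    - move=> s sA; rewrite wA // mulr0 addr0; case: eqP => // /eqP st.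
      by apply: w'A; move: sA; rewrite !inE st.
    under [RHS]eq_bigr => s _ do rewrite scalerDl -scalerA.
    rewrite big_split /= -scaler_sumr -we (bigD1 e) //= addrC; congr (_ + _).
    rewrite [RHS](bigD1 e) //= eqxx scale0r add0r.
    by apply: eq_bigr => s /negPf->.
  by move=> h; move: eA; rewrite -h !inE eqxx.
(* [g t - c t *: g e] is the projection of [g t] along the generator [g e] to the kernel of [u0]. A
   positive relation among the projections would make [g e] redundant. *)
pose c q := pairing (g q) u0 / pairing (g e) u0.
have cpos q : q != p -> 0 < c q by move=> qp; rewrite /c ltr_ndivlMr ?mul0r ?g0.
have [u hu] : exists u, forall t, t \in (A :\ e)%SET -> pairing (g t - c t *: g e) u < 0.
  case: (gordan (fun t => g t - c t *: g e) (A :\ e)) => [//|[w [w0 wA [t1 wt1] ws]]].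
  exfalso; apply: irr; pose s := \sum_t w t * c t.
  have nonneg t : 0 <= w t * c t.
    have [tp|/cpos/ltW] := eqVneq t p; last exact: mulr_ge0.
    by rewrite /c tp gp pairing0l mul0r mulr0.
  have s0 : 0 < s.
    rewrite /s (bigD1 t1) //= ltr_wpDr // ?sumr_ge0 // mulr_gt0 // cpos //.
    apply: contraTneq wt1 => ->; rewrite wA ?ltxx //.
    by rewrite !inE (negPf pA) andbF.
  exists (fun t => w t / s); split.
  - by move=> t; rewrite divr_ge0 // ltW.
  - by move=> t /wA->; rewrite mul0r.
  apply: (scalerI (lt0r_neq0 s0)); rewrite scaler_sumr.
  under [RHS]eq_bigr => t _ do rewrite scalerA mulrCA mulfV ?gt_eqF // mulr1.
  apply/esym/eqP; rewrite -subr_eq0 /s scaler_suml -sumrB -[X in _ == X]ws.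
  by apply/eqP/eq_bigr => t _; rewrite [RHS]scalerBr scalerA.
pose u1 := u - (pairing (g e) u / pairing (g e) u0) *: u0.
have u1E t : pairing (g t) u1 = pairing (g t - c t *: g e) u.
  rewrite /u1 /c pairingBr pairingZr (pairingBl (g t)) pairingZl; congr (_ - _).
  by rewrite mulrAC [RHS]mulrAC (mulrC (pairing (g e) u)).
have u1e : pairing (g e) u1 = 0.
  by rewrite u1E /c mulfV ?lt_eqF // scale1r subrr pairing0l.
have u1A t : t \in A -> t != e -> pairing (g t) u1 < 0.
  by move=> tA te; rewrite u1E hu // !inE te.
have ray q : pairing (g q) u1 <= 0 /\
    (pairing (g q) u1 = 0 -> exists2 t, 0 <= t & g q = t *: g e).
  have [w [w0 wA ->]] := hA q.
  have le0 t : pairing (w t *: g t) u1 <= 0.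
    rewrite pairingZl; have [tA|/wA->] := boolP (t \in A); last by rewrite mul0r.
    have [->|/(u1A _ tA)/ltW] := eqVneq t e; first by rewrite u1e mulr0.
    exact: mulr_ge0_le0.
  rewrite pairing_suml; split; first exact: sumr_le0.
  move=> /eqP; rewrite -oppr_eq0 -sumrN psumr_eq0 => [/allP h|t _]; last by rewrite oppr_ge0.
  exists (w e) => //; rewrite (bigD1 e) //= big1 ?addr0 // => t te.
  have [tA|/wA->] := boolP (t \in A); last by rewrite scale0r.
  have := h t; rewrite mem_index_enum oppr_eq0 pairingZl mulf_eq0 (lt_eqF (u1A t tA te)) orbF.
  by move=> /(_ isT)/eqP->; rewrite scale0r.
pose onray q := pairing (g q) u1 == 0.
have oe : onray e by rewrite /onray u1e.
(* Several points may lie on the ray of [g e]; the farthest is the other end of the edge. *)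
have [q oq qmax] := fin_argmax c oe.
have gE r : onray r -> g r = c r *: g e.
  move=> /eqP /(ray r).2[t _ h]; rewrite /c h pairingZl mulfK ?lt_eqF //.
have cq : 0 < c q by apply: (lt_le_trans _ (qmax e oe)); apply: cpos.
exists q, (c q); split=> //; first exact: gE.
have xqp : x q - x p = c q *: g e by apply: gE.
split.
  move=> e'; move: xqp; rewrite -e' subrr => /esym/eqP; rewrite scaler_eq0 gt_eqF //=.
  by move=> /eqP h; rewrite h pairing0l ltxx in ge.
right; exists u1; have le_p r : pairing (x r) u1 <= pairing (x p) u1.
  by rewrite -subr_le0 -pairingBl; have [] := ray r.
have max_p y : hull x y -> pairing y u1 <= pairing (x p) u1 by apply: hull_max.
apply/seteqP; split=> y /=.
  move=> /conv_rows2[l hl ->]; split; first by apply: hull_conv => //; apply: hull_pt.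
  by move=> z /max_p; rewrite xqp pairingDl !pairingZl u1e !mulr0 addr0.
move=> /(@face_combination _ _ _ x)[w [w0 w1 -> hw]].
have wr r : 0 < w r -> onray r.
  move=> /hw[_ /(_ _ (hull_pt x p)) h].
  by rewrite /onray /g pairingBl subr_eq0 eq_le le_p.
apply/conv_rows2; exists (\sum_t w t * (c t / c q)).
  have bnd t : 0 <= w t * (c t / c q) <= w t.
    have := w0 t; rewrite le_eqVlt => /orP[/eqP<-|wt]; first by rewrite mul0r lexx.
    have ot := wr t wt; rewrite mulr_ge0 //=; last first.
      have [tp|tp] := eqVneq t p; last by rewrite divr_ge0 // ltW // cpos.
      by rewrite /c tp gp pairing0l !mul0r.
    by rewrite ler_piMr // ler_pdivrMr // mul1r qmax.
  apply/andP; split; first by apply: sumr_ge0 => t _; have /andP[] := bnd t.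
  by rewrite -w1; apply: ler_sum => t _; have /andP[] := bnd t.
rewrite xqp scalerA mulr_suml scaler_suml -[x p]scale1r -w1 scaler_suml -big_split.
apply: eq_bigr => t _ /=; have := w0 t; rewrite le_eqVlt => /orP[/eqP<-|wt].
  by rewrite !mul0r !scale0r addr0.
rewrite -mulrA divfK ?gt_eqF // -scalerA -gE; last exact: wr.
by rewrite -scalerDr /g addrC subrK.
Qed.

End EdgesAt.

(** Write q as a convex combination of points x t that lie on the edge. If none of them were q, all
    their parameters along the edge would be below 1, and so would their average, which is the
    parameter of q. *)
Lemma edge_end p q (c : R) w : is_edge (hull x) (x p) q -> 0 < c -> q = x p + c *: w ->
  exists q', q = x q'.
Proof.
move=> [pq hF] c0 eq_; have qF : conv_rows (col_mx (x p) q) q.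
  by apply/conv_rows2; exists 1; rewrite ?ler01 ?lexx // scale1r addrC subrK.
case: hF => [h|[u hF]]; first by rewrite h in qF.
have /face_combination[l [l0 l1 eql hl]] : max_face (hull x) u q by rewrite /max_face -hF.
have on t : 0 < l t -> exists2 s, s <= 1 & x t = x p + s *: (q - x p).
  move=> /hl; rewrite /max_face -hF.
  by move=> /conv_rows2[s /andP[_ s1] ->]; exists s.
apply: contrapT => nq.
have /choice[s hs] : forall t, exists s : R, 0 < l t -> s < 1 /\ x t = x p + s *: (q - x p).
  move=> t; have [lt|lt] := boolP (0 < l t); last by exists 0.
  have [s s1 e] := on t lt; exists s => _; split=> //; rewrite lt_neqAle s1 andbT.
  by apply/eqP => h; apply: nq; exists t; rewrite e h scale1r addrC subrK.
have e1 : q - x p = (\sum_t l t * s t) *: (q - x p).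
  rewrite {1}eql -{1}[x p]scale1r -l1 scaler_suml -sumrB scaler_suml; apply: eq_bigr => t _.
  have := l0 t; rewrite le_eqVlt => /orP[/eqP<-|lt]; first by rewrite mul0r !scale0r subrr.
  by have [_ e] := hs t lt; rewrite -scalerBr {1}e addrAC subrr add0r scalerA.
have qp : q - x p != 0 by rewrite subr_eq0; apply/eqP => e; apply: pq.
have /eqP : (1 - \sum_t l t * s t) *: (q - x p) = 0 by rewrite scalerBl scale1r -e1 subrr.
rewrite scaler_eq0 (negPf qp) orbF subr_eq0 => /eqP hS.
have [t0 lt0] := weight_pos l0 l1; have : \sum_t l t * s t < \sum_t l t.
  rewrite (bigD1 t0) //= [ltRHS](bigD1 t0) //= ltr_leD //.
    by rewrite gtr_pMr //; have [] := hs t0 lt0.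
  apply: ler_sum => t _; have := l0 t; rewrite le_eqVlt => /orP[/eqP<-|lt].
    by rewrite mul0r.
  by rewrite ler_piMr //; have [/ltW] := hs t lt.
by rewrite -hS l1 ltxx.
Qed.

End ExposedPoints.

(** * From smooth lattice polytopes to integral models *)

Section PolytopeModel.
Variables (R : realType) (n : nat).

(** The edges generate the cone at p and their primitive directions are the rows of a unimodular
    matrix, whence nonnegative coordinates. The length of an edge is an integer because it is a
    coordinate in that basis. *)
Lemma exposed_model (V : finType) (y : V -> 'rV[int]_n) :
  (forall p, exists u, forall q, q != p ->
     pairing (real_mx R (y q)) u < pairing (real_mx R (y p)) u) ->
  smooth_polytope (hull (fun p => real_mx R (y p))) ->
  exists X : smooth_model n V, pt X = y.
Proof.
move=> exposed smooth; set x := fun p => real_mx R (y p) in exposed smooth *.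
have y_inj : injective y.
  move=> p q e; apply/eqP; apply: contraT => pq; have [u /(_ _ pq)] := exposed q.
  by rewrite /x e ltxx.
have [B hB] := choice (fun p => smooth _ (exposed_vertex exposed p)).
have Bu p : B p \in unitmx := (hB p).1.
have realB p (z : 'rV[int]_n) :
    real_mx R (z *m invmx (B p)) = real_mx R z *m real_mx R (invmx (B p)).
  exact: real_mxM.
have coordB p i : real_mx R (row i (B p)) *m real_mx R (invmx (B p)) = delta_mx 0 i.
  rewrite -realB -row_mul mulmxV //; apply/rowP => j; rewrite !mxE /=.
  by rewrite eq_sym; case: eqP.
pose f p i (z : 'rV[R]_n) := (z *m real_mx R (invmx (B p))) 0 i.
have fE p i z : ((z *m invmx (B p)) 0 i)%:~R = f p i (real_mx R z).
  by rewrite /f -realB [RHS]mxE.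
have cone_ge0 p q i : 0 <= ((y q - y p) *m invmx (B p)) 0 i.
  have [A [hA eA]] := edge_generators exposed p.
  have ge0 e : e \in A -> 0 <= f p i (x e - x p).
    move=> /eA[q' [t [t0 eq_ edge_q']]].
    have y0 : y q' - y p != 0.
      by rewrite subr_eq0; apply/eqP => /y_inj e'; case: edge_q'; rewrite e'.
    have [d [w [d0 pw dw]]] := primitive_part y0.
    have xq : x q' - x p = d%:~R *: real_mx R w by rewrite /x -real_mxB dw real_mxZ.
    have : primitive_edge_direction (hull x) (x p) w.
      split=> //; exists (x q'), d%:~R; split=> //; first by rewrite ltr0z.
      by rewrite -xq addrC subrK.
    move=> /(hB p).2[j ej].
    have -> : x e - x p = (t^-1 * d%:~R) *: real_mx R w.
      by rewrite -scalerA -xq eq_ scalerA mulVf ?scale1r // gt_eqF.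
    rewrite /f -scalemxAl ej coordB !mxE mulr_ge0 //.
    by apply: mulr_ge0; rewrite ?invr_ge0 ?ler0z; apply: ltW.
  rewrite -(ler0z R) fE real_mxB -/(x q) -/(x p).
  have [w [w0 wA ->]] := hA q; rewrite /f mulmx_suml summxE.
  apply: sumr_ge0 => t _; rewrite -scalemxAl mxE.
  have [/ge0 h|/wA->] := boolP (t \in A); last by rewrite mul0r.
  by rewrite mulr_ge0.
have edges p i : exists qc : V * int,
    0 < qc.2 /\ y qc.1 = y p + qc.2 *: row i (B p).
  have [_ [q [c [pq c0 eq_]]]] : primitive_edge_direction (hull x) (x p) (row i (B p)).
    by apply/(hB p).2; exists i.
  have [q' eq'] := edge_end pq c0 eq_; pose d := ((y q' - y p) *m invmx (B p)) 0 i.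
  have xd : x q' - x p = c *: real_mx R (row i (B p)) by rewrite -eq' eq_ addrC addKr.
  have dc : d%:~R = c.
    by rewrite /d fE real_mxB -/(x q') -/(x p) xd /f -scalemxAl coordB !mxE !eqxx mulr1.
  exists (q', d); split=> /=; first by rewrite -(ltr0z R) dc.
  apply: (@real_mx_inj R); rewrite real_mxD real_mxZ dc -xd.
  by rewrite addrC subrK.
have [qc hqc] := choice (fun pi : V * 'I_n => edges pi.1 pi.2).
exists (@SmoothModel n V y B (fun p i => (qc (p, i)).1) (fun p i => (qc (p, i)).2)
  y_inj Bu (fun p i => (hqc (p, i)).1) (fun p i => (hqc (p, i)).2) cone_ge0).
by [].
Qed.

Lemma polytope_model (P : set 'rV[R]_n) : lattice_polytope P -> smooth_polytope P ->
  exists (V : finType) (X : smooth_model n V), P = hull (fun p => real_mx R (pt X p)).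
Proof.
move=> [k [A ->]] smooth; pose x i := real_mx R (row i A).
have [B [hB exposed]] := hull_exposed x.
have eP : conv_rows (real_mx R A) = hull (fun t : {t | t \in B} => real_mx R (row (val t) A)).
  rewrite -(hull_restrict x) -hB; apply/predeqP => z; rewrite hullP /x; split.
    move=> [w [w0 w1 ->]]; exists (fun i => w 0 i); split=> //.
    by rewrite mulmx_sum_row; apply: eq_bigr => i _; rewrite /real_mx map_row.
  move=> [w [w0 w1 ->]]; exists (\row_i w i); split.
  - by move=> i; rewrite mxE.
  - by rewrite -w1; apply: eq_bigr => i _; rewrite mxE.
  by rewrite mulmx_sum_row; apply: eq_bigr => i _; rewrite mxE /real_mx map_row.
rewrite eP in smooth *.
have [|X eX] := exposed_model _ smooth; last by exists _, X; rewrite eX.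
move=> t; have [u hu] := exposed _ (valP t); exists u => s st.
by apply: hu; [apply: valP|rewrite (inj_eq val_inj)].
Qed.

Lemma hull_full (P : set 'rV[R]_n) (V : finType) (x : V -> 'rV[R]_n) :
  P = hull x -> full_dimensional P -> exists p : V, True.
Proof.
move=> -> [A [_ /(_ ord0) /hullP[w [w0 w1 _]]]].
by have [t _] := weight_pos w0 w1; exists t.
Qed.

End PolytopeModel.

(** * Charts of the toric variety *)

Section ToricCharts.
Variables (R : realType) (K : closedFieldType) (n : nat) (V : finType).
Variable X : smooth_model n V.
Implicit Types (p q r : V) (i j k : 'I_n) (m : 'rV[int]_n) (u : 'rV[R]_n) (A B : {set V}).
Local Notation pt := (pt X).
Local Notation nb := (nb X).
Local Notation edge := (edge X).
Local Notation co := (co X).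
Local Notation nrm := (nrm X).
Local Notation rpt := (fun p => real_mx R (pt p)).

Definition polytope : set 'rV[R]_n := hull rpt.
Definition fan := outer_normal_fan polytope.

(** When A is the vertex set of a face, this is the normal cone of the face. Allowing arbitrary A
    turns an intersection of cones into a union of vertex sets, so that overlaps of charts have the
    same form as charts. *)
Definition vcone A : set 'rV[R]_n :=
  [set u : 'rV[R]_n | forall p q, p \in A -> pairing (rpt q) u <= pairing (rpt p) u]%classic.

Lemma model_exposed p : exists u : 'rV[R]_n, forall q, q != p ->
  pairing (rpt q) u < pairing (rpt p) u.
Proof.
exists (real_mx R (face_normal X p pred0)) => q qp; rewrite !pairing_real ltr_int.
rewrite lt_neqAle pairing_max_le ?andbT; last exact: edge_face_normal_le0.
by apply: contra qp => /eqP/face_normal_eq h; apply/eqP/(@co_pt_eq _ _ X) => i; apply: h.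
Qed.

Lemma outer_normal_vcone (F : set 'rV[R]_n) : is_face polytope F -> (F !=set0)%classic ->
  exists2 A : {set V}, A != finset.set0 & outer_normal_cone polytope F = vcone A.
Proof.
move=> [->|[u0 eF]] [x0 Fx0] //; subst F; set F := [set _ | _]%classic in Fx0 *; pose A := [set p | `[< F (rpt p) >]]%SET.
have hA p : p \in A <-> F (rpt p) by rewrite inE; split=> /asboolP.
exists A.
  have [w [w0 w1 _ hw]] := face_combination Fx0.
  have [p /hw/hA pA] := weight_pos w0 w1.
  by apply/set0Pn; exists p.
apply/seteqP; split=> u hu.
  by move=> p q /hA Fp; apply: hu => //; apply: hull_pt.
move=> y z /face_combination[w [w0 w1 -> hw]] Pz.
have [p0 wp0] := weight_pos w0 w1; have /hA p0A := hw _ wp0.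
apply: (@le_trans _ _ (pairing (rpt p0) u)).
  by apply: (hull_max _ Pz) => q; apply: hu.
rewrite pairing_suml -[leLHS]mul1r -w1 mulr_suml; apply: ler_sum => p _.
rewrite pairingZl; have := w0 p; rewrite le_eqVlt => /orP[/eqP<-|wp].
  by rewrite !mul0r.
by rewrite ler_pM2l //; apply: hu; apply/hA/hw.
Qed.

Lemma fan_vcone s : fan s -> exists2 A : {set V}, A != finset.set0 & s = vcone A.
Proof. by move=> [F [fF F0 ->]]; apply: outer_normal_vcone. Qed.

Lemma fan_vertex p : fan (vcone [set p]).
Proof.
exists [set rpt p]%classic; split.
- exact: (exposed_vertex model_exposed).
- by exists (rpt p).
apply/seteqP; split=> u hu.
  move=> y z -> Pz; apply: (hull_max _ Pz) => q; apply: hu.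
  by rewrite inE.
by move=> q r; rewrite inE => /eqP ->; apply: hu => //; apply: hull_pt.
Qed.

Lemma vconeI A B : (vcone A `&` vcone B)%classic = vcone (A :|: B).
Proof.
apply/seteqP; split=> u.
  by move=> [hA hB] p q; rewrite inE => /orP[/hA|/hB]; apply.
by move=> h; split=> p q pA; apply: h; rewrite inE pA ?orbT.
Qed.

Local Notation dm A := (dual_monoid (vcone A)).

Lemma real_pairing_coE p m u :
  pairing (real_mx R m) u = \sum_i (co p m i)%:~R * pairing (real_mx R (edge p i)) u.
Proof.
rewrite {1}(coE X p m) real_mx_sum pairing_suml; apply: eq_bigr => i _.
by rewrite real_mxZ pairingZl.
Qed.

Lemma vcone_edge A p i u : p \in A -> vcone A u -> pairing (real_mx R (edge p i)) u <= 0.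
Proof.
move=> pA /(_ p (nb p i) pA); rewrite pt_nb real_mxD real_mxZ pairingDl pairingZl gerDl.
by rewrite pmulr_rle0 // ltr0z len_gt0.
Qed.

Lemma dm_subr A p q : p \in A -> dm A (pt p - pt q).
Proof. by move=> pA u /(_ p q pA) h; rewrite real_mxB pairingBl subr_ge0. Qed.

(** The cone of A is generated by the normals of those facets at p that contain A, and the monoid is
    tested on these. As the normals are outer, the monoid of a single vertex is spanned by the
    negated edges. *)
Lemma dmP A p m : p \in A ->
  dm A m <-> (forall i, (forall q, q \in A -> co p (pt q - pt p) i = 0) -> co p m i <= 0).
Proof.
move=> pA; split=> [hm i hi|h u hu].
  have /hm : vcone A (real_mx R (nrm p i)).
    move=> q r qA; rewrite !pairing_real ler_int.
    have := hi q qA; move/eqP; rewrite -oppr_eq0 -pairing_nrm pairingBl subr_eq0 => /eqP->.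
    by rewrite -subr_le0 -pairingBl pairing_nrm oppr_le0 cone_co.
  by rewrite pairing_real ler0z pairing_nrm oppr_ge0.
rewrite (real_pairing_coE p); apply: sumr_ge0 => i _.
have [e|/eqP e] := pselect (pairing (real_mx R (edge p i)) u = 0); first by rewrite e mulr0.
apply: mulr_le0; last exact: (vcone_edge _ pA).
rewrite lerz0; apply: h => q qA; move: i e; apply/cone_sum_eq0.
  by move=> i; apply: (vcone_edge _ pA).
rewrite -real_pairing_coE real_mxB pairingBl; apply/eqP; rewrite subr_eq0 eq_le.
by rewrite !hu.
Qed.

Lemma dm_vertex p m : dm [set p] m <-> forall i, co p m i <= 0.
Proof.
rewrite (@dmP _ p) ?inE //; split=> h i; last by [].
by apply: h => q; rewrite inE => /eqP ->; rewrite subrr co0.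
Qed.

Lemma dm_sub A B m : A \subset B -> dm A m -> dm B m.
Proof.
move=> /fintype.subsetP AB hm u hu; apply: hm => p q pA.
by apply: hu; apply: AB.
Qed.

Lemma dm0 s : dual_monoid (R := R) s (0 : 'rV[int]_n).
Proof. by move=> u _; rewrite real_mx0 pairing0l. Qed.

Lemma dmD s m m' : dual_monoid (R := R) s m -> dual_monoid s m' -> dual_monoid s (m + m').
Proof. by move=> h h' u hu; rewrite real_mxD pairingDl addr_ge0 ?h ?h'. Qed.

Lemma dm_sum s (I : Type) (l : seq I) (Q : pred I) (f : I -> 'rV[int]_n) :
  (forall a, Q a -> dual_monoid (R := R) s (f a)) -> dual_monoid s (\sum_(a <- l | Q a) f a).
Proof. by move=> h; apply: big_ind => //; [apply: dm0|move=> *; apply: dmD]. Qed.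

Lemma dmMn s m N : dual_monoid (R := R) s m -> dual_monoid s (m *+ N).
Proof.
move=> h; elim: N => [|N IH]; first by rewrite mulr0n; apply: dm0.
by rewrite mulrS; apply: dmD.
Qed.

Lemma coMn p x N i : co p (x *+ N) i = co p x i *+ N.
Proof. by elim: N => [|N IH]; rewrite ?co0 // !mulrS coD IH. Qed.

Section Hom.
Variables (s : set 'rV[R]_n) (g : 'rV[int]_n -> K).
Hypothesis hg : monoid_hom (dual_monoid s) g.

Lemma hom0 : g 0 = 1. Proof. by case: hg. Qed.
Lemma homD m m' : dual_monoid s m -> dual_monoid s m' -> g (m + m') = g m * g m'.
Proof. by case: hg => _ h _; apply: h. Qed.
Lemma hom_out m : ~ dual_monoid s m -> g m = 0.
Proof. by case: hg => _ _; apply. Qed.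

Lemma homMn m N : dual_monoid s m -> g (m *+ N) = g m ^+ N.
Proof.
move=> hm; elim: N => [|N IH]; first by rewrite mulr0n expr0 hom0.
by rewrite mulrS homD ?IH ?exprS //; apply: dmMn.
Qed.

Lemma hom_sum (I : Type) (l : seq I) (Q : pred I) (f : I -> 'rV[int]_n) :
  (forall a, Q a -> dual_monoid s (f a)) ->
  g (\sum_(a <- l | Q a) f a) = \prod_(a <- l | Q a) g (f a).
Proof.
move=> h; elim: l => [|a l IH]; first by rewrite !big_nil hom0.
rewrite !big_cons; case: ifPn => [Qa|//].
by rewrite homD ?IH //; [apply: h|apply: dm_sum].
Qed.

Lemma hom_unit m : dual_monoid s m -> dual_monoid s (- m) -> g m != 0.
Proof.
move=> h h'; apply/eqP => e; have := hom0; rewrite -(subrr m) homD // e mul0r => /eqP.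
by rewrite eq_sym oner_eq0.
Qed.

Definition hom_restrict (t : set 'rV[R]_n) m : K := if `[< dual_monoid t m >] then g m else 0.

Lemma hom_restrictE t m : dual_monoid t m -> hom_restrict t m = g m.
Proof. by move=> h; rewrite /hom_restrict asboolT. Qed.

Lemma hom_restrict_hom t : (forall m, dual_monoid t m -> dual_monoid s m) ->
  monoid_hom (dual_monoid t) (hom_restrict t).
Proof.
move=> ts; split.
- by rewrite hom_restrictE ?hom0 //; apply: dm0.
- move=> m m' h h'; rewrite !hom_restrictE ?homD //; [exact: ts|exact: ts|].
  exact: dmD.
- by move=> m h; rewrite /hom_restrict asboolF.
Qed.

End Hom.

(** For p in A and A included in B, adding [bound p m] copies of this character brings a character m
    of the larger monoid of B back into that of A. *)
Let shift p B : 'rV[int]_n := \sum_(q in B) (pt p - pt q).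
Let bound p m : nat := (\sum_i `|co p m i|)%N.

Let dm_shift A B p m N : p \in A -> A \subset B -> dm B m -> (bound p m <= N)%N ->
  dm A (m + shift p B *+ N).
Proof.
move=> pA AB /(dmP m (fintype.subsetP AB _ pA)) hm hN; apply/(dmP _ pA) => i hi.
have shiftE : co p (shift p B) i = - \sum_(q in B) co p (pt q - pt p) i.
  by rewrite co_sum -sumrN; apply: eq_bigr => q _; rewrite -coN opprB.
have le0 : co p (shift p B) i <= 0.
  by rewrite shiftE oppr_le0 sumr_ge0 // => q _; apply: cone_co.
rewrite coD coMn.
have [/forall_inP h|/forall_inPn[q qB hq]] :=
    boolP [forall q in B, co p (pt q - pt p) i == 0].
  have := hm i (fun q qB => eqP (h q qB)).
  by rewrite shiftE big1 ?oppr0 ?mul0rn ?addr0 // => q /h/eqP.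
have lt0 : co p (shift p B) i <= -1.
  rewrite shiftE (bigD1 q) //=; have := cone_co X p q i; rewrite le_eqVlt eq_sym (negPf hq) /=.
  have : 0 <= \sum_(r in B | r != q) co p (pt r - pt p) i.
    by apply: sumr_ge0 => r _; apply: cone_co.
  by move: (\sum_(_ in _ | _) _) (co _ _ _) => a b; lia.
have mi : co p m i <= N%:Z.
  apply: (@le_trans _ _ (bound p m)%:Z); last by rewrite lez_nat.
  apply: (le_trans (ler_norm _)); rewrite -abszE lez_nat /bound (bigD1 i) //=.
  exact: leq_addr.
rewrite -mulr_natr natz; move: mi lt0; set a := co p m i; set b := co p _ _; nia.
Qed.

(* Localization at the characters [pt p - pt q], q in B. *)
Lemma hom_extend A B p g : p \in A -> A \subset B -> monoid_hom (dm A) g ->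
  (forall q, q \in B -> g (pt p - pt q) != 0) ->
  exists2 g', monoid_hom (dm B) g' & forall m, dm A m -> g' m = g m :> K.
Proof.
move=> pA AB hg gB; set m0 := shift p B.
have dm0' : dm A m0 by apply: dm_sum => q _; apply: dm_subr.
have g0 : g m0 != 0.
  by rewrite (hom_sum hg) => [|q _]; [apply/prodf_neq0|apply: dm_subr].
have gU N : g m0 ^+ N \is a GRing.unit by rewrite unitfE expf_neq0.
pose g' m := if `[< dm B m >] then g (m + m0 *+ bound p m) / g m0 ^+ bound p m else 0.
(* The fraction does not depend on the exponent once it reaches the bound, which gives
   multiplicativity. *)
have key m N : dm B m -> (bound p m <= N)%N -> g (m + m0 *+ N) = g' m * g m0 ^+ N.
  move=> hm hN; rewrite /g' asboolT //; rewrite -{1 2}(subnKC hN) mulrnDr addrA exprD.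
  rewrite (homD hg (m := m + _)); last exact: dmMn.
    by rewrite (homMn hg) // mulrA divrK.
  exact: (@dm_shift A B).
have g'E m N : dm B m -> (bound p m <= N)%N -> g' m = g (m + m0 *+ N) / g m0 ^+ N.
  by move=> hm hN; rewrite key // mulrK.
exists g'; last first.
  move=> m hm; rewrite (g'E _ (bound p m)) //; last exact: dm_sub hm.
  by rewrite (homD hg) ?(homMn hg) ?mulrK //; apply: dmMn.
split.
- have b0 : bound p 0 = 0%N by rewrite /bound big1 // => i _; rewrite co0.
  by rewrite (g'E _ 0%N) ?b0 ?mulr0n ?addr0 ?(hom0 hg) ?divr1 //; apply: dm0.
- move=> m m' hm hm'.
  have le : (bound p (m + m') <= bound p m + bound p m')%N.
    by rewrite /bound -big_split; apply: leq_sum => i _; rewrite coD /=; lia.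
  rewrite (g'E _ _ (dmD hm hm') le) mulrnDr addrACA (homD hg); first last.
  - exact: (@dm_shift A B).
  - exact: (@dm_shift A B).
  by rewrite !key // exprD mulrACA mulrK // unitrM !gU.
- by move=> m hm; rewrite /g' asboolF.
Qed.

Lemma hom_extend_uniq A B p g1 g2 : p \in A -> A \subset B ->
  monoid_hom (dm B) g1 -> monoid_hom (dm B) g2 ->
  (forall m, dm A m -> g1 m = g2 m :> K) -> forall m, dm B m -> g1 m = g2 m.
Proof.
move=> pA AB h1 h2 h12 m hm; set m0 := shift p B.
have d0 : dm A m0 by apply: dm_sum => q _; apply: dm_subr.
have d0B : dm B m0 by apply: dm_sub d0.
have d1 : dm B (- m0).
  by rewrite /m0 /shift -sumrN; apply: dm_sum => q qB; rewrite opprB; apply: dm_subr.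
have u0 : g1 m0 ^+ bound p m != 0 by rewrite expf_neq0 // (hom_unit h1).
apply: (mulIf u0); rewrite {2}(h12 _ d0) -(homMn h1) // -(homMn h2) // -(homD h1) -?(homD h2) //.
- by apply: h12; apply: dm_shift.
- exact: dmMn.
- exact: dmMn.
Qed.

End ToricCharts.

(** * Gluing and supports *)

Section Gluing.
Variables (R : realType) (K : closedFieldType) (n : nat) (V : finType).
Variable X : smooth_model n V.
Implicit Types (p q r : V) (i j k : 'I_n) (m : 'rV[int]_n) (u : 'rV[R]_n) (A B D : {set V}).
Implicit Types (c d e : chart_point R K n) (g h : 'rV[int]_n -> K).
Local Notation pt := (pt X).
Local Notation vcone := (@vcone R n V X).
Local Notation dm A := (dual_monoid (vcone A)).
Local Notation fan := (@fan R n V X).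
Local Notation toric := (toric_variety (K := K) fan).

Lemma glued_sym c d : glued c d -> glued d c.
Proof. by move=> [k [hk h1 h2]]; exists k; split=> //; rewrite setIC. Qed.

Lemma chart_vcone c : is_chart_point fan c -> exists A g,
  [/\ A != finset.set0, monoid_hom (dm A) g & c = (vcone A, g)].
Proof.
case: c => s g [/fan_vcone[A A0 /= ->] hg].
by exists A, g.
Qed.

Lemma glued_refl c : is_chart_point fan c -> glued c c.
Proof. by case: c => s g [_ hg]; exists g; split=> //=; rewrite setIid. Qed.

Lemma glued_neq0 A B g h p q : glued (vcone A, g) (vcone B, h) -> p \in A -> q \in B ->
  g (pt p - pt q) != 0.
Proof.
move=> [k [hk kg kh]] pA qB; rewrite /= vconeI in hk kg kh.
rewrite -kg; last exact: dm_subr.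
apply: (hom_unit hk).
  by apply: dm_subr; rewrite inE pA.
by rewrite opprB; apply: dm_subr; rewrite inE qB orbT.
Qed.

(** The middle homomorphism h is nonzero at [pt q - pt s] for every s in A and D, so it extends to
    the overlap of all three charts. By uniqueness of extensions it agrees there with g and l; its
    restriction glues these two. *)
Lemma glued_trans c d e : is_chart_point fan c -> is_chart_point fan d ->
  is_chart_point fan e -> glued c d -> glued d e -> glued c e.
Proof.
move=> /chart_vcone[A [g [/set0Pn[p pA] hg ->]]] /chart_vcone[B [h [/set0Pn[q qB] hh ->]]].
move=> /chart_vcone[D [l [/set0Pn[r rD] hl ->]]] gcd gde.
have q_neq0 s : s \in (B :|: (A :|: D))%SET -> h (pt q - pt s) != 0.
  rewrite !inE => /or3P[sB|sA|sD].
  - by apply: (hom_unit hh); rewrite ?opprB; apply: dm_subr.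
  - exact: (glued_neq0 (glued_sym gcd) qB sA).
  - exact: (glued_neq0 gde qB sD).
have [k hk kh] := hom_extend qB (finset.subsetUl _ _) hh q_neq0.
have agree (E : {set V}) t (f : 'rV[int]_n -> K) : E \subset (A :|: D)%SET ->
    (exists k' : 'rV[int]_n -> K, [/\ monoid_hom (dm (B :|: E)) k', forall m, dm B m -> k' m = h m
      & forall m, dm E m -> k' m = f m]) -> t \in E -> forall m, dm E m -> k m = f m.
  move=> /fintype.subsetP EAD [k' [hk' kh' kf']] tE m hm; rewrite -kf' //.
  have hs : (B :|: E \subset B :|: (A :|: D))%SET by apply: finset.setUS; apply/fintype.subsetP.
  have hmBE : dm (B :|: E) m by apply: dm_sub hm; apply: finset.subsetUr.
  rewrite -(hom_restrictE k hmBE); apply: (hom_extend_uniq qB (finset.subsetUl B E)) => //.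
  - by apply: (hom_restrict_hom hk) => ?; apply: dm_sub.
  - exact: hk'.
  - move=> m' hm'; rewrite kh' // hom_restrictE ?kh //.
    by apply: dm_sub hm'; apply: finset.subsetUl.
  - exact: hmBE.
have kg : forall m, dm A m -> k m = g m.
  apply: (agree A p) => //; first exact: finset.subsetUl.
  by have [k' [h1 h2 h3]] := glued_sym gcd; exists k'; rewrite /= vconeI in h1 h2 h3; split.
have kl : forall m, dm D m -> k m = l m.
  apply: (agree D r) => //; first exact: finset.subsetUr.
  by have [k' [h1 h2 h3]] := gde; exists k'; rewrite /= vconeI in h1 h2 h3; split.
have sub : (A :|: D \subset B :|: (A :|: D))%SET by apply: finset.subsetUr.
exists (hom_restrict k (vcone (A :|: D))); rewrite /= vconeI; split.
- by apply: (hom_restrict_hom hk) => ?; apply: dm_sub.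
- by move=> m hm; rewrite hom_restrictE ?kg //; apply: dm_sub hm; apply: finset.subsetUl.
- by move=> m hm; rewrite hom_restrictE ?kl //; apply: dm_sub hm; apply: finset.subsetUr.
Qed.

Lemma class_of_eq c d : is_chart_point fan c -> is_chart_point fan d -> glued c d ->
  class_of fan c = class_of fan d.
Proof.
move=> hc hd cd; apply/seteqP; split=> e [he h]; split=> //.
  exact: (glued_trans hd hc he (glued_sym cd)).
exact: (glued_trans hc hd he cd).
Qed.

Lemma class_of_self c : is_chart_point fan c -> class_of fan c c.
Proof. by move=> hc; split=> //; apply: glued_refl. Qed.

Lemma toric_class x c : toric x -> x c -> is_chart_point fan c /\ x = class_of fan c.
Proof. by move=> [d hd ->] [hc cd]; split=> //; apply: class_of_eq. Qed.

Lemma class_toric c : is_chart_point fan c -> toric (class_of fan c).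
Proof. by exists c. Qed.

Definition vchart p g : chart_point R K n := (vcone [set p], g).

Lemma vchartP p g : is_chart_point fan (vchart p g) <-> monoid_hom (dm [set p]) g.
Proof. by split=> [[]|h] //; split=> //; apply: fan_vertex. Qed.

Lemma glued_same (s : set 'rV[R]_n) g h : monoid_hom (dual_monoid s) g -> monoid_hom (dual_monoid s) h ->
  glued (s, g) (s, h) -> g = h :> ('rV[int]_n -> K).
Proof.
move=> hg hh [k [_ kg kh]]; apply/funext => m.
have [hm|hm] := pselect (dual_monoid s m); first exact: (etrans (esym (kg _ hm)) (kh _ hm)).
by rewrite (hom_out hg) // (hom_out hh).
Qed.

Lemma class_of_inj (s : set 'rV[R]_n) g h : is_chart_point fan (s, g) -> is_chart_point fan (s, h) ->
  class_of fan (s, g) (s, h) -> g = h.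
Proof. by move=> [_ hg] [_ hh] [_]; apply: glued_same. Qed.

(* The vertices of the smallest face whose orbit closure contains x, that is,
   the fixed points in the closure of the orbit of x. *)
Definition supp (x : toric_point R K n) := [set p | `[< exists g, x (vchart p g) >]]%SET.

Lemma suppP x p : reflect (exists g, x (vchart p g)) (p \in supp x).
Proof. by rewrite inE; apply: asboolP. Qed.

(** The chart of q meets the chart of A in the locus where the character [pt p - pt q] is
    invertible. *)
Lemma mem_supp A g p q : monoid_hom (dm A) g -> is_chart_point fan (vcone A, g) ->
  p \in A -> (q \in supp (class_of fan (vcone A, g))) = (g (pt p - pt q) != 0).
Proof.
move=> hg hc pA; apply/suppP/idP => [[h [_ gh]]|gpq].
  by apply: (glued_neq0 gh pA); rewrite inE.
have g_neq0 s : s \in (A :|: [set q])%SET -> g (pt p - pt s) != 0.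
  rewrite !inE => /orP[sA|/eqP-> //].
  by apply: (hom_unit hg); rewrite ?opprB; apply: dm_subr.
have [k hk kg] := hom_extend pA (finset.subsetUl _ _) hg g_neq0.
have hq : monoid_hom (dm [set q]) (hom_restrict k (vcone [set q])).
  by apply: (hom_restrict_hom hk) => m; apply: dm_sub; apply: finset.subsetUr.
exists (hom_restrict k (vcone [set q])); split; first exact/vchartP.
exists k; rewrite /= vconeI; split=> // m hm.
by rewrite hom_restrictE.
Qed.

Lemma mem_supp_vertex p g q : monoid_hom (dm [set p]) g ->
  (q \in supp (class_of fan (vchart p g))) = (g (pt p - pt q) != 0).
Proof. by move=> hg; rewrite (mem_supp (p := p) _ hg) ?inE //; apply/vchartP. Qed.

Lemma supp_neq0 x : toric x -> exists p, p \in supp x.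
Proof.
move=> [c hc ->]; have [A [g [/set0Pn[p pA] hg ec]]] := chart_vcone hc.
exists p; rewrite ec (mem_supp (p := p)) //; last by rewrite -ec.
by rewrite subrr (hom0 hg) oner_eq0.
Qed.

Lemma supp_chart x p : toric x -> p \in supp x -> exists2 g,
  monoid_hom (dm [set p]) g & x = class_of fan (vchart p g).
Proof.
move=> hx /suppP[g xg]; have [/vchartP hg ->] := toric_class hx xg.
by exists g.
Qed.

Section VertexCoordinates.
Variable p : V.
Local Notation co := (co X).
Local Notation edge := (edge X).

Lemma dm_edge i : dm [set p] (- edge p i).
Proof.
by apply/dm_vertex => j; rewrite coN co_edge oppr_le0; case: eqP.
Qed.

Lemma hom_vertexE g m : monoid_hom (dm [set p]) g -> dm [set p] m ->
  g m = \prod_i g (- edge p i) ^+ `|co p m i|%N.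
Proof.
move=> hg hm; rewrite {1}(coE X p m).
have -> : \sum_i co p m i *: edge p i = \sum_i (- edge p i) *+ `|co p m i|%N.
  apply: eq_bigr => i _; rewrite -scaler_nat natz abszE.
  have := (dm_vertex R X p m).1 hm i => le0; rewrite ler0_norm //.
  by rewrite scaleNr scalerN opprK.
rewrite (hom_sum hg) => [|i _]; last by apply: dmMn; apply: dm_edge.
by apply: eq_bigr => i _; rewrite (homMn hg) //; apply: dm_edge.
Qed.

(** By smoothness the chart at p is an affine space; y lists the values at the generators
    [- edge p i] of its monoid. *)
Definition coord_hom (y : 'I_n -> K) m : K :=
  if [forall i, co p m i <= 0] then \prod_i y i ^+ `|co p m i|%N else 0.

Lemma coord_homP y : monoid_hom (dm [set p]) (coord_hom y).
Proof.
have coord m : dm [set p] m -> coord_hom y m = \prod_i y i ^+ `|co p m i|%N.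
  by move=> /dm_vertex h; rewrite /coord_hom (introT forallP h).
split.
- by rewrite coord; [apply: big1 => i _; rewrite co0 expr0|apply: dm0].
- move=> m m' h h'; rewrite !coord //; last exact: dmD.
  rewrite -big_split; apply: eq_bigr => i _ /=; rewrite coD -exprD; congr (_ ^+ _).
  have := (dm_vertex R X p m).1 h i; have := (dm_vertex R X p m').1 h' i.
  by lia.
- move=> m h; rewrite /coord_hom; case: forallP => // h'.
  by case: h; apply/dm_vertex.
Qed.

Lemma coord_hom_edge y i : coord_hom y (- edge p i) = y i.
Proof.
rewrite /coord_hom (introT forallP) => [|j]; last by have /dm_vertex := dm_edge i; apply.
rewrite (bigD1 i) //= coN co_edge eqxx big1 ?mulr1 // => j ji.
by rewrite coN co_edge (negPf ji) expr0.
Qed.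

Lemma vertex_hom_neq0 g m : monoid_hom (dm [set p]) g -> dm [set p] m ->
  (g m != 0) = [forall i, (co p m i != 0) ==> (g (- edge p i) != 0)].
Proof.
move=> hg hm; rewrite hom_vertexE //; apply/prodf_neq0/forallP => h i.
  apply/implyP => ci; have := h i isT; apply: contra => /eqP->.
  by rewrite expr0n absz_eq0 (negPf ci).
move=> _; have [c0|ci] := eqVneq (co p m i) 0; first by rewrite c0 expr0 oner_eq0.
by rewrite expf_neq0 //; have := h i; rewrite ci.
Qed.

Lemma mem_supp_coord g q : monoid_hom (dm [set p]) g ->
  (q \in supp (class_of fan (vchart p g))) =
  [forall i, (co p (pt q - pt p) i != 0) ==> (g (- edge p i) != 0)].
Proof.
move=> hg; rewrite mem_supp_vertex // vertex_hom_neq0 //; last by apply: dm_subr; rewrite inE.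
by apply: eq_forallb => i; rewrite -opprB coN oppr_eq0.
Qed.

Lemma mem_supp_nb g i : monoid_hom (dm [set p]) g ->
  (nb X p i \in supp (class_of fan (vchart p g))) = (g (- edge p i) != 0).
Proof.
move=> hg; rewrite mem_supp_coord //; apply/forallP/idP => [/(_ i)|h j].
  by rewrite co_nb eqxx mulr1 gt_eqF ?len_gt0.
by rewrite co_nb; have [->|_] := eqVneq j i; rewrite ?mulr0 ?eqxx // h implybT.
Qed.

End VertexCoordinates.
End Gluing.

(** * Fixed points, cells and closures *)

Lemma poly_vanish (K : closedFieldType) (f : {poly K}) (z : {poly K}) :
  z != 0 -> (forall t, z.[t] != 0 -> f.[t] = 0) -> f = 0.
Proof.
move=> z0 h; apply/eqP; apply: contraT => f0.
have /closed_nonrootP[t] : f * z != 0 by rewrite mulf_neq0.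
rewrite /root hornerM mulf_eq0 negb_or => /andP[ft /h e].
by rewrite e eqxx in ft.
Qed.

Lemma infinite_closed_field (K : closedFieldType) : ~ finite_set [set: K]%classic.
Proof.
move=> /finite_seqP[s hs]; pose f : {poly K} := \prod_(a <- s) ('X - a%:P).
have /closed_nonrootP[t] : f != 0 by rewrite monic_neq0 // monic_prod_XsubC.
by rewrite /f root_prod_XsubC => /negP; apply; have : [set: K]%classic t by []; rewrite hs.
Qed.

Section Cells.
Variables (R : realType) (K : closedFieldType) (n : nat) (V : finType).
Variable X : smooth_model n V.
Variable v : 'rV[int]_n.
Implicit Types (p q r : V) (i j k : 'I_n) (m : 'rV[int]_n).
Implicit Types (c d : chart_point R K n) (g h : 'rV[int]_n -> K) (x : toric_point R K n).
Local Notation pt := (pt X).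
Local Notation nb := (nb X).
Local Notation co := (co X).
Local Notation edge := (edge X).
Local Notation vcone := (@vcone R n V X).
Local Notation dm A := (dual_monoid (vcone A)).
Local Notation fan := (@fan R n V X).
Local Notation toric := (toric_variety (K := K) fan).
Local Notation vchart := (@vchart R K n V X).
Local Notation supp := (supp X).

Definition act (t : K) c : chart_point R K n := (c.1, fun m => t ^ pairing m v * c.2 m).

Lemma act_hom (s : set 'rV[R]_n) t g : t != 0 -> monoid_hom (dual_monoid s) g ->
  monoid_hom (dual_monoid s) (fun m => t ^ pairing m v * g m).
Proof.
move=> t0 hg; split.
- by rewrite pairing0l expr0z mul1r (hom0 hg).
- by move=> m m' hm hm'; rewrite pairingDl expfzDr // (homD hg) // mulrACA.
- by move=> m hm; rewrite (hom_out hg) // mulr0.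
Qed.

Lemma act_chart t c : t != 0 -> is_chart_point fan c -> is_chart_point fan (act t c).
Proof. by move=> t0 [h1 h2]; split=> //; apply: act_hom. Qed.

Lemma act_glued t c d : t != 0 -> glued c d -> glued (act t c) (act t d).
Proof.
move=> t0 [k [hk kc kd]]; exists (fun m => t ^ pairing m v * k m); split.
- exact: act_hom.
- by move=> m hm /=; rewrite kc.
- by move=> m hm /=; rewrite kd.
Qed.

Lemma actK t c : t != 0 -> act t (act t^-1 c) = c.
Proof.
case: c => s g t0; rewrite /act /=; congr (_, _); apply/funext => m.
by rewrite mulrA exprz_inv -expfzDr // subrr expr0z mul1r.
Qed.

Lemma class_fixed c : is_chart_point fan c -> (forall t, t != 0 -> act t c = c) ->
  fixed_locus fan v (class_of fan c).
Proof.
move=> hc fc; split; first exact: class_toric.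
have sub (t : K) d : t != 0 -> class_of fan c d -> class_of fan c (act t d).
  move=> t0 [hd cd]; split; first exact: act_chart.
  by rewrite -(fc t t0); apply: act_glued.
move=> t t0; apply/seteqP; split=> d.
  by move=> [d' hd' <-]; apply: sub.
move=> hd; exists (act t^-1 d); last exact: actK.
by apply: sub => //; rewrite invr_eq0.
Qed.

Lemma fixed_weight p g m : monoid_hom (dm [set p]) g ->
  fixed_locus fan v (class_of fan (vchart p g)) -> g m != 0 -> pairing m v = 0.
Proof.
move=> hg [_ fx] gm; have hc : is_chart_point fan (vchart p g) by apply/vchartP.
have e (t : K) : t != 0 -> t ^ pairing m v = 1.
  move=> t0; have : class_of fan (vchart p g) (act t (vchart p g)).
    by rewrite -{1}(fx t t0); exists (vchart p g) => //; apply: class_of_self.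
  move=> /(class_of_inj hc (act_chart t0 hc)) /(congr1 (fun f => f m)) e.
  by apply: (mulIf gm); rewrite mul1r {2}e.
apply/eqP; rewrite -absz_eq0; apply: contraT => k0.
have : 'X^`|pairing m v|%N - 1 = 0 :> {poly K}.
  apply: (@poly_vanish K _ 'X); first by rewrite polyX_eq0.
  move=> t; rewrite hornerX hornerD hornerN hornerXn hornerC => t0.
  case: (pairing m v) (e t t0) => N h; apply/eqP; rewrite subr_eq0; first exact/eqP.
  by rewrite -invr_eq1; apply/eqP.
move=> /eqP; rewrite subr_eq0 => /eqP /(congr1 (fun f : {poly K} => f.[0])).
by rewrite hornerXn hornerC expr0n (negPf k0) => /eqP; rewrite eq_sym oner_eq0.
Qed.

Lemma vertex_hom_eq p g h : monoid_hom (dm [set p]) g -> monoid_hom (dm [set p]) h ->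
  (forall i, g (- edge p i) = h (- edge p i)) -> g = h.
Proof.
move=> hg hh e; apply/funext => m; have [hm|hm] := pselect (dm [set p] m).
  by rewrite (hom_vertexE hg) // (hom_vertexE hh) //; apply: eq_bigr => i _; rewrite e.
by rewrite (hom_out hg) // (hom_out hh).
Qed.

Definition zero_hom p : 'rV[int]_n -> K := coord_hom X p (fun=> 0).
Definition origin p : toric_point R K n := class_of fan (vchart p (zero_hom p)).

Lemma zero_homP p : monoid_hom (dm [set p]) (zero_hom p).
Proof. exact: coord_homP. Qed.

Lemma zero_hom_edge p i : zero_hom p (- edge p i) = 0.
Proof. exact: (coord_hom_edge R). Qed.

Lemma zero_hom_neq0 p m : zero_hom p m != 0 -> m = 0.
Proof.
rewrite /zero_hom /coord_hom; case: ifPn => [/forallP h|]; last by rewrite eqxx.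
move=> /prodf_neq0 e; apply: (@co_eq0 _ _ X p) => i; have := e i isT.
by rewrite expr0n absz_eq0; case: (co p m i =P 0) => //; rewrite eqxx.
Qed.

Lemma mem_supp_origin p q : (q \in supp (origin p)) = (q == p).
Proof.
rewrite /origin mem_supp_vertex; last exact: zero_homP.
apply/idP/eqP => [/zero_hom_neq0/eqP|->]; last by rewrite subrr (hom0 (zero_homP p)) oner_eq0.
by rewrite subr_eq0 => /eqP/pt_inj ->.
Qed.

Lemma origin_fixed p : fixed_locus fan v (origin p).
Proof.
apply: class_fixed; first exact/vchartP/zero_homP.
move=> t t0; rewrite /act /vchart /=; congr (_, _); apply/funext => m.
have [->|/zero_hom_neq0->] := eqVneq (zero_hom p m) 0; first by rewrite mulr0.
by rewrite pairing0l expr0z mul1r.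
Qed.

Lemma fixed_origin x : generic X v -> fixed_locus fan v x -> exists p, x = origin p.
Proof.
move=> gv fx; have [p px] := supp_neq0 fx.1; have [g hg ex] := supp_chart fx.1 px.
exists p; rewrite ex; congr (class_of _ (vchart _ _)).
apply: (vertex_hom_eq hg (zero_homP p)) => i; rewrite zero_hom_edge.
apply/eqP; apply: contraT => gi; rewrite ex in fx.
by have /eqP := fixed_weight hg fx gi; rewrite pairingNl oppr_eq0 (negPf (gv p i)).
Qed.

(** If v is orthogonal to the i-th edge at p, the whole i-th coordinate axis of the chart at p is
    fixed, and it is infinite. Otherwise the fixed points are the origins of the vertex charts. *)
Lemma admissible_generic : admissible K fan v <-> generic X v.
Proof.
split=> [fin p i|gv]; last first.
  apply: (@sub_finite_set _ _ (origin @` [set: V])%classic).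
    by move=> x /(fixed_origin gv)[p ->]; exists p.
  exact/finite_image/finite_finset.
apply/eqP => e; pose y (a : K) j := if j == i then a else 0.
pose f a := class_of fan (vchart p (coord_hom X p (y a))).
have hc a : is_chart_point fan (vchart p (coord_hom X p (y a))).
  exact/vchartP/coord_homP.
have f_inj : injective f.
  move=> a b eab; have : f a (vchart p (coord_hom X p (y b))).
    by rewrite eab; apply: class_of_self.
  move=> /(class_of_inj (hc a) (hc b)) /(congr1 (fun g => g (- edge p i))).
  by rewrite !(coord_hom_edge R) /y eqxx.
apply: (@infinite_closed_field K); have := fin.
move=> /(finite_preimage (f := f) (fun _ _ _ _ => @f_inj _ _)).
apply: sub_finite_set => a _; apply: class_fixed => // t t0.
rewrite /act /vchart /=; congr (_, _); apply/funext => m.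
rewrite /coord_hom; case: ifP => _; last by rewrite mulr0.
have [hz|/existsPn hz] := boolP [exists j, (j != i) && (co p m j != 0)].
  have /existsP[j /andP[ji cj]] := hz.
  by rewrite (bigD1 j) //= /y (negPf ji) expr0n absz_eq0 (negPf cj) mul0r mulr0.
have -> : pairing m v = 0; last by rewrite expr0z mul1r.
rewrite (pairing_coE X p) (bigD1 i) //= e mulr0 add0r big1 // => j ji.
by have := hz j; rewrite ji negbK => /eqP ->; rewrite mul0r.
Qed.

Lemma supp_coord_down p g : monoid_hom (dm [set p]) g ->
  (forall i, g (- edge p i) != 0 -> down X v p i) ->
  forall q, q \in supp (class_of fan (vchart p g)) ->
    lower X v p q /\ (q != p -> pairing (pt q) v < pairing (pt p) v).
Proof.
move=> hg hd q; rewrite mem_supp_coord // => /forallP h.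
suff lq : lower X v p q by split=> //; apply: lower_lt.
apply/lowerP => i di; apply/eqP; apply: contraT => ci; have := h i; rewrite ci /=.
by move=> /hd; rewrite (negPf di).
Qed.

(** In the chart at p the action multiplies the coordinate at [- edge p i] by t to the power
    [- pairing (edge p i) v]. The limit is the origin exactly when every nonzero coordinate belongs
    to a decreasing edge, and a coordinate is nonzero exactly when [nb p i] is in the support. *)
Lemma cell_supp p x : bb_cell fan v (origin p) x <->
  [/\ toric x, p \in supp x &
    forall q, q \in supp x -> q != p -> pairing (pt q) v < pairing (pt p) v].
Proof.
split=> [[tx [s [g [h [xsg osh lim]]]]]|[tx px hx]].
  have [hch eo] := toric_class (class_toric ((vchartP R X p _).2 (zero_homP p))) osh.
  have [A [h' [/set0Pn[a aA] hh' [es eh]]]] := chart_vcone hch.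
  subst s h'.
  (* The vertices of the chart used for the limit belong to the support of [origin p], which is p
     alone; so it is the chart at p. *)
  have sup q : q \in A -> q = p.
    move=> qA; apply/eqP; rewrite -mem_supp_origin /origin eo (mem_supp (p := q) _ hh') //.
    by rewrite subrr (hom0 hh') oner_eq0.
  have eA : A = [set p]%SET.
    apply/setP => q; rewrite inE; apply/idP/eqP => [/sup //|->].
    by rewrite -(sup a aA).
  clear aA sup; subst A.
  have [/vchartP hg ex] := toric_class tx xsg.
  have hz : h = zero_hom p.
    by apply/esym; apply: (class_of_inj _ hch osh); apply/vchartP/zero_homP.
  have hd i : g (- edge p i) != 0 -> down X v p i.
    move=> gi; have [f [ft f0]] := lim _ (@dm_edge R n V X p i).
    rewrite /down ltNge; apply/negP => le.
    (* Were the edge not decreasing, f times this power of X would be constant, and the value 0 of f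
       at 0 would make the constant zero. *)
    have : f * 'X^`|pairing (edge p i) v|%N - (g (- edge p i))%:P = 0.
      apply: (@poly_vanish K _ 'X); first by rewrite polyX_eq0.
      move=> t; rewrite hornerX !hornerE => t0; rewrite ft // pairingNl mulrAC.
      rewrite exprnP abszE ger0_norm // -expfzDr // addNr expr0z mul1r subrr.
      by [].
    move=> /(congr1 (fun f : {poly K} => f.[0])); rewrite !hornerE f0 hz zero_hom_edge mul0r add0r.
    by move=> /eqP; rewrite oppr_eq0 (negPf gi).
  rewrite ex; split; first exact/class_toric/vchartP.
    by rewrite mem_supp_vertex // subrr (hom0 hg) oner_eq0.
  by move=> q /(supp_coord_down hg hd)[].
have [g hg ex] := supp_chart tx px; split=> //.
exists (vcone [set p]), g, (zero_hom p); split.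
- by rewrite ex; apply/class_of_self/vchartP.
- by apply/class_of_self/vchartP/zero_homP.
move=> m hm; exists ((g m)%:P * 'X^`|pairing m v|%N).
have hd i : g (- edge p i) != 0 -> down X v p i.
  by rewrite -(mem_supp_nb i hg) -ex => /hx /(_ (nb_neq _ _ _)); rewrite nb_lt.
have ge0 i : g m != 0 -> 0 <= co p m i * pairing (edge p i) v.
  rewrite (vertex_hom_neq0 hg hm) => /forallP/(_ i).
  have [->|_ /hd/ltW] := eqVneq (co p m i) 0; first by rewrite mul0r.
  by apply: mulr_le0; apply: (dm_vertex R X p m).1.
have mv : g m != 0 -> 0 <= pairing m v.
  by move=> gm; rewrite (pairing_coE X p); apply: sumr_ge0 => i _; apply: ge0.
split=> [t t0|].
  rewrite !hornerE; have [->|gm] := eqVneq (g m) 0; first by rewrite mul0r mulr0.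
  by rewrite exprnP abszE ger0_norm ?mv // mulrC.
rewrite !hornerE expr0n; have [m0|m0] := eqVneq m 0.
  by rewrite m0 pairing0l /= mulr1 (hom0 hg) (hom0 (zero_homP p)).
have -> : zero_hom p m = 0.
  by apply/eqP; apply: contraNT m0 => /zero_hom_neq0 ->.
have [->|gm] := eqVneq (g m) 0; first by rewrite mul0r.
case: eqP => [/eqP|]; last by rewrite mulr0.
rewrite absz_eq0 (pairing_coE X p) psumr_eq0 => [/allP h|i _]; last exact: ge0.
case/eqP: m0; apply: (@co_eq0 _ _ X p) => i; apply/eqP.
have := h i (mem_index_enum _); rewrite mulf_eq0 => /implyP/(_ isT) /orP[//|ev].
apply: contraT => ci; move: gm; rewrite (vertex_hom_neq0 hg hm) => /forallP/(_ i).
by rewrite ci /= => /hd; rewrite /down (eqP ev) ltxx.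
Qed.

Local Notation lower := (lower X v).

(** In a chart the locus is cut out by the characters [pt a - pt q] with q outside S, which vanish
    exactly where q is not in the support. *)
Lemma supp_closed (S : pred V) :
  zariski_closed fan [set x | toric x /\ forall q, q \in supp x -> S q]%classic.
Proof.
split=> [x []|s fs] //; have [A /set0Pn[a aA] es] := fan_vcone fs; subst s.
exists [set f | exists2 q, ~~ S q & f = [:: (1, pt a - pt q)]]%classic; split.
  by move=> f [q _ ->] b; rewrite inE => /eqP->; apply: dm_subr.
move=> g hg; have hc : is_chart_point fan (vcone A, g) by split.
have evalE q : laurent_eval [:: (1, pt a - pt q)] g = g (pt a - pt q).
  by rewrite /laurent_eval big_seq1 mul1r.
split=> [[_ h] f [q Sq ->]|h].
  rewrite evalE; apply/eqP; apply: contraNT Sq => gq.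
  by apply: h; rewrite (mem_supp (p := a) _ hg).
split=> [|q]; first exact: class_toric.
rewrite (mem_supp (p := a) _ hg) //; apply: contraNT => Sq.
by rewrite -evalE h //; exists q.
Qed.

Lemma cell_lower p x : bb_cell fan v (origin p) x ->
  forall q, q \in supp x -> lower p q.
Proof.
move=> /cell_supp[tx px hx] q; have [g hg ex] := supp_chart tx px; rewrite ex => hq.
apply: (supp_coord_down hg _ hq).1 => i; rewrite -(mem_supp_nb i hg) -ex.
by move=> /hx /(_ (nb_neq _ _ _)); rewrite nb_lt.
Qed.

(* In the chart of a vertex q of the lower face, a point x supported on that
   face is the limit at s = 0 of the curve that adds s to its coordinates along
   the face, whose other points but finitely many have full support. *)
Lemma lower_closure p x : toric x -> (forall q, q \in supp x -> lower p q) ->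
  zariski_closure fan (bb_cell fan v (origin p)) x.
Proof.
move=> tx sx; split=> // Z [_ Zclosed] cellZ.
have [q qx] := supp_neq0 tx; have [g hg ex] := supp_chart tx qx.
have lpq := sx q qx; rewrite ex.
have [I [Ireg hI]] := Zclosed _ (fan_vertex R X q); apply/(hI g hg) => f If.
pose J i := lower p (nb q i).
have gJ i : ~~ J i -> g (- edge q i) = 0.
  move=> nJ; apply/eqP; apply: contraT; rewrite -(mem_supp_nb i hg) -ex => /sx.
  by rewrite -/(J i) (negPf nJ).
pose y (s : K) i := g (- edge q i) + s *+ J i.
pose gs s := coord_hom X q (y s).
have gsP s : monoid_hom (dm [set q]) (gs s) by apply: coord_homP.
have gsE s i : gs s (- edge q i) = y s i by apply: (coord_hom_edge R).
have g0 : gs 0 = g.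
  by apply: (vertex_hom_eq (gsP 0) hg) => i; rewrite gsE /y mul0rn addr0.
pose z : {poly K} := \prod_(i | J i) ('X + (g (- edge q i))%:P).
pose U := face_normal X p (down X v p).
have Uq : pairing (pt q) U = pairing (pt p) U by apply/lower_face_normal.
have Umax r : pairing (pt r) U <= pairing (pt q) U.
  by rewrite Uq; apply: pairing_max_le => i; apply: edge_face_normal_le0.
have JU i : J i = (pairing (edge q i) U == 0).
  apply/idP/eqP => [/lower_face_normal|e].
    rewrite -Uq pt_nb pairingDl pairingZl => /eqP; rewrite -subr_eq0 addrAC subrr add0r.
    by rewrite mulf_eq0 gt_eqF ?len_gt0 //= => /eqP.
  by apply/lower_face_normal; rewrite pt_nb pairingDl pairingZl e mulr0 addr0 Uq.
have full s : z.[s] != 0 -> bb_cell fan v (origin p) (class_of fan (vchart q (gs s))).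
  rewrite /z horner_prod => /prodf_neq0 zs.
  have supE r : (r \in supp (class_of fan (vchart q (gs s)))) = lower p r.
    rewrite mem_supp_coord //; transitivity (pairing (pt r) U == pairing (pt q) U).
      apply/forallP/eqP => [h|/(pairing_max_eq r (fun i => edge_pairing_le0 i Umax)) h i].
        apply/pairing_max_eq => [i|i]; first exact: edge_pairing_le0.
        rewrite -JU => nJ; apply/eqP; apply: contraT => ci; have := h i.
        by rewrite ci gsE /y gJ // (negPf nJ) add0r eqxx.
      apply/implyP => ci; have Ji : J i.
        by rewrite JU; apply: contraT => /h e; rewrite e eqxx in ci.
      by have := zs i Ji; rewrite gsE /y Ji !hornerE addrC.
    by rewrite Uq; apply/eqP/idP => /lower_face_normal.
  apply/cell_supp; split; first exact/class_toric/vchartP.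
  - by rewrite supE lower_refl.
  - by move=> r; rewrite supE; apply: lower_lt.
have vanish s : z.[s] != 0 -> laurent_eval f (gs s) = 0.
  by move=> /full/cellZ/(hI _ (gsP s)); apply.
pose F : {poly K} := \sum_(a <- f) a.1 *: \prod_i (((g (- edge q i))%:P + 'X *+ J i) ^+ `|co q a.2 i|%N).
have FE s : F.[s] = laurent_eval f (gs s).
  rewrite /F /laurent_eval horner_sum !big_seq; apply: eq_bigr => a af.
  rewrite hornerZ horner_prod (hom_vertexE (gsP s)); last exact: Ireg af.
  congr (_ * _); apply: eq_bigr => i _; rewrite gsE /y.
  by rewrite horner_exp hornerD hornerC hornerMn hornerX.
have F0 : F = 0.
  apply: (@poly_vanish K _ z) => [|s /vanish]; last by rewrite FE.
  by apply/prodf_neq0 => i _; rewrite -size_poly_eq0 size_XaddC.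
by rewrite -g0 -FE F0 horner0.
Qed.

Lemma closure_supp p x : zariski_closure fan (bb_cell fan v (origin p)) x <->
  toric x /\ forall q, q \in supp x -> lower p q.
Proof.
split=> [[tx h]|[]]; last exact: lower_closure.
split=> //; have [] := h _ (supp_closed (lower p)); last by [].
by move=> y cy; split; [have [] := cy|apply: cell_lower].
Qed.

Hypothesis v_gen : generic X v.

Lemma cell_exists x : toric x -> exists2 q, q \in supp x & bb_cell fan v (origin q) x.
Proof.
move=> tx; have [p0 p0x] := supp_neq0 tx.
have [q qx qmax] := fin_argmax (fun q => pairing (pt q) v) p0x.
exists q => //; have [g hg ex] := supp_chart tx qx.
apply/cell_supp; split=> // r; rewrite {1}ex => rx.
apply: (supp_coord_down hg _ rx).2 => i; rewrite -(mem_supp_nb i hg) -ex => /qmax.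
by rewrite nb_le /down lt_neqAle v_gen.
Qed.

(** If the closure of the cell of p is a union of cells and contains [origin q], it contains the
    whole cell of q, since no other cell contains [origin q]. Conversely every point lies in the
    cell of the highest vertex of its support. *)
Lemma stratification_closed_lower : bb_stratification K fan v <-> closed_lower X v.
Proof.
split=> [strat p q r lpq lqr|cl x0 /(fixed_origin v_gen)[p ->]].
  have [I [If eI]] := strat _ (origin_fixed p).
  have : zariski_closure fan (bb_cell fan v (origin p)) (origin q).
    apply/closure_supp; split; first by have [] := origin_fixed q.
    by move=> q'; rewrite mem_supp_origin => /eqP->.
  rewrite eI => -[y Iy]; have [q' eq'] := fixed_origin v_gen (If _ Iy).
  rewrite eq' => /cell_supp[_]; rewrite mem_supp_origin => /eqP e _.
  rewrite eq' e in Iy.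
  (* A point of the cell of q with the largest possible support: coordinate 1 along the decreasing
     edges and 0 along the others. *)
  pose g := coord_hom X q (fun i => (down X v q i)%:R : K).
  have hg : monoid_hom (dm [set q]) g by apply: coord_homP.
  have gd i : (g (- edge q i) != 0) = down X v q i.
    by rewrite /g (coord_hom_edge R); case: down; rewrite ?oner_eq0 ?eqxx.
  have supE s : lower q s = (s \in supp (class_of fan (vchart q g))).
    rewrite mem_supp_coord //; apply: eq_forallb => i; rewrite gd.
    by case: down; case: eqP.
  have : zariski_closure fan (bb_cell fan v (origin p)) (class_of fan (vchart q g)).
    rewrite eI; exists (origin q) => //; apply/cell_supp.
    split; first exact/class_toric/vchartP.
    - by rewrite -supE lower_refl.
    - by move=> s; rewrite -supE; apply: lower_lt.
  by move=> /closure_supp[_]; apply; rewrite -supE.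
exists [set x | exists2 q, lower p q & x = origin q]%classic; split.
  by move=> x [q _ ->]; apply: origin_fixed.
apply/seteqP; split=> x.
  move=> /closure_supp[tx sx]; have [q qx cq] := cell_exists tx.
  by exists (origin q) => //; exists q => //; apply: sx.
move=> [_ [q lpq ->] cx]; apply/closure_supp; split; first by have [] := cx.
by move=> r /(cell_lower cx); apply: cl.
Qed.

End Cells.

(** * Polytopes whose faces are boxes *)

Section Boxes.
Variables (C FF : finType) (cl : FF -> C).
Implicit Types (A B : {set FF}) (c : C) (G : FF).

Definition is_box A := forall c, exists2 G, cl G = c & G \in A.

Definition in_box A (t : {ffun C -> FF}) := [forall c, t c \in A].

Lemma in_boxP A (t : {ffun C -> FF}) : reflect (forall c, t c \in A) (in_box A t).
Proof. exact: forallP. Qed.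

Lemma box_section A : is_box A -> exists f : {ffun C -> FF}, forall c, cl (f c) = c /\ f c \in A.
Proof.
move=> hA; have ex c : exists H, (cl H == c) && (H \in A).
  by have [H e HA] := hA c; exists H; rewrite e eqxx.
exists [ffun c => xchoose (ex c)] => c; rewrite ffunE.
by have /andP[/eqP] := xchooseP (ex c).
Qed.

Variables (R : realType) (n : nat).

Section Labelled.
Variables (T : finType) (x : T -> 'rV[R]_n) (lab : T -> {ffun C -> FF}).
Implicit Types (s t : T) (u : 'rV[R]_n).

(* The faces of the hull of the points x t correspond to the boxes, that is, to
   the products over all classes of nonempty sets of labels. *)
Definition box_labelling := [/\ forall t c, cl (lab t c) = c,
  forall f : {ffun C -> FF}, (forall c, cl (f c) = c) -> exists t, lab t = f,
  injective lab,
  forall A, is_box A -> exists u, forall t, argmax_at x u t <-> in_box A (lab t)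
& forall u, exists2 A, is_box A & forall t, argmax_at x u t <-> in_box A (lab t)].

Definition box_face A : set 'rV[R]_n := hull_on x [set t | in_box A (lab t)].

Hypothesis hlab : box_labelling.

Lemma box_transversal A c G : is_box A -> cl G = c -> G \in A ->
  exists2 t, lab t c = G & in_box A (lab t).
Proof.
move=> hA hG GA; have [_ onto _ _ _] := hlab.
have ex c' : exists H, [&& cl H == c', H \in A & (c' == c) ==> (H == G)].
  have [->|ne] := eqVneq c' c; first by exists G; rewrite hG GA !eqxx.
  by have [H e HA] := hA c'; exists H; rewrite e eqxx HA.
pose f := [ffun c' => xchoose (ex c')].
have fP c' : [&& cl (f c') == c', f c' \in A & (c' == c) ==> (f c' == G)].
  by rewrite ffunE; apply: (xchooseP (ex c')).
have [|t et] := onto f; first by move=> c'; have /and3P[/eqP] := fP c'.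
exists t; first by rewrite et; have /and3P[_ _] := fP c; rewrite eqxx => /eqP.
by apply/in_boxP => c'; rewrite et; have /and3P[] := fP c'.
Qed.

Lemma box_member A : is_box A -> exists t, in_box A (lab t).
Proof.
move=> hA; have [_ onto _ _ _] := hlab.
have [f hf] := box_section hA.
have [|t et] := onto f; first by move=> c; have [] := hf c.
by exists t; apply/in_boxP => c; rewrite et; have [] := hf c.
Qed.

Lemma box_face_eq A : is_box A -> exists u,
  box_face A = max_face (hull x) u /\
  forall t, argmax_at x u t <-> in_box A (lab t).
Proof.
move=> hA; have [_ _ _ H1 _] := hlab; have [u hu] := H1 A hA; exists u; split=> //.
have [t tA] := box_member hA; symmetry; apply: (@argmax_face _ _ _ _ u t); last by rewrite inE.
by move=> s; rewrite inE.
Qed.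

Lemma face_box F : is_face (hull x) F <-> F = set0 \/ exists2 A, is_box A & F = box_face A.
Proof.
split=> [[->|[u ->]]|[->|[A hA ->]]]; [by left|right| by left|right]; last first.
  by have [u [-> _]] := box_face_eq hA; exists u.
have [_ _ _ _ H2] := hlab; have [A hA hu] := H2 u; exists A => //.
have [t tA] := box_member hA; apply: (@argmax_face _ _ _ _ u t); last by rewrite inE.
by move=> s; rewrite inE.
Qed.

Lemma box_face_pt A t : is_box A -> box_face A (x t) <-> in_box A (lab t).
Proof.
move=> hA; have [u [-> <-]] := box_face_eq hA; split=> [[_ h] s|h].
  by apply: h; apply: hull_pt.
by split=> [|y]; [apply: hull_pt|apply: hull_max].
Qed.

Lemma box_face_neq0 A : is_box A -> box_face A <> set0.
Proof.
move=> hA e; have [t /(box_face_pt t hA)] := box_member hA.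
by rewrite e.
Qed.

Lemma box_face_sub A B : is_box A -> is_box B ->
  (box_face A `<=` box_face B)%classic <-> A \subset B.
Proof.
move=> hA hB; split=> [h|/fintype.subsetP h].
  apply/fintype.subsetP => G GA; have [t et tA] := box_transversal hA (erefl _) GA.
  have /h/(box_face_pt t hB)/in_boxP/(_ (cl G)) := (box_face_pt t hA).2 tA.
  by rewrite et.
move=> z [w [w0 wA w1 ->]]; exists w; split=> // t; rewrite inE => tB; apply: wA.
rewrite inE; apply: contra tB => /in_boxP tA; apply/in_boxP => c.
by apply/h/tA.
Qed.

Lemma box_face_inj A B : is_box A -> is_box B -> box_face A = box_face B -> A = B.
Proof.
move=> hA hB e; apply/eqP; rewrite finset.eqEsubset.
by apply/andP; split; [apply/(box_face_sub hA hB)|apply/(box_face_sub hB hA)]; rewrite e.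
Qed.

Definition pt_box t : {set FF} := [set lab t c | c : C].

Lemma pt_box_box t : is_box (pt_box t).
Proof.
have [clab _ _ _ _] := hlab => c; exists (lab t c) => //.
by apply/imsetP; exists c.
Qed.

Lemma in_pt_box s t : in_box (pt_box t) (lab s) <-> s = t.
Proof.
have [clab _ inj _ _] := hlab.
split=> [/in_boxP h|->]; last by apply/in_boxP => c; apply/imsetP; exists c.
apply: inj; apply/ffunP => c; have /imsetP[c' _ e] := h c.
by rewrite e; congr (lab t _); rewrite -(clab s c) e clab.
Qed.

Lemma box_face_singleton t : box_face (pt_box t) = [set x t]%classic.
Proof.
rewrite -hull_on1 /box_face; congr hull_on; apply/setP => s; rewrite !inE.
by apply/idP/eqP => /in_pt_box.
Qed.

End Labelled.
End Boxes.

(** Up to the empty face, both face lattices are that of the boxes ordered by inclusion. The map is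
    written as a set of points so that the empty face, which has no box, goes to the empty set. *)
Lemma box_same_type (R : realType) (n m : nat) (C FF T T' : finType) (cl : FF -> C)
    (x : T -> 'rV[R]_n) (y : T' -> 'rV[R]_m) lab lab' :
  box_labelling cl x lab -> box_labelling cl y lab' ->
  same_combinatorial_type (hull x) (hull y).
Proof.
move=> hx hy.
pose f (F : set 'rV[R]_n) := [set z | exists A, [/\ is_box cl A, F = box_face x lab A
  & box_face y lab' A z]]%classic.
have f0 : f set0 = set0.
  by apply/seteqP; split=> z // [A [hA e _]]; case: (box_face_neq0 hx hA).
have fA A : is_box cl A -> f (box_face x lab A) = box_face y lab' A.
  move=> hA; apply/seteqP; split=> z; last by exists A.
  by move=> [B [hB /(box_face_inj hx hA hB) ->]].
exists f; split.
- move=> F /(face_box hx)[->|[A hA ->]]; first by left; rewrite f0.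
  by apply/(face_box hy); right; exists A; rewrite ?fA.
- move=> F G /(face_box hx)[->|[A hA ->]] /(face_box hx)[->|[B hB ->]]; rewrite ?f0 ?fA //.
  + by split=> _; apply: classical_sets.sub0set.
  + by split=> _; apply: classical_sets.sub0set.
  + by rewrite !classical_sets.subset0; split=> h; [case: (box_face_neq0 hx hA)|case: (box_face_neq0 hy hA)].
  + by rewrite (box_face_sub hx) // (box_face_sub hy).
- move=> G /(face_box hy)[->|[A hA ->]]; first by exists set0 => //; left.
  by exists (box_face x lab A); rewrite ?fA //; apply/(face_box hx); right; exists A.
Qed.

(** The vertices are the minimal nonempty faces, so an isomorphism of face lattices matches them and
    labels can be pulled back. It preserves which vertices lie on which face, hence the faces
    correspond to the same boxes. *)
Lemma box_transfer (R : realType) (n m : nat) (C FF T T' : finType) (cl : FF -> C)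
    (x : T -> 'rV[R]_n) (y : T' -> 'rV[R]_m) lab' (f : set 'rV[R]_n -> set 'rV[R]_m) :
  (forall t, exists u, forall s, s != t -> pairing (x s) u < pairing (x t) u) ->
  box_labelling cl y lab' ->
  (forall F, is_face (hull x) F -> is_face (hull y) (f F)) ->
  (forall F G, is_face (hull x) F -> is_face (hull x) G -> (F `<=` G)%classic <-> (f F `<=` f G)%classic) ->
  (forall G, is_face (hull y) G -> exists2 F, is_face (hull x) F & f F = G) ->
  exists2 lab, box_labelling cl x lab &
    forall t, exists2 t', f [set x t]%classic = [set y t']%classic & lab t = lab' t'.
Proof.
move=> exposed hy fface fsub fonto.
have face0 : is_face (hull x) set0 by left.
have facex t : is_face (hull x) [set x t]%classic := exposed_vertex exposed t.
have facey t : is_face (hull y) [set y t]%classic.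
  apply/(face_box hy); right; exists (pt_box lab' t); first exact: (pt_box_box hy).
  by rewrite (box_face_singleton hy).
have x_inj : injective x.
  move=> s t e; apply/eqP; apply: contraT => st; have [u /(_ _ st)] := exposed t.
  by rewrite e ltxx.
have f0 : f set0 = set0.
  have [F hF e] := fonto set0 (or_introl erefl).
  have := (fsub set0 F face0 hF).1 (@classical_sets.sub0set _ F); rewrite e => h.
  by apply/seteqP; split=> // z /h.
have f_neq0 F : is_face (hull x) F -> f F = set0 -> F = set0.
  move=> hF e; have h : (F `<=` set0)%classic.
    by apply/(fsub _ _ hF face0); rewrite e; apply: classical_sets.sub0set.
  by apply/seteqP; split=> // z /h.
have f_inj F G : is_face (hull x) F -> is_face (hull x) G -> f F = f G -> F = G.
  by move=> hF hG e; apply/seteqP; split; [apply/(fsub _ _ hF hG)|apply/(fsub _ _ hG hF)]; rewrite e.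
have sub1 (U : Type) (z : U) (F : set U) : (F `<=` [set z])%classic -> F = set0 \/ F = [set z]%classic.
  move=> h; have [[w Fw]|nF] := pselect (F !=set0)%classic.
    right; apply/seteqP; split=> // _ ->; by rewrite -(h _ Fw).
  by left; apply/seteqP; split=> // w Fw; case: nF; exists w.
have pick_pt F : is_face (hull x) F -> F <> set0 -> exists t, F (x t).
  move=> [F0 /(_ F0) //|[u ->] nF]; have /set0P[z] : max_face (hull x) u != set0 by apply/eqP.
  by move=> /face_combination[w [w0 w1 _ hw]]; have [t /hw] := weight_pos w0 w1; exists t.
have image1 t : exists t', f [set x t]%classic = [set y t']%classic.
  have := fface _ (facex t) => /(face_box hy)[e|[A hA e]].
    have e' := f_neq0 _ (facex t) e.
    have : [set x t]%classic (x t) by []; by rewrite e'.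
  have [t' t'A] := box_member hy hA; exists t'.
  have [F hF eF] := fonto _ (facey t').
  have : (F `<=` [set x t])%classic.
    apply/(fsub _ _ hF (facex t)); rewrite eF e => _ ->.
    exact/(box_face_pt hy t' hA).
  move=> /(sub1 _ _ _)[F0|<- //]; exfalso.
  have : [set y t']%classic (y t') by [].
  by rewrite -eF F0 f0.
have [g hg] := choice image1.
have y_inj s t : [set y s]%classic = [set y t]%classic -> s = t.
  rewrite -!(box_face_singleton hy) => e; apply/(in_pt_box hy).
  by apply/(box_face_pt hy _ (pt_box_box hy t)); rewrite -e (box_face_singleton hy).
have g_inj : injective g.
  move=> s t e; apply: x_inj; have : [set x s]%classic = [set x t]%classic.
    by apply: f_inj => //; rewrite !hg e.
  by move=> e'; have : [set x s]%classic (x s) by []; rewrite e'.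
have g_onto t' : exists t, g t = t'.
  have [F hF eF] := fonto _ (facey t').
  have nF : F <> set0.
    by move=> F0; have : [set y t']%classic (y t') by []; rewrite -eF F0 f0.
  have [t Ft] := pick_pt F hF nF; exists t; apply: y_inj; rewrite -hg.
  have : (f [set x t] `<=` [set y t'])%classic.
    by rewrite -eF; apply/(fsub _ _ (facex t) hF) => _ ->.
  move=> /(sub1 _ _ _)[e|//]; exfalso; have e' := f_neq0 _ (facex t) e.
  by have : [set x t]%classic (x t) by []; rewrite e'.
have mem_face A F t : is_box cl A -> is_face (hull x) F -> f F = box_face y lab' A ->
    F (x t) <-> in_box A (lab' (g t)).
  move=> hA hF e; rewrite -(box_face_pt hy (g t) hA) -e.
  split=> h; first by apply: ((fsub _ _ (facex t) hF).1 _ (y (g t))) => [_ ->//|]; rewrite hg.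
  apply: ((fsub _ _ (facex t) hF).2 _ (x t)) => //; rewrite hg => _ ->.
  exact: h.
exists (lab' \o g); last by move=> t; exists (g t).
have [h1 h2 h3 _ _] := hy; split.
- by move=> t c; apply: h1.
- by move=> l /h2[t' <-]; have [t <-] := g_onto t'; exists t.
- exact: inj_comp.
- move=> A hA; have [F hF e] : exists2 F, is_face (hull x) F & f F = box_face y lab' A.
    by apply: fonto; apply/(face_box hy); right; exists A.
  have : F <> set0 by move=> F0; apply: (box_face_neq0 hy hA); rewrite -e F0 f0.
  case: (hF) => // -[u eF] _; exists u => t; rewrite argmaxE /max_face -eF.
  exact: (mem_face A F t).
move=> u; set F := max_face (hull x) u.
have hF : is_face (hull x) F by right; exists u.
case: ((face_box hy _).1 (fface _ hF)) => [/(f_neq0 _ hF) F0|[A hA e]]; last first.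
  by exists A => // t; rewrite argmaxE; apply: (mem_face A F t).
exfalso; have [t0 _] : exists t0 : T, True.
  have [A hA] : exists A, is_box cl A.
    have [_ _ _ _ H2] := hy; have [A hA _] := H2 0; by exists A.
  by have [t' _] := box_member hy hA; have [t _] := g_onto t'; exists t.
have [t1 _ t1max] := @fin_argmax _ _ _ predT (fun t => pairing (x t) u) t0 isT.
have : argmax_at x u t1 by move=> r; apply: t1max.
by rewrite argmaxE -/F F0.
Qed.

(** * Labellings and boxes of a smooth model *)

Section BoxModel.
Variables (R : realType) (n : nat) (V C FF : finType) (X : smooth_model n V).
Implicit Types (p q r : V) (i j k : 'I_n) (G H : FF) (c : C) (u : 'rV[R]_n).
Local Notation pt := (pt X).
Local Notation nb := (nb X).
Local Notation edge := (edge X).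
Local Notation co := (co X).
Local Notation nrm := (nrm X).
Local Notation rpt := (fun p => real_mx R (pt p)).

Lemma argmax_edge p u i : argmax_at rpt u p -> pairing (real_mx R (edge p i)) u <= 0.
Proof.
move=> /(_ (nb p i)); rewrite pt_nb real_mxD real_mxZ pairingDl pairingZl gerDl.
by rewrite pmulr_rle0 // ltr0z len_gt0.
Qed.

Lemma argmax_iff p q u : argmax_at rpt u p -> argmax_at rpt u q <->
  forall i, pairing (real_mx R (edge p i)) u != 0 -> co p (pt q - pt p) i = 0.
Proof.
move=> hp; rewrite -(cone_sum_eq0 X p q (fun i => argmax_edge i hp)).
rewrite -real_pairing_coE real_mxB pairingBl; split=> [hq|/eqP].
  by apply/eqP; rewrite subr_eq0 eq_le hp hq.
by rewrite subr_eq0 => /eqP e r; rewrite e.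
Qed.

Lemma argmax_nb p u i : argmax_at rpt u p ->
  argmax_at rpt u (nb p i) <-> pairing (real_mx R (edge p i)) u = 0.
Proof.
move=> hp; rewrite (argmax_iff _ hp); split=> [h|e k].
  apply/eqP; apply: contraT => /h; rewrite co_nb eqxx mulr1 => /eqP.
  by rewrite gt_eqF ?len_gt0.
by rewrite co_nb; have [->|_] := eqVneq k i; rewrite ?e ?eqxx ?mulr0.
Qed.

Lemma argmax_face_normal p (I : pred 'I_n) q :
  argmax_at rpt (real_mx R (face_normal X p I)) q <->
  forall i, ~~ I i -> co p (pt q - pt p) i = 0.
Proof.
rewrite -face_normal_eq.
have hp : argmax_at rpt (real_mx R (face_normal X p I)) p.
  by move=> r; rewrite !pairing_real ler_int; apply: pairing_max_le => i; apply: edge_face_normal_le0.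
split=> [hq|e r]; last by have := hp r; rewrite !pairing_real e.
apply/eqP; rewrite eq_le; have := hp q; have := hq p; rewrite !pairing_real !ler_int.
by move=> -> ->.
Qed.

(** The face of a box A consists of the vertices on all facets outside A; the edges that stay in it
    from such a vertex are those that leave a facet in A. Conversely a functional maximal at p
    excludes just the facets at p opposite to an edge on which it is nonzero. *)
Lemma labelling_box (L : labelling X C FF) (p0 : V) : box_labelling (cl L) rpt (miss L).
Proof.
split.
- exact: cl_miss.
- exact: miss_onto.
- exact: miss_inj.
- move=> A hA.
  have [f hf] := box_section hA.
  have [p ep] := miss_onto (fun c => (hf c).1).
  exists (real_mx R (face_normal X p (fun i => fac L p i \in A))) => q.
  rewrite argmax_face_normal; split=> [h|/in_boxP h i].
    apply/in_boxP => c; apply: contraT => qA.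
    have [i ei] : exists i, fac L p i = miss L q c.
      apply: fac_onto; rewrite cl_miss; apply: contraNneq qA => <-.
      by rewrite ep; have [] := hf c.
    have := h i; rewrite ei => /(_ qA)/eqP; rewrite (co_label L) ei cl_miss.
    by rewrite eqxx.
  move=> iA; apply/eqP; rewrite (co_label L).
  by apply: contraNneq iA => <-; apply: h.
move=> u; have [p _ pmax] := @fin_argmax _ _ _ predT (fun p => pairing (rpt p) u) p0 isT.
have hp : argmax_at rpt u p by move=> r; apply: pmax.
pose Z G := [exists i, (fac L p i == G) && (pairing (real_mx R (edge p i)) u != 0)].
have ZE i : Z (fac L p i) = (pairing (real_mx R (edge p i)) u != 0).
  apply/existsP/idP => [[j /andP[/eqP/(fac_inj (L := L)) ->]] //|h].
  by exists i; rewrite eqxx.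
exists [set G | ~~ Z G]%SET.
  move=> c; exists (miss L p c); first exact: cl_miss.
  rewrite inE; apply/existsPn => i; rewrite negb_and; apply/orP; left.
  by apply: contra (fac_in L p i) => /eqP ->; rewrite cl_miss eqxx.
move=> q; rewrite (argmax_iff _ hp); split=> [h|/in_boxP h i].
  apply/in_boxP => c; rewrite inE; have [e|ne] := eqVneq (miss L p c) (miss L q c).
    rewrite -e; apply/existsPn => i; rewrite negb_and; apply/orP; left.
    by apply: contra (fac_in L p i) => /eqP ->; rewrite cl_miss eqxx.
  have [i ei] : exists i, fac L p i = miss L q c by apply: fac_onto; rewrite cl_miss.
  rewrite -ei ZE; apply: contraT => /negPn/h/eqP; rewrite (co_label L) ei cl_miss.
  by rewrite eqxx.
rewrite -ZE => Zi; apply/eqP; rewrite (co_label L); apply: contraTneq Zi => e.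
by have := h (cl L (fac L p i)); rewrite e inE.
Qed.

Section Converse.
Variables (cls : FF -> C) (lab : V -> {ffun C -> FF}).
Hypothesis hlab : box_labelling cls rpt lab.

Let lab_cl p c : cls (lab p c) = c.
Proof. by have [] := hlab. Qed.

Let lab_onto (f : {ffun C -> FF}) : (forall c, cls (f c) = c) -> exists t, lab t = f.
Proof. by have [_ h _ _ _] := hlab; apply: h. Qed.

Let lab_inj : injective lab.
Proof. by have [] := hlab. Qed.

Let upd (f : {ffun C -> FF}) G : {ffun C -> FF} := [ffun c => if c == cls G then G else f c].

Let upd_onto p G : exists q, lab q = upd (lab p) G.
Proof.
by apply: lab_onto => c; rewrite ffunE; case: eqP => [->|].
Qed.

(** The edge is a box face with only two vertices. Changing one label of p to a different one of its
    neighbour stays in the box, so it already gives the neighbour. *)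
Let exchanged p i : exists G, lab p (cls G) != G /\ lab (nb p i) = upd (lab p) G.
Proof.
have [_ _ _ _ H2] := hlab.
have [A hA hu] := H2 (real_mx R (face_normal X p (pred1 i))).
have only q : in_box A (lab q) -> q = p \/ q = nb p i.
  by move=> /hu/argmax_face_normal/on_edge.
have /in_boxP pA : in_box A (lab p).
  by apply/hu/argmax_face_normal => k _; rewrite subrr co0.
have /in_boxP nA : in_box A (lab (nb p i)).
  by apply/hu/argmax_face_normal => k /= ki; rewrite co_nb (negPf ki) mulr0.
have [c hc] : exists c, lab (nb p i) c != lab p c.
  have [/existsP //|/existsPn h] := boolP [exists c, lab (nb p i) c != lab p c].
  have /eqP := nb_neq X p i; case; apply: lab_inj; apply/ffunP => c.
  by apply/eqP; rewrite -[_ == _]negbK h.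
exists (lab (nb p i) c); rewrite lab_cl eq_sym; split=> //.
have [s es] := upd_onto p (lab (nb p i) c).
have : in_box A (lab s).
  by apply/in_boxP => d; rewrite es ffunE; case: eqP.
move=> /only[] e; last by rewrite -es e.
move: hc; have := congr1 (fun f : {ffun C -> FF} => f c) es.
by rewrite e ffunE lab_cl eqxx => ->; rewrite eqxx.
Qed.

(** The labels other than G form a box whose face contains every edge at p except the i-th, so it is
    the facet opposite to that edge. *)
Let co_of_box (fac : V -> 'I_n -> FF)
    (facP : forall p i, lab p (cls (fac p i)) != fac p i /\ lab (nb p i) = upd (lab p) (fac p i)) :
  forall p i q, (co p (pt q - pt p) i == 0) = (lab q (cls (fac p i)) != fac p i).
Proof.
have [_ _ _ H1 _] := hlab => p i q; set G := fac p i.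
have [pG nbG] := facP p i; rewrite -/G in pG nbG.
have hA : is_box cls (~: [set G])%SET.
  move=> c; exists (lab p c); first exact: lab_cl.
  by rewrite !inE; apply: contra pG => /eqP <-; rewrite lab_cl.
have [u hu] := H1 _ hA.
have uE r : argmax_at rpt u r <-> lab r (cls G) != G.
  rewrite hu; split=> [/in_boxP/(_ (cls G))|h]; first by rewrite !inE.
  apply/in_boxP => c; rewrite !inE; apply: contra h => /eqP e.
  by rewrite -{1}e lab_cl e.
have up : argmax_at rpt u p by apply/uE.
have ui : pairing (real_mx R (edge p i)) u != 0.
  apply/eqP => /(argmax_nb i up)/uE.
  by rewrite nbG ffunE eqxx eqxx.
have uk k : k != i -> pairing (real_mx R (edge p k)) u = 0.
  move=> ki; apply/(argmax_nb k up)/uE; have [pk nk] := facP p k.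
  rewrite nk ffunE; have [ec|//] := eqVneq (cls G) (cls (fac p k)).
  apply: contra ki => /eqP eG; apply/eqP/(@nb_inj _ _ X p)/lab_inj.
  by rewrite nk nbG eG.
apply/eqP/idP => [h|/uE/(argmax_iff q up) h]; last exact: h.
apply/uE/(argmax_iff q up) => k hk; have [-> //|/uk e] := eqVneq k i.
by rewrite e eqxx in hk.
Qed.

Lemma box_labelling_labelling : exists L : labelling X C FF, cl L = cls /\ miss L = lab.
Proof.
have [fac' facP'] := choice (fun pi : V * 'I_n => exchanged pi.1 pi.2).
pose fac p i := fac' (p, i).
have facP p i : lab p (cls (fac p i)) != fac p i /\ lab (nb p i) = upd (lab p) (fac p i).
  exact: (facP' (p, i)).
have coE := co_of_box facP.
have fac_inj p : injective (fac p).
  move=> i j e; apply: (@nb_inj _ _ X p); apply: lab_inj.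
  by rewrite (facP p i).2 (facP p j).2 e.
have normal_eq p i q j : fac p i = fac q j -> nrm p i = nrm q j.
  move=> e; have [pG _] := facP p i; have [qG _] := facP q j.
  have co0 : co p (pt q - pt p) i = 0 by apply/eqP; rewrite coE e.
  have eqn : pairing (pt q) (nrm p i) = pairing (pt p) (nrm p i).
    by apply/eqP; rewrite -subr_eq0 -pairingBl pairing_nrm co0 oppr0.
  have [j' ej'] := facet_at eqn; rewrite ej'; congr (nrm q _).
  have : co p (pt (nb q j') - pt p) i != 0.
    rewrite -oppr_eq0 -pairing_nrm pairingBl -eqn -pairingBl ej' pairing_nrm oppr_eq0.
    by rewrite co_nb eqxx mulr1 gt_eqF ?len_gt0.
  rewrite coE negbK (facP q j').2 ffunE e; have [_|_] := eqVneq (cls (fac q j)) (cls (fac q j')).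
    by move=> /eqP/fac_inj.
  by rewrite (negPf qG).
pose normal G : 'rV[int]_n :=
  if [pick pi : V * 'I_n | fac pi.1 pi.2 == G] is Some pi then nrm pi.1 pi.2 else 0.
have normalE p i : normal (fac p i) = nrm p i.
  rewrite /normal; case: pickP => [[q j] /eqP /= e|/(_ (p, i))]; first exact: normal_eq.
  by rewrite eqxx.
have onto p G : lab p (cls G) != G -> exists i, fac p i = G.
  move=> pG; have [q eq_] := upd_onto p G.
  have pq : q != p by apply: contraNneq pG => <-; rewrite eq_ ffunE eqxx.
  have /existsP[i] : [exists i, co p (pt q - pt p) i != 0].
    apply: contraT => /existsPn h; case/eqP: pq; apply: (@co_pt_eq _ _ X) => i.
    by have := h i; rewrite negbK => /eqP.
  rewrite coE negbK eq_ ffunE; have [_ /eqP ->|_] := eqVneq (cls (fac p i)) (cls G).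
    by exists i.
  by rewrite (negPf (facP p i).1).
unshelve eexists (@Labelling n V X C FF cls lab fac normal lab_cl (@lab_onto) lab_inj
  (fun p i => (facP p i).1) onto normalE _ _ _); last by [].
- by move=> p i c; rewrite (facP p i).2 ffunE.
- move=> p q G pG qG; have [i ei] := onto p G pG; rewrite -ei normalE.
  rewrite lt_neqAle -subr_eq0 -subr_le0 -pairingBl pairing_nrm oppr_eq0 oppr_le0 cone_co andbT.
  by rewrite coE ei qG eqxx.
move=> G hG; rewrite /normal; case: pickP => // -[p i] /= /eqP e.
by have := (facP p i).1; rewrite e hG eqxx.
Qed.

End Converse.
End BoxModel.

(** * Products of simplices *)

Lemma pairing_mxrow (A : comPzRingType) (r : nat) (d : 'I_r -> nat)
    (x u : 'rV[A]_(\sum_(i < r) d i)) :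
  pairing x u = \sum_i pairing (submxrow x i) (submxrow u i).
Proof.
rewrite pairingE -{1}[x]submxrowK -{1}[u]submxrowK tr_mxrow mul_mxrow_mxcol summxE.
by apply: eq_bigr => i _; rewrite pairingE.
Qed.

Lemma affine_values (R : realType) (k n : nat) (A : 'M[R]_(k, n)) (f : 'I_k -> R) :
  affinely_independent A -> exists (u : 'rV[R]_n) (a : R),
    forall i, pairing (row i A) u = f i - a.
Proof.
move=> /row_freeP[B AB]; pose c : 'cV[R]_(1 + n) := B *m (\col_i f i).
exists (dsubmx c)^T, (usubmx c 0 0) => i.
have /(congr1 (fun M : 'cV[R]_k => M i 0)) : row_mx (const_mx 1) A *m c = \col_i f i.
  by rewrite mulmxA AB mul1mx.
rewrite -[c in LHS]vsubmxK mul_row_col [RHS]mxE mxE => <-.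
rewrite pairingE trmxK -row_mul mxE.
have -> : (const_mx 1 *m usubmx c : 'cV[R]_k) i 0 = usubmx c 0 0.
  by rewrite mxE big_ord1 mxE mul1r.
by rewrite addrC addrK.
Qed.

Lemma conv_rows_hull_on (R : realType) (k n : nat) (A : 'M[R]_(k, n)) (T : finType)
    (s : T -> 'rV[R]_n) (B : {set T}) (phi : 'I_k -> T) :
  injective phi -> (forall t, t \in B <-> exists a, phi a = t) ->
  (forall a, row a A = s (phi a)) -> conv_rows A = hull_on s B.
Proof.
move=> phi_inj hB hA.
have eB : B = (phi @: [set: 'I_k])%SET.
  apply/setP => t; apply/idP/imsetP => [/hB[a <-]|[a _ ->]]; first by exists a.
  by apply/hB; exists a.
have sumB (U : nmodType) (F : T -> U) : (forall t, t \notin B -> F t = 0) ->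
    \sum_t F t = \sum_a F (phi a).
  move=> F0; rewrite (bigID (mem B)) /= [X in _ + X]big1 ?addr0 // eB.
  rewrite big_imset /=; last by move=> a b _ _; apply: phi_inj.
  by apply: eq_bigl => a; rewrite inE.
apply/predeqP => z; split=> [[w [w0 w1 ->]]|[w [w0 wB w1 ->]]].
  pose w' t := if [pick a | phi a == t] is Some a then w 0 a else 0.
  have w'E a : w' (phi a) = w 0 a.
    rewrite /w'; case: pickP => [b /eqP/phi_inj-> //|/(_ a)].
    by rewrite eqxx.
  have w'B t : t \notin B -> w' t = 0.
    rewrite /w'; case: pickP => // b /eqP <- /negP[].
    by apply/hB; exists b.
  exists w'; split=> //.
  - by move=> t; rewrite /w'; case: pickP.
  - by rewrite sumB // -w1; apply: eq_bigr.
  rewrite sumB => [|t /w'B->]; last by rewrite scale0r.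
  by rewrite mulmx_sum_row; apply: eq_bigr => a _; rewrite w'E hA.
exists (\row_a w (phi a)); split.
- by move=> a; rewrite mxE.
- by rewrite -w1 sumB //; apply: eq_bigr => a _; rewrite mxE.
rewrite sumB => [|t /wB->]; last by rewrite scale0r.
by rewrite mulmx_sum_row; apply: eq_bigr => a _; rewrite mxE hA.
Qed.

Lemma submxrowZ (A : pzRingType) (r m : nat) (d : 'I_r -> nat) (a : A)
    (x : 'M[A]_(m, \sum_(i < r) d i)) i : submxrow (a *: x) i = a *: submxrow x i.
Proof. by apply/matrixP => k l; rewrite !mxE. Qed.

Section Product.
Variables (R : realType) (r : nat) (d : 'I_r -> nat) (FF : finType) (cl : FF -> 'I_r).
Variable sv : forall i, FF -> 'rV[R]_(d i).
Implicit Types (i j : 'I_r) (G H : FF).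

Definition simplex_labels := forall i,
  exists k (A : 'M[R]_(k.+1, d i)) (phi : 'I_k.+1 -> FF),
  [/\ affinely_independent A, injective phi,
      forall G, cl G = i <-> exists a, phi a = G & forall a, row a A = sv i (phi a)].

Hypothesis hsv : simplex_labels.

Definition fibre i := [set G | cl G == i]%SET.

Definition simplex_product : set 'rV[R]_(\sum_(i < r) d i) :=
  [set x : 'rV[R]_(\sum_(i < r) d i) | forall i, hull_on (sv i) (fibre i) (submxrow x i)]%classic.

Definition transversal := {t : {ffun 'I_r -> FF} | [forall i, cl (t i) == i]}.

Definition product_pt (t : transversal) : 'rV[R]_(\sum_(i < r) d i) :=
  \mxrow_i sv i (val t i).

Lemma product_ptK t i : submxrow (product_pt t) i = sv i (val t i).
Proof. exact: mxrowK. Qed.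

Lemma transversal_cl (t : transversal) i : cl (val t i) = i.
Proof. by have /forallP/(_ i)/eqP := valP t. Qed.

Lemma simplex_product_is_product : is_product_of_simplices simplex_product.
Proof.
exists (fun i => hull_on (sv i) (fibre i)); split=> // i.
have [k [A [phi [hA phi_inj hphi eA]]]] := hsv i; exists k, A; split=> //.
apply/esym/(conv_rows_hull_on phi_inj) => // t.
by rewrite inE -hphi; split=> [/eqP|->].
Qed.

Lemma label_values i (f : FF -> R) : exists (u : 'rV[R]_(d i)) (a : R),
  forall G, cl G = i -> pairing (sv i G) u = f G - a.
Proof.
have [k [A [phi [hA phi_inj hphi eA]]]] := hsv i.
have [u [a h]] := affine_values (f \o phi) hA; exists u, a => G /hphi[b <-].
by rewrite -eA h.
Qed.

Lemma label_exists i : exists G, cl G = i.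
Proof.
have [k [A [phi [_ _ hphi _]]]] := hsv i; exists (phi ord0).
by apply/hphi; exists ord0.
Qed.

(** The products of weights form a product distribution with i-th marginal [W i]. Weights vanish
    outside their class, so that the sum may run over all functions instead of the transversals. *)
Lemma product_weights (W : 'I_r -> FF -> R) :
  (forall i G, cl G != i -> W i G = 0) -> (forall i, \sum_G W i G = 1) ->
  forall i (f : FF -> R),
  \sum_(t : transversal) (\prod_j W j (val t j)) * f (val t i) = \sum_G W i G * f G.
Proof.
move=> W0 W1 i f.
rewrite -(big_sub_cond (fun t : {ffun 'I_r -> FF} => [forall i, cl (t i) == i]) predT
  (fun t : {ffun 'I_r -> FF} => \prod_j W j (t j) * f (t i))).
rewrite big_mkcond /=.
transitivity (\sum_(t : {ffun 'I_r -> FF})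
    \prod_j (W j (t j) * (if j == i then f (t j) else 1))).
  apply: eq_bigr => t _; rewrite big_split /= [X in _ = _ * X](bigD1 i) //= eqxx.
  rewrite [X in _ * (_ * X)]big1 ?mulr1 => [|j /negPf-> //].
  rewrite unfold_in; case: ifPn => //; rewrite andbT => /forallPn[j hj].
  by rewrite (bigD1 j) //= W0 // !mul0r.
rewrite -(bigA_distr_bigA (fun j G => W j G * (if j == i then f G else 1))).
rewrite (bigD1 i) //= eqxx [X in _ * X]big1 ?mulr1 // => j /negPf ji.
by rewrite -[RHS](W1 j); apply: eq_bigr => G _; rewrite ji mulr1.
Qed.

Lemma product_hull : simplex_product = hull product_pt.
Proof.
apply/predeqP => x; split=> [hx|/hullP[w [w0 w1 ->]] i].
  have [W hW] := choice hx; pose w (t : transversal) := \prod_j W j (val t j).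
  have W0 i G : cl G != i -> W i G = 0.
    by move=> ne; have [_ h _ _] := hW i; apply: h; rewrite inE.
  have W1 i : \sum_G W i G = 1 by have [] := hW i.
  apply/hullP; exists w; split.
  - by move=> t; apply: prodr_ge0 => j _; have [] := hW j.
  - have [/existsP[i _]|/existsPn h] := boolP [exists i : 'I_r, true].
      rewrite -(W1 i); have := product_weights W0 W1 i (fun=> 1).
      by under eq_bigr do rewrite mulr1; under [RHS]eq_bigr do rewrite mulr1.
    (* With no factors the product is a point, given by the empty transversal. *)
    have none (i : 'I_r) : False by have := h i.
    pose t0 : {ffun 'I_r -> FF} := [ffun i => False_rect FF (none i)].
    have t0P : [forall i, cl (t0 i) == i].
      by apply/forallP => i; case: (none i).
    rewrite (bigD1 (exist _ t0 t0P : transversal)) //= big1 => [|t /eqP[]].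
      by rewrite addr0 /w big1 // => i; case: (none i).
    by apply: val_inj; apply/ffunP => i; case: (none i).
  apply/mxrowP => i; have [_ _ _ ->] := hW i.
  apply/rowP => a; rewrite submxrow_sum !summxE.
  under eq_bigr => G _ do rewrite mxE.
  rewrite -(product_weights W0 W1 i (fun G => sv i G 0 a)); apply: eq_bigr => t _.
  by rewrite /w submxrowZ product_ptK [RHS]mxE.
pose W G := \sum_(t : transversal | val t i == G) w t.
exists W; split.
- by move=> G; apply: sumr_ge0.
- move=> G; rewrite inE => GnI; rewrite /W big1 // => t /eqP e.
  by rewrite -e transversal_cl eqxx in GnI.
- rewrite -w1 (partition_big (fun t : transversal => val t i) predT) //=.
rewrite submxrow_sum (partition_big (fun t : transversal => val t i) predT) //=.
apply: eq_bigr => G _; rewrite /W scaler_suml; apply: eq_bigr => t /eqP <-.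
by rewrite submxrowZ product_ptK.
Qed.

Lemma pairing_product_pt t u :
  pairing (product_pt t) u = \sum_i pairing (sv i (val t i)) (submxrow u i).
Proof. by rewrite pairing_mxrow; apply: eq_bigr => i _; rewrite product_ptK. Qed.

(** By affine independence a functional can take prescribed values on the labels of each class up to
    an additive constant; the indicator of A thus exposes the box A. Conversely a maximum over the
    product is attained factor by factor. *)
Lemma product_box : box_labelling cl product_pt val.
Proof.
have onto (f : {ffun 'I_r -> FF}) : (forall c, cl (f c) = c) -> exists t : transversal, val t = f.
  move=> hf; have h : [forall i, cl (f i) == i] by apply/forallP => i; apply/eqP.
  by exists (exist _ f h).
split; [exact: transversal_cl|exact: onto|exact: val_inj| |].
- move=> A hA; pose val_A i := label_values i (fun G => (G \in A)%:R).
  pose u i := projT1 (cid (val_A i)); have [a ha] := choice (fun i => projT2 (cid (val_A i))).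
  exists (\mxrow_i u i) => t.
  have pE s : pairing (product_pt s) (\mxrow_i u i) = \sum_i ((val s i \in A)%:R - a i).
    rewrite pairing_product_pt; apply: eq_bigr => i _.
    by rewrite mxrowK ha // transversal_cl.
  have [f hf] := box_section hA.
  have [s es] := onto f (fun c => (hf c).1).
  split=> [/(_ s)|/in_boxP h t']; rewrite !pE; last first.
    by apply: ler_sum => i _; rewrite lerD2r h; case: (_ \in A); rewrite ?ler01.
  rewrite !sumrB lerD2r => le; apply/in_boxP => i; apply: contraT => ti.
  suff : \sum_i (val t i \in A)%:R < \sum_i (val s i \in A)%:R :> R by rewrite ltNge le.
  rewrite (bigD1 i) //= [ltRHS](bigD1 i) //= (negPf ti) es (hf i).2 ltr_leD ?ltr01 //.
  by apply: ler_sum => j _; rewrite (hf j).2; case: (_ \in A); rewrite ?ler01.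
move=> u; pose val_ G := pairing (sv (cl G) G) (submxrow u (cl G)).
pose A := [set G | [forall H, (cl H == cl G) ==> (val_ H <= val_ G)]]%SET.
have pE s : pairing (product_pt s) u = \sum_i val_ (val s i).
  by rewrite pairing_product_pt; apply: eq_bigr => i _; rewrite /val_ transversal_cl.
have hA : is_box cl A.
  move=> i; have [G0 /eqP eG0] := label_exists i.
  have [G /eqP Gi Gmax] := @fin_argmax _ _ _ (fun G => cl G == i) val_ _ eG0.
  by exists G => //; rewrite inE; apply/forallP => H; rewrite Gi; apply/implyP/Gmax.
exists A => // t; split=> [h|/in_boxP h s]; last first.
  rewrite !pE; apply: ler_sum => i _; have := h i; rewrite inE => /forallP/(_ (val s i)).
  by rewrite !transversal_cl eqxx.
apply/in_boxP => i; rewrite inE; apply/forallP => H; rewrite transversal_cl.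
apply/implyP => /eqP eH; pose f : {ffun 'I_r -> FF} := [ffun j => if j == i then H else val t j].
have [|s es] := onto f.
  by move=> j; rewrite ffunE; case: eqP => [->|_]; rewrite ?transversal_cl.
have := h s; rewrite !pE (bigD1 i) //= [leRHS](bigD1 i) //= es ffunE eqxx.
rewrite [X in _ + X <= _](eq_bigr (fun j => val_ (val t j))) ?lerD2r //.
by move=> j /negPf ji; rewrite ffunE ji.
Qed.

End Product.

Lemma product_labels (R : realType) (r : nat) (d : 'I_r -> nat)
    (Q : set 'rV[R]_(\sum_(i < r) d i)) : is_product_of_simplices Q ->
  exists (FF : finType) (cl : FF -> 'I_r) (sv : forall i, FF -> 'rV[R]_(d i)),
    simplex_labels cl sv /\ Q = simplex_product cl sv.
Proof.
move=> [S [hS eQ]].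
pose k i := projT1 (cid (hS i)).
pose A i : 'M[R]_((k i).+1, d i) := projT1 (cid (projT2 (cid (hS i)))).
have hA i : affinely_independent (A i) /\ S i = conv_rows (A i).
  exact: (projT2 (cid (projT2 (cid (hS i))))).
pose FF := {i : 'I_r & 'I_(k i).+1}.
pose cl (G : FF) := tag G.
pose sv i (G : FF) : 'rV[R]_(d i) := untag 0 (fun b => row b (A i)) G.
pose phi i (a : 'I_(k i).+1) : FF := Tagged (fun i => 'I_(k i).+1) a.
have phi_inj i : injective (phi i).
  by move=> a b; apply: (@eq_from_Tagged _ (fun i => 'I_(k i).+1) i a b).
have phi_onto i G : cl G = i <-> exists a, phi i a = G.
  by split=> [<-|[a <-] //]; exists (tagged G); case: (G).
have phi_row i a : row a (A i) = sv i (phi i a).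
  by rewrite /sv (untagE _ _ (erefl i : tag (Tagged _ a) = i)).
exists FF, cl, sv; split=> [i|]; first by exists (k i), (A i), (phi i); have [] := hA i.
have eS i : S i = hull_on (sv i) (fibre cl i).
  rewrite (hA i).2; apply: (conv_rows_hull_on (phi_inj i) _ (phi_row i)) => G.
  by rewrite inE -phi_onto; split=> /eqP.
by rewrite eQ; apply/predeqP => x; split=> hx i; have := hx i; rewrite eS.
Qed.

Definition reindex_labelling (n : nat) (V C FF : finType) (X : smooth_model n V)
  (L : labelling X C FF) : labelling X 'I_#|C| FF.
Proof.
apply: (@Labelling _ _ _ _ _ (fun G => enum_rank (cl L G))
  (fun p => [ffun i => miss L p (enum_val i)]) (fac L) (normal L)).
- by move=> p i; rewrite ffunE cl_miss enum_valK.
- move=> t ht; have [|p ep] := @miss_onto _ _ _ _ _ L [ffun c => t (enum_rank c)].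
    by move=> c; rewrite ffunE; apply: enum_rank_inj.
  by exists p; apply/ffunP => i; rewrite ffunE ep ffunE enum_valK.
- move=> p q e; apply: (@miss_inj _ _ _ _ _ L); apply/ffunP => c.
  by have := congr1 (fun f : {ffun _ -> _} => f (enum_rank c)) e; rewrite !ffunE enum_rankK.
- by move=> p i; rewrite ffunE enum_rankK fac_in.
- by move=> p G; rewrite ffunE enum_rankK; apply: fac_onto.
- exact: normal_fac.
- move=> p i c; rewrite !ffunE miss_nb; congr (if _ then _ else _).
  by rewrite -(inj_eq enum_rank_inj) enum_valK.
- by move=> p q G; rewrite !ffunE enum_rankK; apply: normal_lt.
- by move=> G hG; apply: (normal_eq0 (l := L)) => p; have := hG p; rewrite ffunE enum_rankK.
Defined.

(** * Unimodular coordinates from a labelling *)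

Section StandardProduct.
Variables (R : realType) (n r : nat) (V FF : finType) (X : smooth_model n V).
Variables (L : labelling X 'I_r FF) (p0 : V) (l : 'I_r -> R).
Hypothesis l_gt0 : forall i, 0 < l i.
Local Notation cl := (cl L).
Local Notation miss := (miss L).
Local Notation fac := (fac L).

Definition local_facets i := [set G | (cl G == i) && (G != miss p0 i)]%SET.
Definition local_dim i := #|local_facets i|.
Definition local_facet i (j : 'I_(local_dim i)) : FF := enum_val j.

(* The vertices of a simplex of size [l i], of which [miss p0 i] is the origin. *)
Definition standard_vertex i (G : FF) : 'rV[R]_(local_dim i) :=
  \row_j (l i *+ (local_facet j == G)).

Lemma local_facetP i (j : 'I_(local_dim i)) :
  cl (local_facet j) = i /\ local_facet j != miss p0 i.
Proof.
by have := enum_valP j; rewrite -/(local_facet j) inE => /andP[/eqP].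
Qed.

Lemma standard_simplex_labels : simplex_labels cl standard_vertex.
Proof.
move=> i; pose phi (a : 'I_(local_dim i).+1) : FF :=
  if unlift ord0 a is Some j then local_facet j else miss p0 i.
have phi0 : phi ord0 = miss p0 i by rewrite /phi unlift_none.
have phiS j : phi (lift ord0 j) = local_facet j by rewrite /phi liftK.
exists (local_dim i), (\matrix_(a, j) standard_vertex i (phi a) 0 j), phi; split.
- rewrite /affinely_independent -kermx_eq0; apply/rowV0P => w /sub_kermxP.
  rewrite mul_mx_row => h.
  have ws j : w 0 (lift ord0 j) = 0.
    have := congr1 (fun M : 'rV_(1 + local_dim i) => M 0 (rshift 1 j)) h.
    rewrite row_mxEr mxE big_ord_recl !mxE phi0.
    rewrite (negPf (local_facetP j).2) mulr0n mulr0 add0r (bigD1 j) //= big1 => [|k kj].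
      rewrite addr0 !mxE phiS eqxx mulr1n => /eqP.
      by rewrite mulf_eq0 (gt_eqF (l_gt0 i)) orbF => /eqP.
    by rewrite !mxE phiS (inj_eq enum_val_inj) eq_sym (negPf kj) mulr0n mulr0.
  apply/rowP => a; rewrite mxE; case: (unliftP ord0 a) => [j ->|->]; first exact: ws.
  have := congr1 (fun M : 'rV_(1 + local_dim i) => M 0 (lshift _ 0)) h.
  rewrite row_mxEl mxE big_ord_recl mxE mulr1 big1 ?addr0; first by rewrite mxE.
  by move=> j _; rewrite ws mul0r.
- move=> a b; case: (unliftP ord0 a) => [j ->|->]; case: (unliftP ord0 b) => [k ->|->];
    rewrite ?phi0 ?phiS //.
  + by move=> /enum_val_inj ->.
  + by move=> e; have [_] := local_facetP j; rewrite e eqxx.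
  + by move=> e; have [_] := local_facetP k; rewrite -e eqxx.
- move=> G; split=> [hG|[a <-]]; last first.
    case: (unliftP ord0 a) => [j ->|->]; rewrite ?phi0 ?phiS ?cl_miss //.
    by have [] := local_facetP j.
  have [->|ne] := eqVneq G (miss p0 i); first by exists ord0.
  have GB : G \in local_facets i by rewrite inE hG eqxx.
  by exists (lift ord0 (enum_rank_in GB G)); rewrite phiS /local_facet enum_rankK_in.
- by move=> a; apply/rowP => j; rewrite !mxE.
Qed.

Lemma sum_local_facets (U : nmodType) (F : FF -> U) :
  \sum_(k < n) F (fac p0 k) = \sum_i \sum_(j < local_dim i) F (local_facet j).
Proof.
transitivity (\sum_i \sum_(G in local_facets i) F G); last first.
  by apply: eq_bigr => i _; rewrite big_enum_val.
transitivity (\sum_(G | miss p0 (cl G) != G) F G).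
  transitivity (\sum_(G in (fac p0 @: [set: 'I_n])%SET) F G).
    rewrite big_imset /=; last by move=> j k _ _; apply: fac_inj.
    by apply: eq_bigl => k; rewrite inE.
  apply: eq_bigl => G; apply/imsetP/idP => [[k _ ->]|/fac_onto[k <-]]; first exact: fac_in.
  by exists k.
rewrite (partition_big cl predT) //=; apply: eq_bigr => i _; apply: eq_bigl => G.
by rewrite inE andbC; case: eqP => [->|]; rewrite // eq_sym.
Qed.

End StandardProduct.

Lemma hull_image (R : realType) (n m : nat) (T : finType) (x : T -> 'rV[R]_n)
    (M : 'M[R]_(n, m)) (b : 'rV[R]_m) :
  [set z *m M + b | z in hull x]%classic = hull (fun t => x t *m M + b).
Proof.
have aff (w : T -> R) : \sum_t w t = 1 ->
    (\sum_t w t *: x t) *m M + b = \sum_t w t *: (x t *m M + b).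
  move=> w1; rewrite (eq_bigr _ (fun t _ => scalerDr _ _ _)) big_split /= -scaler_suml w1.
  rewrite scale1r mulmx_suml; congr (_ + _).
  by apply: eq_bigr => t _; rewrite scalemxAl.
apply/predeqP => y; split=> [[z /hullP[w [w0 w1 ->]] <-]|/hullP[w [w0 w1 ->]]].
  by apply/hullP; exists w; rewrite aff.
by exists (\sum_t w t *: x t); [apply/hullP; exists w|rewrite aff].
Qed.

Lemma hull_bij (R : realType) (n : nat) (T T' : finType) (x : T' -> 'rV[R]_n) (g : T -> T') :
  bijective g -> hull (x \o g) = hull x.
Proof.
move=> [h hK gK]; apply/predeqP => y; rewrite !hullP.
split=> [[w [w0 w1 ->]]|[w [w0 w1 ->]]].
  exists (fun t => w (h t)); split=> //; first by rewrite -w1 (reindex g) /=;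
    [apply: eq_bigr => t _; rewrite hK|exists h => t _; rewrite ?hK ?gK].
  rewrite [RHS](reindex g) /=; last by exists h => t _; rewrite ?hK ?gK.
  by apply: eq_bigr => t _; rewrite hK.
exists (fun t => w (g t)); split=> //.
  by rewrite -w1 [RHS](reindex g) //=; exists h => t _; rewrite ?hK ?gK.
by rewrite (reindex g) //=; exists h => t _; rewrite ?hK ?gK.
Qed.

Lemma mulmx1C_eq (S : comNzRingType) (n m : nat) (A : 'M[S]_(n, m)) (B : 'M[S]_(m, n)) :
  n = m -> A *m B = 1%:M -> B *m A = 1%:M.
Proof. by move=> e; case: m / e A B => A B; apply: mulmx1C. Qed.

Section ToUnimodular.
Variables (R : realType) (n r : nat) (V FF : finType) (X : smooth_model n V).
Variables (L : labelling X 'I_r FF) (p0 : V).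
Hypothesis all_closed : forall v, generic X v -> closed_lower X v.
Local Notation cl := (cl L).
Local Notation miss := (miss L).
Local Notation fac := (fac L).
Local Notation normal := (normal L).
Local Notation pt := (pt X).
Local Notation edge := (edge X).
Local Notation height := (height L).
Local Notation local_facet := (@local_facet n r V FF X L p0).
Local Notation local_dim := (local_dim L p0).

Let size i : int := \sum_(G | cl G == i) height G.

(** The default 1 concerns only factors that are points, which have no coordinates. *)
Let scale i : R := if 0 < size i then (size i)%:~R else 1.

Let scale_gt0 i : 0 < scale i.
Proof. by rewrite /scale; case: ifP; rewrite ?ltr01 // ltr0z. Qed.

(** The normals of a class sum to zero, so the distances of p from its facets add up to [size i] for
    every p, and only the missed facet contributes. *)
Let height_gap p i G : cl G = i ->
  height G - pairing (pt p) (normal G) = size i *+ (G == miss p i).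
Proof.
move=> hG; have gap0 H : cl H == i -> H != miss p i ->
    height H - pairing (pt p) (normal H) = 0.
  move=> /eqP hH ne; rewrite pairing_height ?subrr // hH eq_sym.
  exact: ne.
have [->|ne] := eqVneq G (miss p i); last by rewrite gap0 ?hG ?mulr0n.
have : \sum_(H | cl H == i) (height H - pairing (pt p) (normal H)) = size i.
  by rewrite sumrB -pairing_sumr -/(class_sum L i) (class_sum_eq0 L all_closed p0) pairing0r subr0.
rewrite (bigD1 (miss p i)) ?cl_miss //= big1 ?addr0 // => H /andP[].
exact: gap0.
Qed.

Let size_gt0 i (j : 'I_(local_dim i)) : 0 < size i.
Proof.
have [hcl ne] := local_facetP j.
have [k ek] : exists k, fac p0 k = local_facet j by apply: fac_onto; rewrite hcl eq_sym.
have := height_gap p0 (cl_miss L p0 i); rewrite eqxx mulr1n => <-; rewrite subr_gt0.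
apply: (@pairing_lt_height _ _ _ _ _ _ _ (nb X p0 k)); rewrite cl_miss //.
by rewrite miss_nb ek hcl eqxx.
Qed.

(** The new coordinates are the distances from the facets at [p0], grouped by class: A holds the
    negated normals and b the heights. The rows of B are the edges at [p0], dual to the negated
    normals. *)
Let A : 'M[int]_(n, \sum_(i < r) local_dim i) :=
  \mxrow_i (\matrix_(a < n, j < local_dim i) - normal (local_facet j) 0 a).

Let edge_of G : 'rV[int]_n := \sum_(k | fac p0 k == G) edge p0 k.

Let edge_of_fac k : edge_of (fac p0 k) = edge p0 k.
Proof.
by rewrite /edge_of (big_pred1 k) // => j; rewrite (inj_eq (@fac_inj _ _ _ _ _ L p0)).
Qed.

Let B : 'M[int]_(\sum_(i < r) local_dim i, n) :=
  \mxcol_i (\matrix_(j < local_dim i, a < n) edge_of (local_facet j) 0 a).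

Let b : 'rV[int]_(\sum_(i < r) local_dim i) :=
  \mxrow_i (\row_(j < local_dim i) height (local_facet j)).

Let AB : A *m B = 1%:M.
Proof.
rewrite /A /B mul_mxrow_mxcol; apply/matrixP => a c; rewrite summxE.
transitivity (\sum_i \sum_(j < local_dim i)
    - normal (local_facet j) 0 a * edge_of (local_facet j) 0 c).
  by apply: eq_bigr => i _; rewrite mxE; apply: eq_bigr => j _; rewrite !mxE.
rewrite -(sum_local_facets L p0 (fun G => - normal G 0 a * edge_of G 0 c)).
rewrite -[RHS](congr1 (fun M : 'M_n => M a c) (mulVmx (ebas_unit X p0))) mxE.
by apply: eq_bigr => k _; rewrite edge_of_fac normal_fac nrmE edgeE opprK.
Qed.

Let dim_eq : n = (\sum_(i < r) local_dim i)%N.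
Proof.
have := sum_local_facets L p0 (fun=> 1%N); rewrite sum1_card card_ord => {1}->.
by apply: eq_bigr => i _; rewrite sum1_card card_ord.
Qed.

Let chart_pt p : real_mx R (pt p) *m real_mx R A + real_mx R b =
  \mxrow_i standard_vertex L p0 scale i (miss p i).
Proof.
apply/mxrowP => i; rewrite mxrowK; apply/rowP => j.
have AE a : A a (tagnat.Rank i j) = - normal (local_facet j) 0 a.
  have <- : submxrow A i a j = - normal (local_facet j) 0 a by rewrite /A mxrowK mxE.
  by rewrite [RHS]mxE.
have bE : b 0 (tagnat.Rank i j) = height (local_facet j).
  have <- : submxrow b i 0 j = height (local_facet j) by rewrite /b mxrowK mxE.
  by rewrite [RHS]mxE.
transitivity ((height (local_facet j) - pairing (pt p) (normal (local_facet j)))%:~R : R).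
  rewrite /real_mx [LHS]mxE [LHS]mxE [X in X + _]mxE [X in _ + X]mxE bE rmorphB addrC.
  congr (_ + _); rewrite /pairing rmorph_sum -sumrN /=.
  apply: eq_bigr => a _; rewrite [map_mx _ A _ _]mxE AE [map_mx _ (pt p) _ _]mxE.
  by rewrite rmorphM rmorphN mulrN.
rewrite (height_gap _ (local_facetP j).1) mxE /scale (size_gt0 j).
by case: (_ == _); rewrite ?mulr1n ?mulr0n.
Qed.

Lemma closed_unimodular : unimodular_product_of_simplices (hull (fun p => real_mx R (pt p))).
Proof.
have hsv := standard_simplex_labels L p0 scale_gt0.
exists r, local_dim, (simplex_product cl (standard_vertex L p0 scale)); split.
  exact: simplex_product_is_product.
exists A, B, b; split; [exact: AB|exact: (mulmx1C_eq dim_eq AB)|].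
rewrite hull_image product_hull.
have tP p : [forall i, cl (miss p i) == i] by apply/forallP => i; rewrite cl_miss.
pose t p : transversal cl := exist _ (miss p) (tP p).
have t_bij : bijective t.
  apply: inj_card_bij => [p q /(congr1 val)/miss_inj //|].
  rewrite -(card_imset _ (@miss_inj _ _ _ _ _ L)) card_sub; apply: subset_leq_card.
  apply/fintype.subsetP => f /forallP hf; have [p <-] := @miss_onto _ _ _ _ _ L f (fun c => eqP (hf c)).
  exact: imset_f.
rewrite -(hull_bij _ t_bij); congr hull; apply/funext => p /=.
by rewrite chart_pt.
Qed.

End ToUnimodular.

(** * The frontier condition on unimodular products *)

Section FromUnimodular.
Variables (R : realType) (n : nat) (V : finType) (X : smooth_model n V).
Local Notation pt := (pt X).
Local Notation nb := (nb X).
Local Notation len := (len X).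
Local Notation edge := (edge X).
Local Notation rpt := (fun p => real_mx R (pt p)).

(** Carried to the product, v has at each vertex a value that is a sum over the factors. Crossing an
    edge changes one summand, so the direction of the edge is decided by comparing two labels. *)
Lemma unimodular_closed v : unimodular_product_of_simplices (@polytope R n V X) ->
  generic X v -> closed_lower X v.
Proof.
move=> [r [d [Q [/product_labels[FF [cls [sv [hsv ->]]]] [A [B [b [AB BA eQ]]]]]]]] gv.
have hy := product_box hsv; rewrite product_hull in eQ.
pose phi (z : 'rV[R]_n) := z *m real_mx R A + real_mx R b.
pose psi (z : 'rV[R]_(\sum_(i < r) d i)) := (z - real_mx R b) *m real_mx R B.
have rAB : real_mx R A *m real_mx R B = 1%:M by rewrite -real_mxM AB /real_mx map_mx1.
have phiK : cancel phi psi.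
  by move=> z; rewrite /phi /psi addrK -mulmxA rAB mulmx1.
have phi_pair z u : pairing (phi z) (u *m (real_mx R B)^T) =
    pairing z u + pairing (real_mx R b) (u *m (real_mx R B)^T).
  by rewrite /phi pairingDl pairing_mulmx -mulmxA -trmx_mul rAB trmx1 mulmx1.
have pair_phi z u : pairing (phi z) u =
    pairing z (u *m (real_mx R A)^T) + pairing (real_mx R b) u.
  by rewrite /phi pairingDl pairing_mulmx.
pose f (F : set 'rV[R]_n) := (phi @` F)%classic.
have fP : f (hull rpt) = hull (@product_pt R r d FF cls sv) by rewrite eQ.
have f_max u : f (max_face (hull rpt) (u *m (real_mx R A)^T)) =
    max_face (hull (@product_pt R r d FF cls sv)) u.
  rewrite -fP; apply/seteqP; split=> [_ [z [Pz zmax] <-]|_ [[z Pz <-] zmax]].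
    split; first by exists z.
    by move=> _ [z' Pz' <-]; rewrite !pair_phi lerD2r; apply: zmax.
  exists z => //; split=> // z' Pz'.
  have : f (hull rpt) (phi z') by exists z'.
  by move=> /zmax; rewrite !pair_phi lerD2r.
have fface F : is_face (hull rpt) F -> is_face (hull (@product_pt R r d FF cls sv)) (f F).
  move=> [->|[u ->]]; first by left; rewrite /f image_set0.
  right; exists (u *m (real_mx R B)^T); rewrite -[RHS]/(max_face (hull (@product_pt R r d FF cls sv)) _) -f_max.
  by rewrite -mulmxA -trmx_mul rAB trmx1 mulmx1.
have fsub F G : is_face (hull rpt) F -> is_face (hull rpt) G ->
    (F `<=` G)%classic <-> (f F `<=` f G)%classic.
  move=> _ _; split=> [h _ [z Fz <-]|h z Fz]; first by exists z => //; apply: h.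
  by have [z' Gz' /(can_inj phiK) <-] : f G (phi z) by apply: h; exists z.
have fonto G : is_face (hull (@product_pt R r d FF cls sv)) G -> exists2 F, is_face (hull rpt) F & f F = G.
  move=> [->|[u ->]]; first by exists set0; [left|rewrite /f image_set0].
  exists (max_face (hull rpt) (u *m (real_mx R A)^T)); last exact: f_max.
  by right; exists (u *m (real_mx R A)^T).
have [lab hlab labE] := box_transfer (model_exposed R X) hy fface fsub fonto.
have [L [eL eM]] := box_labelling_labelling hlab.
have phi_pt p : exists2 t, phi (rpt p) = @product_pt R r d FF cls sv t & miss L p = val t.
  have [t e1 e2] := labE p; exists t; rewrite ?eM //.
  have : f [set rpt p]%classic (phi (rpt p)) by exists (rpt p).
  by rewrite e1.
pose u := real_mx R v *m (real_mx R B)^T.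
pose mu G := pairing (sv (cls G) G) (submxrow u (cls G)).
have muE p : pairing (phi (rpt p)) u = \sum_i mu (miss L p i).
  have [t -> ->] := phi_pt p; rewrite pairing_product_pt.
  by apply: eq_bigr => i _; rewrite /mu transversal_cl.
apply: (@order_closed_lower _ _ _ _ _ L _ mu) => p i.
have e : (len p i * pairing (edge p i) v)%:~R =
    mu (fac L p i) - mu (miss L p (cl L (fac L p i))).
  rewrite -pairingZl -nb_sub -pairing_real real_mxB pairingBl.
  have -> : pairing (rpt (nb p i)) (real_mx R v) - pairing (rpt p) (real_mx R v) =
      pairing (phi (rpt (nb p i))) u - pairing (phi (rpt p)) u.
    by rewrite !phi_pair opprD addrACA subrr addr0.
  rewrite !muE (bigD1 (cl L (fac L p i))) //=.
  rewrite [X in _ - X](bigD1 (cl L (fac L p i))) //= miss_nb eqxx opprD addrACA.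
  rewrite [X in _ + (X - _)](eq_bigr (fun j => mu (miss L p j))) ?subrr ?addr0 // => j /negPf ji.
  by rewrite miss_nb ji.
by rewrite /down -subr_lt0 -e ltrz0 pmulr_rlt0 ?len_gt0.
Qed.

End FromUnimodular.

(** * Combinatorial products of simplices *)

Section Combinatorial.
Variables (R : realType) (n : nat) (V : finType) (X : smooth_model n V) (p0 : V).

Lemma closed_lower_combinatorial v : generic X v -> closed_lower X v ->
  combinatorial_product_of_simplices (@polytope R n V X).
Proof.
move=> gv cv; have [C [FF [L0]]] := closed_lower_labelling gv cv p0.
pose L := reindex_labelling L0.
(* The combinatorial type does not depend on the sizes of the simplices, which are all taken to be
   1. *)
have hsv := standard_simplex_labels (R := R) (l := fun=> 1) L p0 (fun=> ltr01).
exists #|C|, (local_dim L p0), (simplex_product (cl L) (standard_vertex L p0 (fun=> 1))); split.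
  exact: simplex_product_is_product.
rewrite product_hull.
exact: (box_same_type (labelling_box R L p0) (product_box hsv)).
Qed.

Lemma combinatorial_closed_lower : combinatorial_product_of_simplices (@polytope R n V X) ->
  exists2 v, generic X v & closed_lower X v.
Proof.
move=> [r [d [Q [/product_labels[FF [cls [sv [hsv ->]]]] [f [fface fsub fonto]]]]]].
rewrite product_hull in fface fonto.
have [lab hlab _] := box_transfer (model_exposed R X) (product_box hsv) fface fsub fonto.
have [L _] := box_labelling_labelling hlab.
exact: labelling_closed_lower L.
Qed.

End Combinatorial.

Theorem theoremE (R : realType) (K : closedFieldType) (n : nat)
    (Sigma : set (set 'rV[R]_n)) (P : set 'rV[R]_n)
    (latP : lattice_polytope P)
    (fullP : full_dimensional P)
    (ampleP : Sigma = outer_normal_fan P)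
    (smoothX : smooth_polytope P) :
  ((exists v : 'rV[int]_n, admissible K Sigma v /\ bb_stratification K Sigma v)
     <-> combinatorial_product_of_simplices P) /\
  ((forall v : 'rV[int]_n, admissible K Sigma v -> bb_stratification K Sigma v)
     <-> unimodular_product_of_simplices P).
Proof.
have [V [X eP]] := polytope_model latP smoothX.
have [p0 _] := hull_full eP fullP.
have eSigma : Sigma = fan X by rewrite ampleP eP.
rewrite eSigma eP; split; split.
- move=> [v [/admissible_generic gv /(stratification_closed_lower R K gv) cv]].
  exact: closed_lower_combinatorial gv cv.
- move=> /combinatorial_closed_lower[v gv cv]; exists v.
  by split; [apply/admissible_generic|apply/stratification_closed_lower].
- move=> all_strat.
  have all_closed v : generic X v -> closed_lower X v.
    move=> gv; apply/(stratification_closed_lower R K gv)/all_strat.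
    exact/admissible_generic.
  have [v gv] := exists_generic X.
  have [C [FF [L0]]] := closed_lower_labelling gv (all_closed v gv) p0.
  exact: (closed_unimodular R (reindex_labelling L0) p0 all_closed).
- move=> hP v /admissible_generic gv; apply/stratification_closed_lower => //.
  exact: (unimodular_closed hP gv).
Qed.
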